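(* (a) If $f\in\left\{\frac{n}{\log(n+1)}\right\}^{\#}BV$, then the double Walsh–Fourier series of $f$ converges to $f(x,y)$ at any point $(x,y)\in I^2$ at which $f$ is continuous; that is, $\lim_{M,N\to\infty}S_{M,N}(x,y;f)=f(x,y)$, where $M,N\to\infty$ independently. (b) For an arbitrary sequence of positive numbers $\alpha_n\to\infty$ there exists a continuous function $f\in\left\{\frac{n\alpha_n}{\log(n+1)}\right\}^{\#}BV$ such that the quadratic partial sums $S_{N,N}$ of its double Walsh–Fourier series diverge unboundedly at $(0,0)$, i.e. $\sup_N|S_{N,N}(0,0;f)|=+\infty$.
   Context: Let $I=[0,1)$ and let $f$ be a real measurable function on $I^2=[0,1)^2$. For an interval $\Delta=(a,b)$ with endpoints in $I$ and $x,y\in I$ put $f(\Delta,y)=f(b,y)-f(a,y)$ and $f(x,\Delta)=f(x,b)-f(x,a)$. Let $\Omega$ be the set of all (finite or countable) collections of nonoverlapping intervals in $I$, each ordered (indexed) in an arbitrary way. For a sequence of positive numbers $\Lambda=\{\lambda_n\}_{n=1}^\infty$ define $$\Lambda^{\#}V_1(f)=\sup_{\{y_i\}\subset I}\ \sup_{\{I_i\}\in\Omega}\sum_i\frac{|f(I_i,y_i)|}{\lambda_i},\qquad \Lambda^{\#}V_2(f)=\sup_{\{x_j\}\subset I}\ \sup_{\{J_j\}\in\Omega}\sum_j\frac{|f(x_j,J_j)|}{\lambda_j}.$$ The class $\Lambda^{\#}BV$ consists of all $f$ with $\Lambda^{\#}V_1(f)+\Lambda^{\#}V_2(f)<\infty$.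 Walsh system: $r_0$ is the 1-periodic function equal to $1$ on $[0,1/2)$ and $-1$ on $[1/2,1)$; $r_n(x)=r_0(2^nx)$. Put $w_0=1$ and, for $k=2^{n_1}+\cdots+2^{n_s}$ with $n_1>\cdots>n_s\ge 0$, $w_k(x)=r_{n_1}(x)\cdots r_{n_s}(x)$. For $f\in L^1(I^2)$, $\hat f(n,m)=\int_{I^2}f(x,y)w_n(x)w_m(y)\,dx\,dy$ and the rectangular partial sums are $$S_{M,N}(x,y;f)=\sum_{m=0}^{M-1}\sum_{n=0}^{N-1}\hat f(m,n)w_m(x)w_n(y).$$ Convergence of the double series means convergence of rectangular partial sums. Dyadic addition: every $x\in I$ is written $x=\sum_{k\ge0}x_k2^{-(k+1)}$, $x_k\in\{0,1\}$, choosing for dyadic rationals the expansion with $x_k\to0$; then $x\dotplus y=\sum_{k\ge0}|x_k-y_k|2^{-(k+1)}$. In (a), $f$ is said to be continuous at $(x,y)$ if $\lim_{h,\delta\to0}f(x\dotplus h,y\dotplus\delta)=f(x,y)$ (with $h,\delta\in I$ such that the point $(x\dotplus h,y\dotplus\delta)$ lies in $I^2$). In (b), a continuous function is an element of $C(I^2)$, i.e. continuous on $I^2$ in the usual sense. *)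

(* Defs.v *)
From HB Require Import structures.
From mathcomp Require Import all_boot all_order all_algebra.
From mathcomp Require Import all_classical all_reals all_analysis.
From mathcomp Require Import measurable_realfun.

Set Implicit Arguments.
Unset Strict Implicit.
Unset Printing Implicit Defensive.

Import Order.TTheory GRing.Theory Num.Theory.
Import numFieldNormedType.Exports.

Local Open Scope classical_set_scope.
Local Open Scope ring_scope.

Definition unitI {R : realType} : set R := `[0, 1[%classic.

Definition unitI2 {R : realType} : set (R * R) := unitI `*` unitI.

Definition leb2 {R : realType} :
    {measure set (measurableTypeR R * measurableTypeR R) -> \bar R} :=
  (lebesgue_measure \x lebesgue_measure)%E.

(* [leb2] lives on the Borel sigma-algebra; Lebesgue measurability is
   measurability for its completion. *)
Definition lebesgue_measurable_fun {R : realType} (D : set (R * R))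
    (f : R * R -> R) : Prop :=
  @measurable_fun _ _ (g_sigma_algebraType (completed_algebra_gen (@leb2 R)))
    (measurableTypeR R) D f.

(* An indexed collection of intervals is a pair [(D, e)]: [D] is the set of
   indices and the i-th interval is the open interval from [(e i).1] to
   [(e i).2]. The index [i : nat] stands for the paper's index [i + 1]. *)
Definition Omega {R : realType} : set (set nat * (nat -> R * R)) :=
  [set c | [/\ c.1 = setT \/ (exists n, c.1 = `I_n),
    forall i, c.1 i ->
      [/\ unitI (c.2 i).1, unitI (c.2 i).2 & (c.2 i).1 < (c.2 i).2] &
    trivIset c.1 (fun i => `](c.2 i).1, (c.2 i).2[%classic : set R)]].

Definition sharpV1 {R : realType} (lambda : nat -> R) (f : R * R -> R) :
    \bar R :=
  ereal_sup [set ereal_sup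
    [set \esum_(i in c.1)
           (`|f ((c.2 i).2, y i) - f ((c.2 i).1, y i)| / lambda i.+1)%:E
     | c in Omega]
   | y in [set y : nat -> R | forall i, unitI (y i)]].

Definition sharpV2 {R : realType} (lambda : nat -> R) (f : R * R -> R) :
    \bar R :=
  ereal_sup [set ereal_sup
    [set \esum_(j in c.1)
           (`|f (x j, (c.2 j).2) - f (x j, (c.2 j).1)| / lambda j.+1)%:E
     | c in Omega]
   | x in [set x : nat -> R | forall j, unitI (x j)]].

(* Only the values [lambda n] with [n >= 1] matter. *)
Definition sharpBV {R : realType} (lambda : nat -> R) (f : R * R -> R) : Prop :=
  lebesgue_measurable_fun unitI2 f /\
  (sharpV1 lambda f + sharpV2 lambda f < +oo)%E.

Definition rademacher0 {R : realType} (x : R) : R :=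
  if x - (Num.floor x)%:~R < 2^-1 then 1 else -1.

Definition rademacher {R : realType} (n : nat) (x : R) : R :=
  rademacher0 (2 ^+ n * x).

(* The product runs over the positions [j] of the binary digits 1 of [k]; they
   all satisfy [j < k]. *)
Definition walsh {R : realType} (k : nat) (x : R) : R :=
  \prod_(j < k | odd (k %/ 2 ^ j)) rademacher j x.

(* The integral of a Lebesgue measurable function against the Borel measure
   [leb2] is its Lebesgue integral, integrals of nonnegative functions being
   defined as suprema over the measurable simple functions below them. *)
Definition walsh_coef {R : realType} (f : R * R -> R) (n m : nat) : R :=
  \int[leb2]_(z in unitI2) (f z * walsh n z.1 * walsh m z.2).

Definition walsh_sum {R : realType} (f : R * R -> R) (M N : nat) (x y : R) : R :=
  \sum_(m < M) \sum_(n < N) walsh_coef f m n * walsh m x * walsh n y.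

(* For [x] in [0, 1): the digits of the binary expansion of [x] that has
   infinitely many digits 0. *)
Definition bindigit {R : realType} (x : R) (k : nat) : nat :=
  odd `|Num.floor (2 ^+ k.+1 * x)|%N.

Definition dyadic_add {R : realType} (x y : R) : R :=
  limn (series (fun k : nat =>
    `|(bindigit x k)%:R - (bindigit y k)%:R| / 2 ^+ k.+1 : R)).

Definition dyadic_continuous_at {R : realType} (f : R * R -> R) (x y : R) :
    Prop :=
  f (dyadic_add x h.1, dyadic_add y h.2)
    @[h --> within [set h : R * R | unitI2 h /\
                      unitI2 (dyadic_add x h.1, dyadic_add y h.2)]
              (nbhs ((0, 0) : R * R))] --> f (x, y).

(* Main.v *)
Require Import Defs.
From HB Require Import structures.
From mathcomp Require Import all_boot all_order all_algebra.
From mathcomp Require Import all_classical all_reals all_analysis.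
From mathcomp Require Import measurable_realfun ring lra zify.

Set Implicit Arguments.
Unset Strict Implicit.
Unset Printing Implicit Defensive.

Import Order.TTheory GRing.Theory Num.Theory.
Import numFieldNormedType.Exports.

Local Open Scope classical_set_scope.
Local Open Scope ring_scope.

(** The partial sum at (x, y) of orders M and N is the integral of f against
    D_M(x, .) D_N(y, .), where D_M(x, s) is the sum over k < M of
    w_k(x) w_k(s). For 2^m <= M < 2^(m+1) write M = 2^m + M'. The kernel of
    order 2^m averages over the dyadic cell of rank m around x; the rest is a
    Rademacher function times the kernel of order M', which is constant on the
    cells of rank m. Hence a partial sum is, in each variable, the average over
    the cell of x plus a combination of differences of f between the two halves
    of the cells of rank m, in which the cell at distance d from the cell of x
    has a coefficient at most 1/d (kernel_split). These identities hold for the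
    values of f on every translate of the grid, and the partial sum is the
    mean over all translates (walsh_sum_average), so that pointwise estimates
    of finite sums suffice.

    In the double sum the terms at distances d and d' carry the factor
    1/(d d'). If d' <= d, the mixed difference is bounded by two differences in
    the first variable alone, and the sum of 1/d' over d' <= d is about log d.
    What remains is the sum of (log d / d) |f(I_d, y_d)|, which is precisely a
    sum of the kind that the first variation controls; the case d < d' is
    symmetric (mixed_sum_le). The part with both distances below a constant K
    is small by continuity, and the part beyond K is small for two reasons
    (tail_small): close to x, packings of intervals with non-negligible
    variation could be put together infinitely often (small_wvar_near), and far
    from x all weights are of order (log 2^m)/2^m, whereas the sum of the jumps
    over all 2^m cells is at most of order 2^m/(log 2^m)^2 (sum_jump_le).
    Bounded variation also gives one-sided limits in each variable, uniformly
    in the other one. Therefore f is Borel (log_var_borel), and continuity with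
    respect to dyadic addition, which says nothing about some points of a
    cell, yields small oscillation on whole cells (dyadic_continuous_cells).

    For the second part let M have the binary digits 1 0 1 0 ... 1, so that the
    L1 norm of the kernel of order M is of order log M (bad_order_norm), and let
    g be a continuous sawtooth on the cells of M with the signs of the kernel.
    The partial sum of order M of g(x) g(y) at the origin is the square of a
    quantity of order log M, whereas its variation, g having Q teeth, is at
    most twice the sum of the first Q weights, taken with a nondecreasing
    minorant of alpha; this sum is o(log^2 Q) because alpha tends to infinity.
    Dividing by that sum gives functions of variation at
    most 2 with unbounded Walsh sums (peak_unbounded). They are Lipschitz, so
    that by the first part the Walsh sums of each of them are bounded, and a
    gliding hump argument (gliding_hump) adds them up to a single example. *)

(** * Dyadic cells, Walsh functions and Walsh kernels *)

Definition in_cell {R : realType} (p i : nat) (x : R) : Prop :=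
  i%:R <= 2 ^+ p * x < i.+1%:R.

Lemma in_cell_coarse (R : realType) (p q i : nat) (x : R) :
  in_cell (p + q) i x -> in_cell p (i %/ 2 ^ q)%N x.
Proof.
rewrite /in_cell => /andP[h1 h2].
have q0 : 0 < 2 ^+ q :> R by rewrite exprn_gt0.
apply/andP; split.
  rewrite -(ler_pM2l q0) mulrA -exprD addnC (le_trans _ h1)// -natrX -natrM.
  by rewrite ler_nat mulnC leq_divM.
rewrite -(ltr_pM2l q0) mulrA -exprD addnC (lt_le_trans h2)// -natrX -natrM.
by rewrite ler_nat mulnC ltn_ceil// expn_gt0.
Qed.

Lemma in_cell_inj (R : realType) (p i j : nat) (x : R) :
  in_cell p i x -> in_cell p j x -> i = j.
Proof.
move=> /andP[a b] /andP[c d].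
have /[!ltr_nat] ij := le_lt_trans a d; have /[!ltr_nat] ji := le_lt_trans c b.
by apply/eqP; rewrite eqn_leq -ltnS ij -ltnS ji.
Qed.

Lemma in_cell_exists (R : realType) (p : nat) (x : R) : unitI x ->
  exists2 i, (i < 2 ^ p)%N & in_cell p i x.
Proof.
rewrite /unitI/= in_itv/= => /andP[x0 x1].
have px0 : 0 <= 2 ^+ p * x by rewrite mulr_ge0// exprn_ge0.
exists (Num.truncn (2 ^+ p * x)).
  rewrite -(ltr_nat R) (@le_lt_trans _ _ (2 ^+ p * x)) ?truncn_le//.
  by rewrite natrX gtr_pMr// exprn_gt0.
by rewrite /in_cell truncn_itv.
Qed.

(** With i = 2 q + b, the integer part of 2^j x is q, and b tells in which
    half the fractional part lies. *)
Lemma rademacher_cell (R : realType) (j i : nat) (x : R) :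
  in_cell j.+1 i x -> rademacher j x = (-1) ^+ odd i.
Proof.
rewrite /in_cell exprS -mulrA => /andP[h1 h2].
rewrite /rademacher /rademacher0; set y := 2 ^+ j * x in h1 h2 *.
have hi : i%:R = (odd i)%:R + 2 * (i./2)%:R :> R.
  by rewrite -{1}(odd_double_half i) natrD -mul2n natrM.
rewrite hi in h1; rewrite -[i.+1%:R]natr1 hi in h2.
have -> : Num.floor y = i./2%:Z.
  apply: floor_def; rewrite intrD -!pmulrn.
  by case: (odd i) h1 h2 => /= h1 h2; apply/andP; split; lra.
rewrite -pmulrn.
case: (odd i) h1 h2 => /= h1 h2; case: ifP => // /negP h3; exfalso.
- lra.
- by apply: h3; lra.
Qed.

Lemma walsh_bits (R : realType) (J k : nat) (x : R) : (k < 2 ^ J)%N ->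
  walsh k x = \prod_(j < J | odd (k %/ 2 ^ j)) rademacher j x.
Proof.
have widen A B : (A <= B)%N -> (k < 2 ^ A)%N ->
    \prod_(j < B | odd (k %/ 2 ^ j)) rademacher j x =
    \prod_(j < A | odd (k %/ 2 ^ j)) rademacher j x :> R.
  move=> AB kA; rewrite [RHS](big_ord_widen_cond B (fun j => odd (k %/ 2 ^ j))
    (fun j => rademacher j x))//.
  apply: eq_bigl => j; case: (ltnP j A); rewrite ?andbT// andbF => Aj.
  by rewrite divn_small// (leq_trans kA)// leq_exp2l.
move=> kJ.
have kk : (k < 2 ^ k)%N by rewrite ltn_expl.
transitivity (\prod_(j < maxn k J | odd (k %/ 2 ^ j)) rademacher j x).
  by symmetry; exact: (widen k (maxn k J) (leq_maxl _ _) kk).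
exact: (widen J (maxn k J) (leq_maxr _ _) kJ).
Qed.

Lemma walsh_exp2 (R : realType) (k : nat) (x : R) :
  walsh (2 ^ k) x = rademacher k x.
Proof.
rewrite (@walsh_bits _ k.+1) ?ltn_exp2l// big_mkcond big_ord_recr/= big1 ?mul1r.
  by rewrite divnn expn_gt0.
move=> [j jk] _ /=; case: ifP => //; rewrite -(subnKC (ltnW jk)) expnD.
rewrite mulKn ?expn_gt0// oddX/= orbF.
by rewrite subn_eq0 leqNgt jk.
Qed.

(** The binary digits of a 2^k + n are those of n below place k and those of a
    2^k from place k on. *)
Lemma walsh_add (R : realType) (k a n : nat) (x : R) : (n < 2 ^ k)%N ->
  walsh (a * 2 ^ k + n) x = walsh n x * walsh (a * 2 ^ k) x.
Proof.
move=> nk; pose J := (a * 2 ^ k + n)%N.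
have JJ : (J < 2 ^ J)%N by rewrite ltn_expl.
rewrite !(@walsh_bits _ J) ?(leq_ltn_trans _ JJ) ?leq_addr ?leq_addl//.
rewrite !(big_mkcond (fun _ => odd _)) -big_split/=; apply: eq_bigr => j _.
have [jk|kj] := ltnP j k.
  have -> : (2 ^ k = 2 ^ (k - j) * 2 ^ j)%N by rewrite -expnD subnK// ltnW.
  rewrite mulnA divnMDl ?expn_gt0// mulnK ?expn_gt0// oddD.
  have -> : odd (a * 2 ^ (k - j)) = false.
    by rewrite oddM oddX/= orbF subn_eq0 leqNgt jk andbF.
  by rewrite /= mulr1.
have -> : (n %/ 2 ^ j = 0)%N.
  by rewrite divn_small// (leq_trans nk)// leq_exp2l.
rewrite -(subnKC kj) expnD !divnMA mulnK ?expn_gt0//.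
by rewrite divnMDl ?expn_gt0// (divn_small nk) addn0 mul1r.
Qed.

Lemma rademacher_scale (R : realType) (k j : nat) (x : R) :
  rademacher j (2 ^+ k * x) = rademacher (k + j) x.
Proof. by rewrite /rademacher mulrA -exprD addnC. Qed.

Lemma walsh_scale (R : realType) (k a : nat) (x : R) :
  walsh (a * 2 ^ k) x = walsh a (2 ^+ k * x).
Proof.
have Ja : (a < 2 ^ a)%N by rewrite ltn_expl.
rewrite (@walsh_bits _ (k + a)); last first.
  by rewrite addnC expnD ltn_pmul2r ?expn_gt0.
rewrite big_mkcond big_split_ord/= big1 ?mul1r => [|[j jk] _ /=]; last first.
  rewrite -(subnK (ltnW jk)) expnD mulnA mulnK ?expn_gt0//.
  by rewrite oddM oddX/= orbF subn_eq0 leqNgt jk andbF.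
rewrite -big_mkcond/=; apply: eq_big => [j|j _].
  by rewrite expnD divnMA mulnK ?expn_gt0.
by rewrite rademacher_scale.
Qed.

Lemma normr_rademacher (R : realType) (j : nat) (x : R) : `|rademacher j x| = 1.
Proof. by rewrite /rademacher /rademacher0; case: ifP; rewrite ?normrN normr1. Qed.

Lemma normr_walsh (R : realType) (k : nat) (x : R) : `|walsh k x| = 1.
Proof. by rewrite /walsh normr_prod big1// => j _; rewrite normr_rademacher. Qed.

Lemma walsh_at0 (R : realType) (k : nat) : walsh k (0 : R) = 1.
Proof.
rewrite /walsh big1// => j _.
by rewrite (@rademacher_cell _ _ 0)// /in_cell mulr0 lexx ltr01.
Qed.

Lemma walsh_cell (R : realType) (p k i : nat) (x y : R) : (k < 2 ^ p)%N ->
  in_cell p i x -> in_cell p i y -> walsh k x = walsh k y.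
Proof.
move=> kp xi yi; rewrite !(walsh_bits _ kp); apply: eq_bigr => j _.
have jp : (p = j.+1 + (p - j.+1))%N by rewrite subnKC.
by rewrite !(@rademacher_cell _ j (i %/ 2 ^ (p - j.+1)))//;
  apply: in_cell_coarse; rewrite -jp.
Qed.

Definition walsh_kernel {R : realType} (M : nat) (x s : R) : R :=
  \sum_(k < M) walsh k x * walsh k s.

Lemma walsh_kernelD (R : realType) (k a n : nat) (x s : R) : (n <= 2 ^ k)%N ->
  walsh_kernel (a * 2 ^ k + n) x s = walsh_kernel (a * 2 ^ k) x s +
    walsh (a * 2 ^ k) x * walsh (a * 2 ^ k) s * walsh_kernel n x s.
Proof.
move=> nk; rewrite {1}/walsh_kernel big_split_ord/=; congr (_ + _).
rewrite /walsh_kernel mulr_sumr; apply: eq_bigr => i _.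
by rewrite !walsh_add ?(leq_trans (ltn_ord i))//; ring.
Qed.

(** The functions of orders 2^k to 2^(k+1) - 1 are the preceding ones times
    the k-th Rademacher function. *)
Lemma walsh_kernel_exp2S (R : realType) (k : nat) (x s : R) :
  walsh_kernel (2 ^ k.+1) x s =
  (1 + rademacher k x * rademacher k s) * walsh_kernel (2 ^ k) x s.
Proof.
rewrite expnS mul2n -addnn -{1}(mul1n (2 ^ k)%N) walsh_kernelD// mul1n.
by rewrite !walsh_exp2; ring.
Qed.

Lemma walsh_kernel_same (R : realType) (k i : nat) (x s : R) :
  in_cell k i x -> in_cell k i s -> walsh_kernel (2 ^ k) x s = 2 ^+ k.
Proof.
elim: k i => [|k IH] i xi si.
  by rewrite /walsh_kernel big_ord1 /walsh !big_ord0 mulr1.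
rewrite walsh_kernel_exp2S !(rademacher_cell xi) (rademacher_cell si).
rewrite -addn1 in xi si.
rewrite (IH _ (in_cell_coarse xi) (in_cell_coarse si)).
by case: (odd i); rewrite /= ?expr0 ?expr1 exprS; ring.
Qed.

Lemma walsh_kernel_diff (R : realType) (k i j : nat) (x s : R) :
  (i < 2 ^ k)%N -> (j < 2 ^ k)%N ->
  in_cell k i x -> in_cell k j s -> i <> j -> walsh_kernel (2 ^ k) x s = 0.
Proof.
elim: k i j => [|k IH] i j; first by rewrite expn0 !ltnS !leqn0 => /eqP-> /eqP->.
move=> ik jk xi sj ij; rewrite walsh_kernel_exp2S.
rewrite (rademacher_cell xi) (rademacher_cell sj).
rewrite -addn1 in xi sj.
have [e|/eqP ne] := eqVneq (i %/ 2)%N (j %/ 2)%N; last first.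
  by rewrite (IH _ _ _ _ (in_cell_coarse xi) (in_cell_coarse sj)) ?mulr0//;
    rewrite ltn_divLR -?expnSr.
have : odd i <> odd j.
  move=> o; apply: ij.
  by rewrite -(odd_double_half i) -(odd_double_half j) o -!divn2 e.
by case: (odd i); case: (odd j) => //= _; rewrite ?expr0 ?expr1; ring.
Qed.

Lemma walsh_kernel_le (R : realType) (M : nat) (x s : R) :
  `|walsh_kernel M x s| <= M%:R.
Proof.
apply: (le_trans (ler_norm_sum _ _ _)).
rewrite (eq_bigr (fun=> 1)) ?sumr_const ?card_ord// => i _.
by rewrite normrM !normr_walsh mulr1.
Qed.

(** Complete blocks of 2^k consecutive Walsh functions cancel between two
    different cells of rank k, so only the incomplete last block counts. *)
Lemma walsh_kernel_diff_le (R : realType) (k i j M : nat) (x s : R) :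
  (i < 2 ^ k)%N -> (j < 2 ^ k)%N ->
  in_cell k i x -> in_cell k j s -> i <> j -> `|walsh_kernel M x s| <= 2 ^+ k.
Proof.
move=> ik jk xi sj ij.
have block a : walsh_kernel (a * 2 ^ k) x s = 0.
  elim: a => [|a IH]; first by rewrite /walsh_kernel mul0n big_ord0.
  rewrite mulSn addnC walsh_kernelD// IH add0r.
  by rewrite (walsh_kernel_diff ik jk xi sj ij) mulr0.
rewrite {1}(divn_eq M (2 ^ k)) walsh_kernelD; last first.
  by rewrite ltnW// ltn_mod expn_gt0.
rewrite block add0r normrM normrM !normr_walsh !mul1r.
rewrite (le_trans (walsh_kernel_le _ _ _))// -natrX ler_nat.
by rewrite ltnW// ltn_mod expn_gt0.
Qed.

(** * Bounded Borel functions on the square *)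

Lemma measurable_addr (R : realType) (u : R) :
  measurable_fun [set: measurableTypeR R]
    ((fun x => x + u) : measurableTypeR R -> measurableTypeR R).
Proof. by apply: measurable_funD => //; exact: measurable_id. Qed.

Lemma lebesgue_measure_shift (R : realType) (u : R)
    (A : set (measurableTypeR R)) : measurable A ->
  lebesgue_measure ((fun x => x + u) @^-1` A) = lebesgue_measure A.
Proof.
move=> mA.
rewrite -[LHS]/(pushforward lebesgue_measure
  ((fun x => x + u) : measurableTypeR R -> measurableTypeR R) A).
apply/esym/lebesgue_measure_unique => //=; first exact: measurable_addr.
move=> mu _ [[a b]] _ <-; rewrite /pushforward/=.
rewrite (_ : _ @^-1` _ = `]a - u, b - u]%classic); last first.
  by apply/seteqP; split=> x /=; rewrite !in_itv/= => /andP[h1 h2];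
    apply/andP; split; lra.
rewrite !lebesgue_measure_itv/= !lte_fin ltrBlDr subrK.
by case: ifP => // _; congr (_%:E); ring.
Qed.

Definition shift2 {R : realType} (u v : R)
    (z : measurableTypeR R * measurableTypeR R) :
  measurableTypeR R * measurableTypeR R := (z.1 + u, z.2 + v).

Lemma measurable_shift2 (R : realType) (u v : R) :
  measurable_fun [set: measurableTypeR R * measurableTypeR R] (shift2 u v).
Proof.
apply: measurable_fun_pair.
- by apply: measurable_funD => //; exact: measurable_fst.
- by apply: measurable_funD => //; exact: measurable_snd.
Qed.

Lemma leb2_shift (R : realType) (u v : R)
    (A : set (measurableTypeR R * measurableTypeR R)) : measurable A ->
  leb2 (shift2 u v @^-1` A) = leb2 A.
Proof.
move=> mA; rewrite -[LHS]/(pushforward leb2 (shift2 u v) A).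
apply/esym/product_measure_unique => //=; first exact: measurable_shift2.
move=> muv B C mB mC; rewrite /pushforward.
rewrite (_ : _ @^-1` _ = ((fun x => x + u) @^-1` B) `*`
  ((fun x => x + v) @^-1` C)); last by apply/seteqP; split.
rewrite product_measure1E; last 2 first.
- by rewrite -[X in measurable X]setTI; exact: measurable_addr.
- by rewrite -[X in measurable X]setTI; exact: measurable_addr.
congr (_ * _)%E; exact: lebesgue_measure_shift.
Qed.

Definition cell {R : realType} (p i : nat) : set R := [set x | in_cell p i x].

Definition cell2 {R : realType} (p q i j : nat) :
    set (measurableTypeR R * measurableTypeR R) :=
  (cell p i : set R) `*` (cell q j : set R).

Lemma in_cellE (R : realType) (p i : nat) (x : R) :
  in_cell p i x <-> i%:R / 2 ^+ p <= x < i.+1%:R / 2 ^+ p.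
Proof.
have p0 : 0 < 2 ^+ p :> R by rewrite exprn_gt0.
by rewrite /in_cell ler_pdivrMr// ltr_pdivlMr// mulrC.
Qed.

Lemma in_cell_left (R : realType) (p i : nat) :
  in_cell p i (i%:R / 2 ^+ p : R).
Proof.
apply/in_cellE.
by rewrite lexx ltr_pM2r ?invr_gt0 ?exprn_gt0// ltr_nat ltnSn.
Qed.

Lemma in_cell_double (R : realType) (m i b : nat) (z : R) : (b < 2)%N ->
  in_cell m.+1 (i.*2 + b) z -> in_cell m i z.
Proof.
move=> b2 h; have -> : i = ((i.*2 + b) %/ 2 ^ 1)%N.
  by rewrite -muln2 divnMDl// divn_small// addn0.
by apply: in_cell_coarse; rewrite addn1.
Qed.

Lemma in_cell_translate (R : realType) (m a : nat) (z : R) :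
  in_cell m a (z + a%:R / 2 ^+ m) <-> in_cell m 0 z.
Proof.
rewrite /in_cell mulrDr [2 ^+ m * (_ / _)]mulrC mulfVK ?expf_neq0//.
by rewrite -[a.+1%:R]natr1; split=> /andP[h1 h2]; apply/andP; split; lra.
Qed.

Lemma in_cell_shift (R : realType) (m a : nat) (z : R) :
  in_cell m 0 z -> in_cell m a (z + a%:R / 2 ^+ m).
Proof. by move/(in_cell_translate m a z).2. Qed.

Lemma unitI0 (R : realType) : unitI (0 : R).
Proof. by rewrite /unitI/= in_itv/= lexx ltr01. Qed.

Lemma cell_itv (R : realType) (p i : nat) :
  cell p i = `[i%:R / 2 ^+ p, i.+1%:R / 2 ^+ p[%classic :> set R.
Proof. by apply/seteqP; split=> x; rewrite /cell/= in_itv/= in_cellE. Qed.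

Lemma measurable_cell (R : realType) (p i : nat) :
  measurable (cell p i : set (measurableTypeR R)).
Proof. by rewrite cell_itv; exact: measurable_itv. Qed.

Lemma measurable_cell2 (R : realType) (p q i j : nat) :
  measurable (@cell2 R p q i j).
Proof. by apply: measurableX; exact: measurable_cell. Qed.

Lemma lebesgue_cell (R : realType) (p i : nat) :
  lebesgue_measure (cell p i : set (measurableTypeR R)) = (2 ^- p)%:E.
Proof.
have p0 : 0 < 2 ^- p :> R by rewrite invr_gt0 exprn_gt0.
rewrite cell_itv lebesgue_measure_itv/= lte_fin ltr_pM2r// ltr_nat ltnSn.
by rewrite -EFinB -mulrBl -natr1 addrAC subrr add0r mul1r.
Qed.

Lemma leb2_cell2 (R : realType) (p q i j : nat) :
  leb2 (@cell2 R p q i j) = (2 ^- p * 2 ^- q)%:E.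
Proof.
apply: (etrans (product_measure1E _ _ (@measurable_cell R p i)
  (@measurable_cell R q j))).
by rewrite EFinM; congr (_ * _)%E; exact: lebesgue_cell.
Qed.

Lemma unitI_cell (R : realType) : unitI = cell 0 0 :> set R.
Proof. by rewrite cell_itv /unitI mul0r expr0 divr1. Qed.

Lemma unitI2_cell2 (R : realType) : unitI2 = @cell2 R 0 0 0 0.
Proof. by rewrite /unitI2 unitI_cell. Qed.

Lemma measurable_unitI2 (R : realType) :
  measurable (unitI2 : set (measurableTypeR R * measurableTypeR R)).
Proof. by rewrite unitI2_cell2; exact: measurable_cell2. Qed.

Lemma leb2_unitI2 (R : realType) : leb2 (@unitI2 R) = 1%E.
Proof. by rewrite unitI2_cell2 leb2_cell2 expr0 invr1 mulr1. Qed.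

Lemma cell_unitI (R : realType) (p i : nat) : (i < 2 ^ p)%N ->
  cell p i `<=` (@unitI R).
Proof.
move=> ip x; rewrite /cell/= unitI_cell/cell/= => h.
rewrite -[p]add0n in h; have := in_cell_coarse h.
by rewrite divn_small.
Qed.

Definition bounded_borel {R : realType} (D : set (R * R)) (f : R * R -> R) :=
  measurable_fun (D : set (measurableTypeR R * measurableTypeR R))
    (f : _ -> measurableTypeR R) /\
  exists C, forall z, D z -> `|f z| <= C.

Lemma bounded_borelS (R : realType) (D E : set (R * R)) (f : R * R -> R) :
  measurable (D : set (measurableTypeR R * measurableTypeR R)) ->
  E `<=` D -> bounded_borel D f -> bounded_borel E f.
Proof.
move=> mD ED [mf [C fC]]; split; first exact: measurable_funS mf.
by exists C => z /ED; exact: fC.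
Qed.

Lemma bounded_borelD (R : realType) (D : set (R * R)) (f g : R * R -> R) :
  bounded_borel D f -> bounded_borel D g -> bounded_borel D (fun z => f z + g z).
Proof.
move=> [mf [C fC]] [mg [B gB]]; split; first exact: measurable_funD.
by exists (C + B) => z Dz; rewrite (le_trans (ler_normD _ _))// lerD// ?fC ?gB.
Qed.

Lemma bounded_borel_cst (R : realType) (D : set (R * R)) (c : R) :
  bounded_borel D (fun=> c).
Proof. by split; [exact: measurable_cst | exists `|c|]. Qed.

Lemma bounded_borelM (R : realType) (D : set (R * R)) (f g : R * R -> R) :
  bounded_borel D f -> bounded_borel D g -> bounded_borel D (fun z => f z * g z).
Proof.
move=> [mf [C fC]] [mg [B gB]]; split; first exact: measurable_funM.
by exists (C * B) => z Dz; rewrite normrM ler_pM// ?fC ?gB.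
Qed.

Lemma bounded_borelZ (R : realType) (D : set (R * R)) (c : R) (f : R * R -> R) :
  bounded_borel D f -> bounded_borel D (fun z => c * f z).
Proof. by move=> fD; apply: bounded_borelM => //; exact: bounded_borel_cst. Qed.

Lemma bounded_borel_sum (R : realType) (D : set (R * R)) (I : Type) (s : seq I)
    (f : I -> R * R -> R) : (forall i, bounded_borel D (f i)) ->
  bounded_borel D (fun z => \sum_(i <- s) f i z).
Proof.
move=> fD; elim: s => [|i s IH].
  rewrite (_ : (fun _ => _) = fun=> 0); first exact: bounded_borel_cst.
  by apply/funext => z; rewrite big_nil.
rewrite (_ : (fun _ => _) = fun z => f i z + \sum_(j <- s) f j z).
  exact: bounded_borelD.
by apply/funext => z; rewrite big_cons.
Qed.

Lemma bounded_borel_integrable (R : realType) (D : set (R * R))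
    (f : R * R -> R) :
  measurable (D : set (measurableTypeR R * measurableTypeR R)) ->
  (leb2 D < +oo)%E -> bounded_borel D f -> leb2.-integrable D (EFin \o f).
Proof.
move=> mD Doo [mf [C fC]]; apply: measurable_bounded_integrable => //.
exists C; split; first exact: num_real.
by move=> M CM z Dz /=; rewrite (le_trans (fC _ Dz))// ltW.
Qed.

Lemma Rintegral_sum (R : realType) (D : set (R * R)) (I : Type) (s : seq I)
    (f : I -> R * R -> R) :
  measurable (D : set (measurableTypeR R * measurableTypeR R)) ->
  (leb2 D < +oo)%E -> (forall i, bounded_borel D (f i)) ->
  \int[leb2]_(z in D) (\sum_(i <- s) f i z) =
  \sum_(i <- s) \int[leb2]_(z in D) f i z.
Proof.
move=> mD Doo fD; elim: s => [|i s IH].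
  rewrite big_nil (@eq_Rintegral _ _ _ _ _ (fun=> 0)) ?Rintegral_cst ?mul0r// => z _.
  by rewrite big_nil.
rewrite big_cons -IH -RintegralD//; last 2 first.
- exact: bounded_borel_integrable.
- by apply: bounded_borel_integrable => //; exact: bounded_borel_sum.
by apply: eq_Rintegral => z _; rewrite big_cons.
Qed.

(** * Partial sums as averages of finite sums *)

Lemma cell2_unitI2 (R : realType) (p q i j : nat) :
  (i < 2 ^ p)%N -> (j < 2 ^ q)%N -> @cell2 R p q i j `<=` @unitI2 R.
Proof.
move=> ip jq [x y] [h1 h2].
by split; [exact: cell_unitI ip _ h1 | exact: cell_unitI jq _ h2].
Qed.

Lemma shift2_cell (R : realType) (p q i j : nat) :
  shift2 (i%:R / 2 ^+ p) (j%:R / 2 ^+ q) @^-1` cell2 p q i j =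
  @cell2 R p q 0 0.
Proof.
apply/seteqP; split=> -[x y] [h1 h2].
  by split; [exact: (in_cell_translate p i x).1 h1 |
             exact: (in_cell_translate q j y).1 h2].
by split; [exact: (in_cell_translate p i x).2 h1 |
           exact: (in_cell_translate q j y).2 h2].
Qed.

Lemma integral_cell_shift (R : realType) (f : R * R -> R) (p q i j : nat) :
  bounded_borel unitI2 f -> (i < 2 ^ p)%N -> (j < 2 ^ q)%N ->
  \int[leb2]_(z in cell2 p q i j) f z =
  \int[leb2]_(z in cell2 p q 0 0) f (shift2 (i%:R / 2 ^+ p) (j%:R / 2 ^+ q) z).
Proof.
move=> [mf [C fC]] ip jq; set phi := shift2 _ _.
have sub : @cell2 R p q i j `<=` @unitI2 R.
  exact: cell2_unitI2.
pose g : measurableTypeR R * measurableTypeR R -> R := f \_ unitI2.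
have gE z : cell2 p q i j z -> g z = f z.
  by move=> /sub h; rewrite /g patchE mem_set.
have mg : measurable_fun setT (g : _ -> measurableTypeR R).
  exact: (measurable_restrictT _ (@measurable_unitI2 R)).1.
transitivity (\int[leb2]_(z in cell2 p q i j) g z).
  by apply: eq_Rintegral => z /set_mem /gE.
transitivity (\int[leb2]_(z in cell2 p q 0 0) g (phi z)); last first.
  apply: eq_Rintegral => z /set_mem; rewrite -(shift2_cell R p q i j) => h.
  by rewrite gE.
have mphi : measurable_fun setT phi by exact: measurable_shift2.
rewrite /Rintegral; congr fine.
rewrite -(shift2_cell R p q i j) -/phi.
have mEg : measurable_fun setT (EFin \o g) by exact/measurable_EFinP.
have intg : leb2.-integrable (phi @^-1` cell2 p q i j) ((EFin \o g) \o phi).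
  apply: (@bounded_borel_integrable _ _ (g \o phi)).
  - by rewrite shift2_cell; exact: measurable_cell2.
  - by rewrite shift2_cell leb2_cell2 ltry.
  - split; first by apply: measurable_funTS; exact: measurableT_comp.
    by exists C => z h; rewrite /= gE//; exact/fC/sub.
apply: etrans (integral_pushforward mphi mEg intg (@measurable_cell2 R p q i j)).
by apply: eq_measure_integral => A mA _; exact/esym/leb2_shift.
Qed.

Lemma bounded_borel_shift (R : realType) (f : R * R -> R) (p q i j : nat) :
  bounded_borel unitI2 f -> (i < 2 ^ p)%N -> (j < 2 ^ q)%N ->
  bounded_borel (cell2 p q 0 0)
    (fun z => f (shift2 (i%:R / 2 ^+ p) (j%:R / 2 ^+ q) z)).
Proof.
move=> fI ip jq.
have [mf [C fC]] := bounded_borelS (@measurable_unitI2 R)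
  (@cell2_unitI2 R p q i j ip jq) fI.
rewrite -(shift2_cell R p q i j); split; last by exists C => z /fC.
apply: (measurable_comp (F := cell2 p q i j)) => //.
- exact: measurable_cell2.
- by move=> _ [z h <-].
- by apply: measurable_funTS; exact: measurable_shift2.
Qed.

(** Cutting the square into translates of one cell turns the integral against
    a step function into an integral, over that cell, of finite sums of values
    of f; estimates of integrals thereby reduce to pointwise estimates. *)
Lemma integral_step (R : realType) (f K : R * R -> R) (p q : nat)
    (kappa : nat -> nat -> R) :
  bounded_borel unitI2 f ->
  (forall i j z, (i < 2 ^ p)%N -> (j < 2 ^ q)%N -> cell2 p q i j z ->
    K z = kappa i j) ->
  \int[leb2]_(z in unitI2) (f z * K z) =
  \int[leb2]_(z in cell2 p q 0 0) (\sum_(i < 2 ^ p) \sum_(j < 2 ^ q)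
    kappa i j * f (shift2 (i%:R / 2 ^+ p) (j%:R / 2 ^+ q) z)).
Proof.
move=> fI Kk.
have mI := @measurable_unitI2 R.
have Ioo : (leb2 (@unitI2 R) < +oo)%E by rewrite leb2_unitI2 ltry.
have mc := @measurable_cell2 R p q 0 0.
have coo : (leb2 (@cell2 R p q 0 0) < +oo)%E by rewrite leb2_cell2 ltry.
have fc i j : bounded_borel unitI2 (f \_ (@cell2 R p q i j)).
  split; last first.
    have [_ [C fC]] := fI; exists C => z /fC; rewrite patchE.
    by case: ifPn => // _; apply: le_trans; rewrite normr0.
  apply: (measurable_restrict f (@measurable_cell2 R p q i j) mI).1.
  by apply: measurable_funS (proj1 fI) => //; exact: subIsetl.
transitivity (\int[leb2]_(z in unitI2) (\sum_(i < 2 ^ p) \sum_(j < 2 ^ q)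
    kappa i j * (f \_ (@cell2 R p q i j)) z)).
  apply: eq_Rintegral => -[x y] /set_mem[/= xI yI].
  have [i ip xi] := in_cell_exists p xI; have [j jq yj] := in_cell_exists q yI.
  rewrite (bigD1 (Ordinal ip))//= (bigD1 (Ordinal jq))//=.
  rewrite big1 => [|k kj]; last first.
    rewrite patchE memNset ?mulr0// => -[/= _ h].
    by move/eqP : kj; apply; apply: val_inj; exact: in_cell_inj h yj.
  rewrite big1 => [|k ki]; last first.
    rewrite big1// => l _; rewrite patchE memNset ?mulr0// => -[/= h _].
    by move/eqP : ki; apply; apply: val_inj; exact: in_cell_inj h xi.
  by rewrite patchE mem_set// (Kk _ _ _ ip jq)// !addr0 mulrC.
rewrite Rintegral_sum//; last first.
  by move=> i; apply: bounded_borel_sum => j; exact: bounded_borelZ.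
rewrite Rintegral_sum//; last first.
  move=> i; apply: bounded_borel_sum => j; apply: bounded_borelZ.
  exact: bounded_borel_shift.
apply: eq_bigr => i _; rewrite Rintegral_sum//; last first.
  by move=> j; exact: bounded_borelZ.
rewrite Rintegral_sum//; last first.
  move=> j; apply: bounded_borelZ; exact: bounded_borel_shift.
apply: eq_bigr => j _; rewrite !RintegralZl//; last 2 first.
- by apply: bounded_borel_integrable => //; exact: bounded_borel_shift.
- exact: bounded_borel_integrable.
congr (_ * _); rewrite -integral_cell_shift//.
by rewrite -Rintegral_mkcondr setIidr//; exact: cell2_unitI2.
Qed.

Lemma walsh_cell_left (R : realType) (p k i : nat) (x : R) : (k < 2 ^ p)%N ->
  in_cell p i x -> walsh k x = walsh k (i%:R / 2 ^+ p : R).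
Proof.
move=> kp xi; exact: (walsh_cell kp xi (in_cell_left R p i)).
Qed.

Lemma walsh_sum_average (R : realType) (f : R * R -> R) (p q M N : nat)
    (x y : R) :
  bounded_borel unitI2 f -> (M <= 2 ^ p)%N -> (N <= 2 ^ q)%N ->
  walsh_sum f M N x y = \int[leb2]_(z in cell2 p q 0 0)
    (\sum_(i < 2 ^ p) \sum_(j < 2 ^ q)
      walsh_kernel M x (i%:R / 2 ^+ p) * walsh_kernel N y (j%:R / 2 ^+ q) *
      f (shift2 (i%:R / 2 ^+ p) (j%:R / 2 ^+ q) z)).
Proof.
move=> fI Mp Nq.
have mc := @measurable_cell2 R p q 0 0.
have coo : (leb2 (@cell2 R p q 0 0) < +oo)%E by rewrite leb2_cell2 ltry.
pose F i j z := f (shift2 (i%:R / 2 ^+ p) (j%:R / 2 ^+ q) z).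
pose W r k i : R := walsh k (i%:R / 2 ^+ r).
have Fb (i : 'I_(2 ^ p)) (j : 'I_(2 ^ q)) : bounded_borel (cell2 p q 0 0) (F i j).
  exact: bounded_borel_shift.
have Sb (c : nat -> nat -> R) : bounded_borel (cell2 p q 0 0) (fun z =>
    \sum_(i < 2 ^ p) \sum_(j < 2 ^ q) c i j * F i j z).
  apply: bounded_borel_sum => i; apply: bounded_borel_sum => j.
  exact: bounded_borelZ.
have Sw m n : bounded_borel (cell2 p q 0 0) (fun z =>
    \sum_(i < 2 ^ p) \sum_(j < 2 ^ q) W p m i * W q n j * F i j z).
  exact: (Sb (fun i j => W p m i * W q n j)).
have coefE (m : 'I_M) (n : 'I_N) : walsh_coef f m n =
    \int[leb2]_(z in cell2 p q 0 0) (\sum_(i < 2 ^ p) \sum_(j < 2 ^ q)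
      W p m i * W q n j * F i j z).
  rewrite -(@integral_step _ f (fun z => walsh m z.1 * walsh n z.2) p q
    (fun i j => W p m i * W q n j))//.
    by apply: eq_Rintegral => z _; exact/esym/mulrA.
  move=> i j [u v] ip jq [/= ui vj]; congr (_ * _).
    by apply: walsh_cell_left ui; rewrite (leq_trans (ltn_ord m)).
  by apply: walsh_cell_left vj; rewrite (leq_trans (ltn_ord n)).
rewrite /walsh_sum.
transitivity (\sum_(m < M) \sum_(n < N) \int[leb2]_(z in cell2 p q 0 0)
    ((walsh m x * walsh n y) * \sum_(i < 2 ^ p) \sum_(j < 2 ^ q)
      W p m i * W q n j * F i j z)).
  apply: eq_bigr => m _; apply: eq_bigr => n _.
  rewrite RintegralZl//; last first.
    by apply: bounded_borel_integrable => //; exact: Sw.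
  by rewrite -coefE; ring.
under eq_bigr => m _.
  rewrite -Rintegral_sum//; last first.
    by move=> n; apply: bounded_borelZ; exact: Sw.
  over.
rewrite -Rintegral_sum//; last first.
  move=> m; apply: bounded_borel_sum => n; apply: bounded_borelZ; exact: Sw.
apply: eq_Rintegral => z _.
transitivity (\sum_(m < M) \sum_(n < N) \sum_(i < 2 ^ p) \sum_(j < 2 ^ q)
    (walsh m x * W p m i) * (walsh n y * W q n j) * F i j z).
  apply: eq_bigr => m _; apply: eq_bigr => n _; rewrite mulr_sumr.
  apply: eq_bigr => i _; rewrite mulr_sumr; apply: eq_bigr => j _.
  by ring.
under eq_bigr do rewrite exchange_big.
rewrite exchange_big; apply: eq_bigr => i _ /=.
under eq_bigr do rewrite exchange_big.
rewrite exchange_big; apply: eq_bigr => j _ /=.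
rewrite /walsh_kernel big_distrlr/= mulr_suml; apply: eq_bigr => m _.
by rewrite mulr_suml.
Qed.

(** * Logarithmic weights *)

Definition logw {R : realType} (n : nat) : R := ln n.+1%:R / n%:R.

Lemma ln2_gt0 (R : realType) : 0 < ln 2 :> R.
Proof. by rewrite ln_gt0// ltr1n. Qed.

Lemma ln2_le1 (R : realType) : ln 2 <= 1 :> R.
Proof.
have h : -1 < 1 :> R by lra.
exact: le_ln1Dx h.
Qed.

Lemma lnXn2 (R : realType) (m : nat) : ln ((2 ^ m)%:R) = m%:R * ln 2 :> R.
Proof. by rewrite natrX lnXn// mulr_natl. Qed.

Lemma logw_ge0 (R : realType) (n : nat) : 0 <= logw n :> R.
Proof. by rewrite divr_ge0// ln_ge0// ler1n. Qed.

Lemma ler_ln_nat (R : realType) (m n : nat) : (0 < m)%N -> (m <= n)%N ->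
  ln m%:R <= ln n%:R :> R.
Proof. by move=> m0 mn; rewrite ler_ln ?posrE ?ltr0n ?ler_nat// (leq_trans m0). Qed.

Definition logW {R : realType} (n : nat) : R := \sum_(l < n) logw l.+1.

(** The terms of index 2^m + 1 to 2^(m+1) alone contribute about m (ln 2)/2. *)
Lemma logW_exp2 (R : realType) (m : nat) :
  ln 2 / 4 * (m%:R * (m%:R - 1)) <= logW (2 ^ m) :> R.
Proof.
elim: m => [|m IH].
  by rewrite mul0r mulr0 sumr_ge0// => i _; exact: logw_ge0.
rewrite /logW expnS mul2n -addnn big_split_ord/=.
have : \sum_(i < 2 ^ m) (m%:R * ln 2 / (2 ^ m.+1)%:R) <=
    \sum_(i < 2 ^ m) logw (2 ^ m + i).+1 :> R.
  apply: ler_sum => i _; rewrite /logw ler_pM//.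
  - by rewrite mulr_ge0// ltW// ln2_gt0.
  - by rewrite -lnXn2 ler_ln_nat ?expn_gt0// -addSn leqW// leqW// leq_addr.
  - rewrite lef_pV2 ?posrE ?ltr0n ?expn_gt0// ler_nat.
    by rewrite expnS mul2n -addnn -addnS leq_add2l.
rewrite sumr_const card_ord -[X in X <= _]mulr_natl expnS natrM.
have t0 : (2 ^ m)%:R != 0 :> R by rewrite pnatr_eq0 -lt0n expn_gt0.
have -> : (2 ^ m)%:R * (m%:R * ln 2 / (2%:R * (2 ^ m)%:R)) = m%:R * ln 2 / 2 :> R.
  by field.
move=> h; apply: le_trans (lerD IH h); rewrite -natr1.
by rewrite le_eqVlt; apply/orP; left; apply/eqP; field.
Qed.

Lemma logW_exp2_le (R : realType) (m : nat) :
  logW (2 ^ m) <= (m%:R + 1) ^+ 2 :> R.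
Proof.
elim: m => [|m IH].
  by rewrite /logW big_ord1 /logw add0r expr1n divr1 ln2_le1.
rewrite /logW expnS mul2n -addnn big_split_ord/=.
have : \sum_(i < 2 ^ m) logw (2 ^ m + i).+1 <=
    \sum_(i < 2 ^ m) (m.+2%:R / (2 ^ m)%:R) :> R.
  apply: ler_sum => i _; rewrite /logw ler_pM ?ln_ge0 ?ler1n//.
  - apply: (@le_trans _ _ (ln (2 ^ m.+2)%:R)).
      apply: ler_ln_nat => //; rewrite !expnS; have := ltn_ord i.
      have := expn_gt0 2 m; lia.
    by rewrite lnXn2 ler_piMr// ln2_le1.
  - by rewrite lef_pV2 ?posrE ?ltr0n ?expn_gt0// ler_nat leqW// leq_addr.
rewrite sumr_const card_ord -[X in _ <= X]mulr_natr.
rewrite mulfVK ?pnatr_eq0 -?lt0n ?expn_gt0//.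
move=> h; apply: le_trans (lerD IH h) _; rewrite -natr1 -natr1.
by have : 0 <= m%:R :> R by []; nra.
Qed.

Lemma logW_unbounded (R : realType) (C : R) : exists n, C < logW n.
Proof.
set u := 4 * C / ln 2; pose k := (Num.truncn `|u|).+1.
exists (2 ^ k.+1)%N; apply: lt_le_trans (logW_exp2 R k.+1).
have L := ln2_gt0 R.
have uk : `|u| < k%:R by exact: truncnS_gt.
have Cu : C = u * ln 2 / 4 by rewrite /u; field; rewrite gt_eqF.
have k1 : 1 <= k%:R :> R by rewrite ler1n.
rewrite -natr1 Cu.
have : u < k%:R by apply: le_lt_trans uk; exact: ler_norm.
by nra.
Qed.

(** * Variation along finite packings of intervals *)

(** A triple (a, b, y) encodes the term |f(b, y) - f(a, y)|; the second
    coordinate belongs to the term because it may vary from one interval to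
    the next. *)
Definition atom (R : realType) := (R * R * R)%type.

Definition jump {R : realType} (f : R * R -> R) (t : atom R) : R :=
  `|f (t.1.2, t.2) - f (t.1.1, t.2)|.

Definition inside {R : realType} (t : atom R) : bool :=
  [&& 0 <= t.1.1, t.1.1 < t.1.2, t.1.2 < 1 & 0 <= t.2 < 1].

Definition apart {R : realType} (t u : atom R) : bool :=
  (t.1.2 <= u.1.1) || (u.1.2 <= t.1.1).

Definition packing {R : realType} (s : seq (atom R)) : bool :=
  all inside s && pairwise apart s.

Lemma jump_ge0 (R : realType) (f : R * R -> R) (t : atom R) : 0 <= jump f t.
Proof. exact: normr_ge0. Qed.

(** The offset K serves to weigh a list as the tail of a longer one. *)
Fixpoint wvar {R : realType} (w : nat -> R) (f : R * R -> R) (K : nat)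
    (s : seq (atom R)) : R :=
  if s is t :: s' then w K.+1 * jump f t + wvar w f K.+1 s' else 0.

Definition log_var_le {R : realType} (f : R * R -> R) (V : R) : Prop :=
  forall s, packing s -> wvar logw f 0 s <= V.

Lemma wvarE (R : realType) (w : nat -> R) (f : R * R -> R) (K : nat)
    (s : seq (atom R)) t0 :
  wvar w f K s = \sum_(l < size s) w (K + l).+1 * jump f (nth t0 s l).
Proof.
elim: s K => [|t s IH] K /=; first by rewrite big_ord0.
by rewrite big_ord_recl/= addn0 IH; congr (_ + _); apply: eq_bigr => l _;
  rewrite addSnnS.
Qed.

Lemma wvar_cat (R : realType) (w : nat -> R) (f : R * R -> R) (K : nat)
    (s1 s2 : seq (atom R)) :
  wvar w f K (s1 ++ s2) = wvar w f K s1 + wvar w f (K + size s1) s2.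
Proof.
elim: s1 K => [|t s IH] K /=; first by rewrite addn0 add0r.
by rewrite IH addrA addSnnS.
Qed.

Lemma wvar_ge0 (R : realType) (w : nat -> R) (f : R * R -> R) (K : nat)
    (s : seq (atom R)) : (forall n, (0 < n)%N -> 0 <= w n) -> 0 <= wvar w f K s.
Proof.
move=> w0; elim: s K => //= t s IH K; rewrite addr_ge0//.
by rewrite mulr_ge0 ?w0 ?jump_ge0.
Qed.

Lemma apartC (R : realType) (t u : atom R) : apart t u = apart u t.
Proof. by rewrite /apart orbC. Qed.

Lemma packing_cat (R : realType) (s1 s2 : seq (atom R)) :
  packing (s1 ++ s2) = [&& packing s1, packing s2 & allrel apart s1 s2].
Proof.
rewrite /packing all_cat pairwise_cat.
by case: (all _ s1); case: (all _ s2); case: (pairwise _ s1);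
  case: (pairwise _ s2); case: (allrel _ _ _).
Qed.

Lemma packing_rot (R : realType) (r : nat) (s : seq (atom R)) :
  packing s -> packing (rot r s).
Proof.
rewrite -{1}(cat_take_drop r s) /rot !packing_cat => /and3P[-> -> h] /=.
rewrite (allrelC); congr is_true: h; apply: eq_allrel => t u.
by rewrite apartC.
Qed.

Lemma sharpV1_wvar (R : realType) (lambda : nat -> R) (f : R * R -> R) :
  (forall n, (0 < n)%N -> 0 <= lambda n) -> (sharpV1 lambda f < +oo)%E ->
  exists V, forall s, packing s -> wvar (fun n => (lambda n)^-1) f 0 s <= V.
Proof.
move=> l0 Voo; exists (fine (sharpV1 lambda f)) => s ps.
set V := sharpV1 _ f in Voo *.
have t00 := unitI0 R.
pose d : atom R := (0, 0, 0).
have /andP[/allP ins /(pairwiseP d) pw] := ps.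
have le : ((wvar (fun n => (lambda n)^-1) f 0 s)%:E <= V)%E.
  apply: (@le_trans _ _ (ereal_sup [set \esum_(i in c.1)
      (`|f ((c.2 i).2, (nth d s i).2) - f ((c.2 i).1, (nth d s i).2)| /
        lambda i.+1)%:E | c in Omega])); last first.
    apply: ereal_sup_ubound; exists (fun i => (nth d s i).2) => // i /=.
    have [si|si] := ltnP i (size s); last by rewrite nth_default.
    have /and4P[_ _ _ h] := ins _ (mem_nth d si).
    by rewrite /unitI/= in_itv.
  apply: ereal_sup_ubound; exists (`I_(size s), fun i => (nth d s i).1) => /=.
    split => /=; first by right; exists (size s).
    - move=> i si; have /and4P[h1 h2 h3 _] := ins _ (mem_nth d si).
      rewrite /unitI/= !in_itv/= h1 h2 h3 (lt_trans h2 h3)/=.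
      by rewrite (le_trans h1 (ltW h2)).
    - have H i j : (i < j)%N -> (j < size s)%N ->
          `](nth d s i).1.1, (nth d s i).1.2[ `&`
          `](nth d s j).1.1, (nth d s j).1.2[ = set0.
        move=> ij js; have /orP := pw i j (ltn_trans ij js) js ij.
        rewrite -subset0 => -[] h x [] /=; rewrite !in_itv/= => /andP[a b]
          /andP[c e].
          by have := lt_trans (lt_le_trans b h) c; rewrite ltxx.
        by have := lt_trans (lt_le_trans e h) a; rewrite ltxx.
      apply/trivIsetP => /= i j si sj; rewrite neq_ltn => /orP[] ij.
        exact: H.
      by rewrite setIC; exact: H.
  rewrite esum_fset//=; last first.
    by move=> i _; rewrite lee_fin divr_ge0// l0.
  rewrite -fsbig_ord (wvarE _ _ _ _ d) -sumEFin.
  by apply: eq_bigr => i _; rewrite add0n /jump mulrC.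
have V0 : (0 <= V)%E.
  apply: le_trans le; rewrite lee_fin wvar_ge0// => n n0.
  by rewrite invr_ge0 l0.
by rewrite -lee_fin fineK// ge0_fin_numE.
Qed.

(** A countable collection is exhausted by its initial segments, and open
    intervals that do not meet have ordered endpoints. *)
Lemma wvar_sharpV1 (R : realType) (lambda : nat -> R) (f : R * R -> R) (V : R) :
  (forall n, (0 < n)%N -> 0 <= lambda n) ->
  (forall s, packing s -> wvar (fun n => (lambda n)^-1) f 0 s <= V) ->
  (sharpV1 lambda f <= V%:E)%E.
Proof.
move=> l0 fV; apply: ge_ereal_sup => _ [y /= Iy <-].
apply: ge_ereal_sup => _ [[D c] /= [D0 ci triv] <-].
pose A i : atom R := (c i, y i).
pose a i := `|f ((c i).2, y i) - f ((c i).1, y i)| / lambda i.+1.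
have a0 i : 0 <= a i by rewrite divr_ge0// l0.
have part n : (forall i, (i < n)%N -> D i) -> \sum_(i < n) a i <= V.
  move=> nD; have d : atom R := (0, 0, 0).
  have /fV : packing (mkseq A n).
    apply/andP; split.
      apply/allP => _ /mapP[i + ->]; rewrite mem_iota add0n => /andP[_ /nD /ci].
      have := Iy i; rewrite /unitI/inside/= !in_itv/=.
      by move=> -> [/andP[-> _] /andP[_ ->] ->].
    apply/(pairwiseP d) => i j; rewrite !inE size_mkseq => im jm ij.
    rewrite !nth_mkseq// /apart /A/= leNgt [X in _ || X]leNgt -negb_and.
    apply/negP => /andP[h1 h2].
    have [_ _ ci'] := ci _ (nD _ im); have [_ _ cj'] := ci _ (nD _ jm).
    have ne : i != j by rewrite neq_ltn ij.
    have := trivIsetP.1 triv i j (nD _ im) (nD _ jm) ne.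
    pose lo := Num.max (c i).1 (c j).1; pose hi := Num.min (c i).2 (c j).2.
    have lh : lo < hi by rewrite /lo /hi gt_max !lt_min ci' cj' h1 h2.
    have : lo < (lo + hi) / 2 < hi by apply/andP; split; lra.
    rewrite /lo gt_max lt_min -andbA => /and4P[x1 x2 x3 x4].
    rewrite -subset0 => /(_ ((lo + hi) / 2)); apply.
    by rewrite /= !in_itv/= x1 x2 x3 x4.
  rewrite (wvarE _ _ _ _ d) size_mkseq; apply: le_trans.
  rewrite le_eqVlt; apply/orP; left; apply/eqP; apply: eq_bigr => i _.
  by rewrite nth_mkseq// add0n mulrC.
case: D0 => /= [DT|[n Dn]]; last first.
  rewrite Dn esum_fset//; last first.
    by move=> i _; rewrite lee_fin; exact: a0.
  rewrite -fsbig_ord sumEFin lee_fin; apply: part => i ii.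
  by rewrite Dn.
rewrite DT -nneseries_esumT; last by move=> i; rewrite lee_fin; exact: a0.
apply: lime_le; first 
  by apply: is_cvg_nneseries => i _ _; rewrite lee_fin; exact: a0.
apply: nearW => n; rewrite sumEFin lee_fin big_mkord; apply: part => i _.
by rewrite DT.
Qed.

(** Turns statements on the first variation into statements on the second. *)
Definition swap {R : realType} (f : R * R -> R) (z : R * R) : R := f (z.2, z.1).

Lemma sharpV2_swap (R : realType) (lambda : nat -> R) (f : R * R -> R) :
  sharpV2 lambda f = sharpV1 lambda (swap f).
Proof. by []. Qed.

Lemma sharpV1_log_var (R : realType) (f : R * R -> R) :
  (sharpV1 (fun n => n%:R / ln (n.+1)%:R)%R f < +oo)%E ->
  exists V, log_var_le f V.
Proof.
move=> /sharpV1_wvar[n n0|V fV]; first by rewrite divr_ge0// ln_ge0// ler1n.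
exists V => s /fV; rewrite (_ : (fun n => _) = logw)//.
by apply/funext => n; rewrite invf_div.
Qed.

(** * Variation near a point *)

Definition avoids {R : realType} (x : R) (t : atom R) : bool :=
  (t.1.2 < x) || (x < t.1.1).

Definition punctured {R : realType} (x delta : R) (t : atom R) : bool :=
  ((x - delta < t.1.1) && (t.1.2 < x)) || ((x < t.1.1) && (t.1.2 < x + delta)).

Lemma punctured_avoids (R : realType) (x delta : R) (s : seq (atom R)) :
  all (punctured x delta) s -> all (avoids x) s.
Proof.
by apply: sub_all => t /orP[] /andP[a b]; rewrite /avoids ?a ?b ?orbT.
Qed.

Lemma avoids_gap (R : realType) (x : R) (s : seq (atom R)) :
  all (avoids x) s -> exists2 delta, 0 < delta &
    forall t, punctured x delta t -> inside t -> all (apart^~ t) s.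
Proof.
elim: s => [|u s IH] /=; first by exists 1.
move=> /andP[ux /IH[e e0 es]].
have [d d0 du] : exists2 d, 0 < d &
    forall t, punctured x d t -> inside t -> apart u t.
  case/orP : ux => ux.
    exists (x - u.1.2); first by rewrite subr_gt0.
    move=> t tx /and4P[_ tt _ _]; rewrite /apart.
    by case/orP : tx => /andP[a b]; apply/orP; left; lra.
  exists (u.1.1 - x); first by rewrite subr_gt0.
  move=> t tx /and4P[_ tt _ _]; rewrite /apart.
  by case/orP : tx => /andP[a b]; apply/orP; right; lra.
exists (Num.min d e); first by rewrite lt_min d0 e0.
move=> t tx it.
have [m1 m2] : Num.min d e <= d /\ Num.min d e <= e.
  by rewrite !ge_min !lexx orbT.
rewrite du ?es//.
  by case/orP : tx => /andP[a b]; apply/orP; [left|right]; apply/andP; split; lra.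
by case/orP : tx => /andP[a b]; apply/orP; [left|right]; apply/andP; split; lra.
Qed.

(** Packings that live closer and closer to x, without touching it, can be put
    together; a fixed amount of variation near x would thus be repeated
    infinitely often. *)
Lemma small_wvar_near (R : realType) (f : R * R -> R) (V x e : R) :
  log_var_le f V -> 0 < e -> exists K, exists2 delta, 0 < delta &
    forall s, packing s -> all (punctured x delta) s -> wvar logw f K s <= e.
Proof.
move=> fV e0; apply: contrapT => H.
have step K d : 0 < d -> exists s,
    [/\ packing s, all (punctured x d) s & e < wvar logw f K s].
  move=> d0; apply: contrapT => H2; apply: H; exists K; exists d => // s ps ss.
  by rewrite leNgt; apply/negP => es; apply: H2; exists s.
have big r : exists s, [/\ packing s, all (avoids x) s & r%:R * e <= wvar logw f 0 s].
  elim: r => [|r [s [ps sx rs]]]; first by exists [::]; rewrite /= mul0r.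
  have [d d0 ds] := avoids_gap sx.
  have [u [pu ux eu]] := step (size s) d d0.
  exists (s ++ u); split.
  - rewrite packing_cat ps pu/= allrelC; apply/allrelP => t v tu vs.
    have := ds t (allP ux _ tu); have /andP[/allP iu _] := pu.
    by move=> /(_ (iu _ tu)) /allP/(_ _ vs).
  - by rewrite all_cat sx (punctured_avoids ux).
  - by rewrite wvar_cat add0n -natr1 mulrDl mul1r lerD// ltW.
have [s [ps _]] := big (Num.truncn (`|V| / e)).+1.
apply/negP; rewrite -ltNge; apply: le_lt_trans (fV _ ps) _.
rewrite -ltr_pdivrMr//; apply: le_lt_trans (truncnS_gt _).
by rewrite ler_pM2r ?invr_gt0// ler_norm.
Qed.

(** Otherwise arbitrarily many jumps of a fixed size could be packed near x,
    and the sum of the weights diverges. *)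
Lemma small_jump_near (R : realType) (f : R * R -> R) (V x e : R) :
  log_var_le f V -> 0 < e -> exists2 delta, 0 < delta &
    forall t, inside t -> punctured x delta t -> jump f t <= e.
Proof.
move=> fV e0; apply: contrapT => H.
have step d : 0 < d -> exists t, [/\ inside t, punctured x d t & e < jump f t].
  move=> d0; apply: contrapT => H2; apply: H; exists d => // t it tx.
  by rewrite leNgt; apply/negP => et; apply: H2; exists t.
have big r : exists s, [/\ size s = r, packing s, all (avoids x) s &
    forall K, e * \sum_(l < r) logw (K + l).+1 <= wvar logw f K s].
  elim: r => [|r [s [sr ps sx rs]]].
    by exists [::]; split => // K; rewrite big_ord0 mulr0.
  have [d d0 ds] := avoids_gap sx.
  have [t [it tx et]] := step d d0.
  exists (rcons s t); rewrite -cats1; split.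
  - by rewrite size_cat sr addn1.
  - rewrite packing_cat ps /= allrelC; apply/andP; split.
      by rewrite /packing/= it.
    by apply/allrelP => v u; rewrite inE => /eqP -> us; apply: (allP (ds t tx it)).
  - rewrite all_cat sx; apply: (@punctured_avoids _ _ d).
    by rewrite /= tx.
  - move=> K; rewrite wvar_cat big_ord_recr/= mulrDr lerD//.
    by rewrite sr addr0 mulrC ler_wpM2l ?logw_ge0// ltW.
have [r Vr] := logW_unbounded (`|V| / e).
have [s [_ ps _ /(_ 0%N)]] := big r.
apply/negP; rewrite -ltNge; apply: le_lt_trans (fV _ ps) _.
rewrite mulrC -ltr_pdivrMr//; apply: le_lt_trans Vr.
by rewrite ler_pM2r ?invr_gt0// ler_norm.
Qed.

(** * Functions of bounded variation are Borel *)

Lemma oscillation_le (R : realType) (f : R * R -> R) (e d x s t y : R) :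
  (forall u, inside u -> punctured x d u -> jump f u <= e) ->
  0 <= e -> unitI s -> unitI t -> unitI y ->
  (x - d < s < x /\ x - d < t < x) \/ (x < s < x + d /\ x < t < x + d) ->
  `|f (s, y) - f (t, y)| <= e.
Proof.
move=> H e0; wlog st : s t / s < t => [hw|].
  move=> Is It Iy h; have [st|ts|->] := ltgtP s t; first exact: hw.
    by rewrite distrC; apply: hw => //; tauto.
  by rewrite subrr normr0.
rewrite /unitI/= !in_itv/= => /andP[s0 s1] /andP[t0 t1] /andP[y0 y1] h.
rewrite distrC; apply: (H (s, t, y)).
  by rewrite /inside/= s0 st t1 y0.
rewrite /punctured/=.
by case: h => -[/andP[a b] /andP[c d']]; apply/orP; [left|right]; apply/andP; split.
Qed.

(** By compactness finitely many punctured neighborhoods suffice; their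
    centers form cells of their own since f may jump there. *)
Lemma small_oscillation_cover (R : realType) (f : R * R -> R) (V e : R) :
  log_var_le f V -> 0 < e -> exists C : nat -> set (measurableTypeR R),
    [/\ forall k, measurable (C k),
        forall t, unitI t -> exists k, C k t &
        forall k s t y, C k s -> C k t -> unitI s -> unitI t -> unitI y ->
          `|f (s, y) - f (t, y)| <= e].
Proof.
move=> fV e0.
have /choice[d dP] : forall x, exists d, 0 < d /\
    forall t, inside t -> punctured x d t -> jump f t <= e.
  by move=> x; have [d d0 dt] := small_jump_near x fV e0; exists d.
have : cover_compact (`[0, 1]%classic : set R).
  by rewrite -compact_cover; exact: segment_compact.
move=> /(_ R setT (fun x => ball x (d x)))[].
- by move=> x _; exact: ball_open.
- by move=> x _; exists x => //; apply: ballxx; exact: (dP x).1.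
move=> D' _ cov.
pose xs : seq R := finmap.enum_fset D'.
(* Each center contributes itself and the two halves of its neighborhood. *)
pose C k := let x := nth 0 xs (k %/ 3)%N in
  if (k %% 3 == 0)%N then [set x] else
  if (k %% 3 == 1)%N then `]x - d x, x[%classic else `]x, x + d x[%classic.
exists C; split.
- move=> k; rewrite /C/=; case: ifP => _; first exact: measurable_set1.
  by case: ifP => _; exact: measurable_itv.
- move=> t; rewrite /unitI/= in_itv/= => /andP[t0 t1].
  have [|x xD] := cov t; first by rewrite /= in_itv/= t0 ltW.
  rewrite /ball/= => tx.
  have xs_x : nth 0 xs (index x xs) = x by rewrite nth_index.
  have div3 c : (c < 3)%N -> ((index x xs * 3 + c) %/ 3 = index x xs)%N.
    by move=> c3; rewrite divnMDl// divn_small// addn0.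
  have mod3 c : (c < 3)%N -> ((index x xs * 3 + c) %% 3 = c)%N.
    by move=> c3; rewrite modnMDl modn_small.
  move: tx; rewrite ltr_norml => /andP[h1 h2].
  have [tx|xt|->] := ltgtP t x.
  + exists (index x xs * 3 + 1)%N; rewrite /C div3// mod3//= xs_x in_itv/=.
    by apply/andP; split; lra.
  + exists (index x xs * 3 + 2)%N; rewrite /C div3// mod3//= xs_x in_itv/=.
    by apply/andP; split; lra.
  + by exists (index x xs * 3 + 0)%N; rewrite /C div3// mod3//= xs_x.
- move=> k s t y; rewrite /C/=; set x := nth _ _ _.
  have H := (dP x).2.
  case: ifP => _ /=; first by move=> -> ->; rewrite subrr normr0 ltW.
  case: ifP => _ /=; rewrite !in_itv/= => h1 h2 Is It Iy;
    apply: (oscillation_le H) => //; rewrite ?ltW//; by [left|right].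
Qed.

(** Every point of the superlevel set lies in a product of two sets of
    small oscillation that is contained in it, and countably many such
    products are available. *)
Lemma log_var_borel (R : realType) (f : R * R -> R) (V V' : R) :
  log_var_le f V -> log_var_le (swap f) V' -> bounded_borel unitI2 f.
Proof.
move=> fV fV'; have I0 := unitI0 R.
have l1 : 0 < logw 1 :> R by rewrite /logw divr1 ln2_gt0.
have bd g W x y : log_var_le g W -> unitI x -> unitI y ->
    `|g (x, y) - g (0 : R, y)| <= `|W| / logw 1.
  move=> gW; rewrite /unitI/= !in_itv/= => /andP[x0 x1] /andP[y0 y1].
  move: x0; rewrite le_eqVlt => /predU1P[<-|x0].
    by rewrite subrr normr0 divr_ge0// ltW.
  have := gW [:: (0, x, y)]; rewrite /packing/inside/= lexx x0 x1 y0 y1/=.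
  rewrite addr0 => /(_ isT); rewrite ler_pdivlMr// mulrC => h.
  exact: le_trans h (ler_norm _).
split; last first.
  exists (`|f (0, 0)| + `|V'| / logw 1 + `|V| / logw 1) => -[x y] [/= Ix Iy].
  have := bd _ _ _ _ fV Ix Iy; have := bd _ _ _ _ fV' Iy I0; rewrite /swap/=.
  rewrite !ler_norml => /andP[h1 h2] /andP[h3 h4].
  have := ler_norm (f (0, 0)); have := ler_norm (- f (0, 0)); rewrite normrN.
  move=> h5 h6; apply/andP; split; lra.
have n0 n : 0 < n.+1%:R^-1 :> R by rewrite invr_gt0.
have /choice[C CP] := fun n => small_oscillation_cover fV (n0 n).
have /choice[D DP] := fun n => small_oscillation_cover fV' (n0 n).
apply: (measurability _ (RGenOInfty.measurableE R)) => _ [_ [c ->] <-].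
pose Q n k l := unitI2 `&` (C n k `*` D n l).
pose G n k l := if `[< Q n k l `<=` f @^-1` `]c, +oo[ >] then Q n k l else set0.
rewrite (_ : _ `&` _ = \bigcup_n \bigcup_k \bigcup_l G n k l); last first.
  apply/seteqP; split => [[x y]|[x y]]; last first.
    move=> [n _ [k _ [l _]]]; rewrite /G; case: asboolP => // sub h.
    by split; [exact: h.1 | exact: sub].
  rewrite /= in_itv/= andbT => -[[/= Ix Iy] cf].
  pose n := Num.truncn (2 / (f (x, y) - c)).
  have [Cm Cc Co] := CP n; have [Dm Dc Do] := DP n.
  have [k Ck] := Cc _ Ix; have [l Dl] := Dc _ Iy.
  exists n => //; exists k => //; exists l => //; rewrite /G.
  case: asboolP => // -[] => -[s t] [[/= Is It] [/= Cs Dt]].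
  rewrite in_itv/= andbT.
  have h1 := Co _ _ _ _ Ck Cs Ix Is Iy.
  have h2 := Do _ _ _ _ Dl Dt Iy It Is; rewrite /swap/= in h2.
  have h3 : 2 / n.+1%:R < f (x, y) - c.
    rewrite ltr_pdivrMr ?ltr0n// mulrC -ltr_pdivrMr ?subr_gt0//.
    exact: truncnS_gt.
  move: h1 h2; rewrite !ler_norml => /andP[_ h1] /andP[_ h2].
  move: h3 h1 h2; set r := n.+1%:R^-1 => h3 h1 h2; lra.
apply: bigcupT_measurable => n; apply: bigcupT_measurable => k.
apply: bigcupT_measurable => l; rewrite /G; case: ifP => _ //.
apply: measurableI; first exact: measurable_unitI2.
apply: measurableX; first by have [] := CP n.
by have [] := DP n.
Qed.

(** * Continuity with respect to dyadic addition *)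

Lemma exp2_small (R : realType) (e : R) : 0 < e -> exists k, 2 ^- k < e.
Proof.
move=> e0; exists (Num.truncn e^-1).+1.
rewrite -[X in _ < X]invrK ltf_pV2 ?posrE ?invr_gt0 ?exprn_gt0//.
apply: (lt_trans (truncnS_gt _)); rewrite -natrX ltr_nat.
by rewrite ltn_expl.
Qed.

Lemma exp2V_le (R : realType) (m n : nat) : (m <= n)%N ->
  2 ^- n <= 2 ^- m :> R.
Proof.
by move=> mn; rewrite lef_pV2 ?posrE ?exprn_gt0// ler_weXn2l// ler1n.
Qed.

Lemma in_cell_lt (R : realType) (p i : nat) (x : R) :
  unitI x -> in_cell p i x -> (i < 2 ^ p)%N.
Proof. by move=> /(in_cell_exists p)[j jp /in_cell_inj h] /h <-. Qed.

Lemma bindigit_cell (R : realType) (k i : nat) (x : R) :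
  in_cell k.+1 i x -> bindigit x k = odd i.
Proof.
move=> /andP[h1 h2]; rewrite /bindigit (@floor_def _ _ i%:Z)// intrD -!pmulrn.
by rewrite natr1 h1.
Qed.

Lemma bindigit_sum (R : realType) (n i : nat) (x : R) :
  (i < 2 ^ n)%N -> in_cell n i x ->
  \sum_(k < n) (bindigit x k)%:R / 2 ^+ k.+1 = i%:R / 2 ^+ n :> R.
Proof.
elim: n i => [|n IH] i.
  by rewrite expn0 ltnS leqn0 => /eqP -> _; rewrite big_ord0 mul0r.
move=> ip xi; rewrite big_ord_recr/= (bindigit_cell xi).
have ip2 : (i %/ 2 < 2 ^ n)%N by rewrite ltn_divLR// -expnSr.
rewrite -addn1 in xi; rewrite (IH _ ip2 (in_cell_coarse xi)) divn2.
have n0 : 2 ^+ n != 0 :> R by rewrite expf_neq0.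
rewrite -[in RHS](odd_double_half i) -mul2n natrD natrM exprS.
by field.
Qed.

Lemma bindigit_series (R : realType) (x : R) : unitI x ->
  limn (series (fun k => (bindigit x k)%:R / 2 ^+ k.+1 : R)) = x.
Proof.
move=> Ix; apply: cvg_lim => //; apply/cvgrPdist_le => e e0.
have [n ne] := exp2_small e0.
exists n => // m /= nm; have [i im xi] := in_cell_exists m Ix.
rewrite /series/= big_mkord (bindigit_sum im xi).
have /in_cellE/andP[h1 h2] := xi.
have h3 := exp2V_le R nm.
rewrite ger0_norm ?subr_ge0//.
have : i.+1%:R / 2 ^+ m = i%:R / 2 ^+ m + 2 ^- m :> R.
  by rewrite -natr1 mulrDl mul1r.
by move=> h4; lra.
Qed.

Lemma dyadic_add0 (R : realType) (x : R) : unitI x -> dyadic_add x 0 = x.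
Proof.
move=> Ix; rewrite -[RHS]bindigit_series//; congr (limn (series _)).
apply/funext => k; rewrite (@bindigit_cell _ _ 0 0)/=.
  by rewrite subr0 ger0_norm.
by rewrite /in_cell mulr0 lexx ltr01.
Qed.

Lemma bits_xor (p a q : nat) : exists2 e, (e < 2 ^ p)%N &
  forall k, (k < p)%N ->
    odd (e %/ 2 ^ k)%N = odd (a %/ 2 ^ k)%N (+) odd (q %/ 2 ^ k)%N.
Proof.
elim: p a q => [|p IH] a q; first by exists 0%N.
have [e ep ek] := IH (a %/ 2)%N (q %/ 2)%N.
exists ((odd a (+) odd q) + e.*2)%N.
  by rewrite expnS mul2n; case: (_ (+) _) => /=; lia.
case=> [|k] kp.
  by rewrite expn0 !divn1 oddD odd_double addbF oddb.
by rewrite expnS !divnMA divn2 half_bit_double ek.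
Qed.

(** The increment has the digits of x from place p on, so that it does not end
    in a string of digits 1. For other points s of the cell the digits of the
    increment might do so, and s is then out of reach. *)
Lemma dyadic_add_dyadic (R : realType) (k p i q : nat) (x : R) :
  unitI x -> in_cell k i x -> (k <= p)%N -> (q < 2 ^ p)%N ->
  in_cell k i (q%:R / 2 ^+ p : R) ->
  exists h, [/\ unitI h, h < 2 ^- k & dyadic_add x h = q%:R / 2 ^+ p].
Proof.
move=> Ix xi kp qp si; set s : R := q%:R / 2 ^+ p in si *.
have sq : in_cell p q s.
  exact: in_cell_left.
have Is : unitI s by exact: (cell_unitI qp).
have [a ap xa] := in_cell_exists p Ix.
have kpE : (p = k + (p - k))%N by rewrite subnKC.
have ai : (a %/ 2 ^ (p - k) = i)%N.
  by apply: in_cell_inj xi; apply: in_cell_coarse; rewrite -kpE.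
have qi : (q %/ 2 ^ (p - k) = i)%N.
  by apply: in_cell_inj si; apply: in_cell_coarse; rewrite -kpE.
have [e ep ek] := bits_xor (p - k) a q.
have ebits l : odd (e %/ 2 ^ l)%N = odd (a %/ 2 ^ l)%N (+) odd (q %/ 2 ^ l)%N.
  have [/ek//|pl] := ltnP l (p - k).
  rewrite divn_small; last by rewrite (leq_trans ep)// leq_exp2l.
  by rewrite -(subnKC pl) expnD !divnMA ai qi addbb.
pose h : R := x + (e%:R - a%:R) / 2 ^+ p.
have p0 : 2 ^+ p != 0 :> R by rewrite expf_neq0.
have hE : 2 ^+ p * h = 2 ^+ p * x - a%:R + e%:R by rewrite /h; field.
have he : in_cell p e h.
  move: xa; rewrite /in_cell hE -[a.+1%:R]natr1 -[e.+1%:R]natr1.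
  by move=> /andP[h1 h2]; apply/andP; split; lra.
have ep' : (e < 2 ^ p)%N by rewrite (leq_trans ep)// leq_exp2l// leq_subr.
have Ih : unitI h := cell_unitI ep' he.
exists h; split => //.
  have : in_cell k 0 h.
    by rewrite -(divn_small ep); apply: in_cell_coarse; rewrite -kpE.
  by move/in_cellE => /andP[_]; rewrite mul1r.
rewrite -[RHS]bindigit_series//; congr (limn (series _)); apply/funext => l.
congr (_ / _); have [lp|pl] := ltnP l p.
  have lE : (p = l.+1 + (p - l.+1))%N by rewrite subnKC.
  have d j (z : R) : in_cell p j z -> bindigit z l = odd (j %/ 2 ^ (p - l.+1)).
    by move=> zj; apply: bindigit_cell; apply: in_cell_coarse; rewrite -lE.
  rewrite (d _ _ xa) (d _ _ he) (d _ _ sq) ebits.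
  by case: (odd _); case: (odd _) => /=; rewrite ?subrr ?subr0 ?sub0r ?normrN
    ?normr0 ?normr1.
have [b bl xb] := in_cell_exists l.+1 Ix.
have lE : (l.+1 = p + (l.+1 - p))%N by rewrite subnKC// leqW.
set r := (l.+1 - p)%N in lE.
have r0 : r = (l - p).+1 by rewrite /r subSn.
have ba : (b %/ 2 ^ r = a)%N.
  by apply: in_cell_inj xa; apply: in_cell_coarse; rewrite -lE.
have bE := divn_eq b (2 ^ r); rewrite ba in bE.
have he' : in_cell l.+1 (e * 2 ^ r + b %% 2 ^ r) h.
  have Qh : 2 ^+ p * 2 ^+ r * h = 2 ^+ p * 2 ^+ r * x - a%:R * 2 ^+ r +
      e%:R * 2 ^+ r by rewrite mulrAC hE; ring.
  have bR : b%:R = a%:R * 2 ^+ r + (b %% 2 ^ r)%:R :> R.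
    by rewrite {1}bE natrD natrM natrX.
  move: xb; rewrite /in_cell lE exprD Qh -[b.+1%:R]natr1 bR -[(e * _ + _).+1%:R]natr1.
  by rewrite natrD natrM natrX => /andP[h1 h2]; apply/andP; split; lra.
have se : in_cell l.+1 (q * 2 ^ r) s.
  have E : 2 ^+ l.+1 * s = (q * 2 ^ r)%:R.
    by rewrite lE exprD natrM natrX /s; field.
  by rewrite /in_cell E lexx ltr_nat ltnSn.
rewrite (bindigit_cell xb) (bindigit_cell he') (bindigit_cell se) {1}bE.
by rewrite !oddD !oddM oddX r0/= !andbF/= subrr normr0.
Qed.

Lemma dyadic_between (R : realType) (k : nat) (s u : R) : 0 <= s -> s < u ->
  u <= 1 -> exists p q, [/\ (k <= p)%N, (q < 2 ^ p)%N &
    s < q%:R / 2 ^+ p :> R /\ q%:R / 2 ^+ p < u].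
Proof.
move=> s0 su u1; have us : 0 < u - s by rewrite subr_gt0.
have [n nu] := exp2_small us.
pose p := maxn k n.
have Is : unitI s by rewrite /unitI/= in_itv/= s0 (lt_le_trans su).
have [i ip /in_cellE/andP[h1 h2]] := in_cell_exists p Is.
have h3 : i.+1%:R / 2 ^+ p = i%:R / 2 ^+ p + 2 ^- p :> R.
  by rewrite -natr1 mulrDl mul1r.
have h4 := exp2V_le R (leq_maxr k n : (n <= p)%N).
have iu : i.+1%:R / 2 ^+ p < u by lra.
exists p, i.+1; split; [exact: leq_maxl | | by []].
rewrite -(ltr_nat R) natrX.
have := lt_le_trans iu u1; rewrite ltr_pdivrMr ?exprn_gt0// mul1r.
by [].
Qed.

(** Inside a small dyadic cell around x, jumps on either side of x are small,
    so that the values reached by dyadic addition control all others. *)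
Lemma dyadic_approx (R : realType) (g : R * R -> R) (V x e : R) :
  log_var_le g V -> 0 < e -> unitI x -> exists k0, forall k i s,
    (k0 <= k)%N -> in_cell k i x -> in_cell k i s ->
    exists h, [/\ unitI h, h < 2 ^- k, unitI (dyadic_add x h) &
      forall t, unitI t -> `|g (s, t) - g (dyadic_add x h, t)| <= e].
Proof.
move=> gV e0 Ix; have [d d0 dP] := small_jump_near x gV e0.
have [k0 k0d] := exp2_small d0.
exists k0 => k i s k0k xi si.
have ik := in_cell_lt Ix xi.
have kd : 2 ^- k < d by apply: le_lt_trans k0d; exact: exp2V_le.
have [x0 x1] : 0 <= x /\ x < 1.
  by move: Ix; rewrite /unitI/= in_itv/= => /andP.
have Is := cell_unitI ik si.
have [s0 s1] : 0 <= s /\ s < 1.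
  by move: Is; rewrite /unitI/= in_itv/= => /andP.
have /in_cellE/andP[xl xr] := xi; have /in_cellE/andP[sl sr] := si.
have lr : i.+1%:R / 2 ^+ k = i%:R / 2 ^+ k + 2 ^- k :> R.
  by rewrite -natr1 mulrDl mul1r.
have u1 : i.+1%:R / 2 ^+ k <= 1 :> R.
  by rewrite ler_pdivrMr ?exprn_gt0// mul1r -natrX ler_nat.
have reach (p q : nat) : (k <= p)%N -> (q < 2 ^ p)%N ->
    i%:R / 2 ^+ k <= q%:R / 2 ^+ p :> R -> q%:R / 2 ^+ p < i.+1%:R / 2 ^+ k :> R ->
    (x - d < s < x /\ x - d < (q%:R / 2 ^+ p : R) < x) \/
    (x < s < x + d /\ x < (q%:R / 2 ^+ p : R) < x + d) ->
    exists h, [/\ unitI h, h < 2 ^- k, unitI (dyadic_add x h) &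
      forall t, unitI t -> `|g (s, t) - g (dyadic_add x h, t)| <= e].
  move=> kp qp ql qr H.
  have [|h [Ih hk xh]] := @dyadic_add_dyadic R k p i q x Ix xi kp qp.
    by apply/in_cellE; rewrite ql qr.
  have Iq : unitI (q%:R / 2 ^+ p : R).
    by apply: (cell_unitI qp); exact: in_cell_left.
  exists h; rewrite xh; split => // t It.
  by apply: (oscillation_le dP) => //; exact: ltW.
have [sx|xs|sx] := ltgtP s x.
- have [p [q [kp qp [sq qx]]]] := dyadic_between k s0 sx (ltW x1).
  have := reach p q kp qp; set z := q%:R / 2 ^+ p in sq qx *.
  move=> H; apply: H; [lra | lra |].
  by left; split; apply/andP; split; lra.
- have [p [q [kp qp [sq qu]]]] := dyadic_between k s0 sr u1.
  have := reach p q kp qp; set z := q%:R / 2 ^+ p in sq qu *.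
  move=> H; apply: H; [lra | lra |].
  by right; split; apply/andP; split; lra.
- exists 0; have Ix0 := unitI0 R.
  rewrite dyadic_add0// sx; split => //.
  by move=> t _; rewrite subrr normr0 ltW.
Qed.

Lemma dyadic_continuous_cells (R : realType) (f : R * R -> R) (V V' x y e : R) :
  log_var_le f V -> log_var_le (swap f) V' -> unitI x -> unitI y ->
  dyadic_continuous_at f x y -> 0 < e ->
  exists k0, forall k l i j s t, (k0 <= k)%N -> (k0 <= l)%N ->
    in_cell k i x -> in_cell k i s -> in_cell l j y -> in_cell l j t ->
    `|f (s, t) - f (x, y)| <= e.
Proof.
move=> fV fV' Ix Iy + e0.
have e3 : 0 < e / 3 by rewrite divr_gt0.
move=> /cvgrPdist_le/(_ _ e3); rewrite near_withinE.
move=> /nbhs_ballP[d /= d0 dP].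
have [k1 k1P] := dyadic_approx fV e3 Ix.
have [k2 k2P] := dyadic_approx fV' e3 Iy.
have [k3 k3d] := exp2_small d0.
exists (maxn k1 (maxn k2 k3)) => k l i j s t.
rewrite !geq_max => /and3P[k1k k2k k3k] /and3P[k1l k2l k3l] xi si yj tj.
have [h [Ih hk Ixh hP]] := k1P _ _ _ k1k xi si.
have [h' [Ih' hk' Iyh hP']] := k2P _ _ _ k2l yj tj.
have It := cell_unitI (in_cell_lt Iy yj) tj.
have := hP _ It; have := hP' _ Ixh; rewrite /swap/=.
have small m z : (k3 <= m)%N -> unitI z -> z < 2 ^- m -> ball (0 : R) d z.
  move=> km; rewrite /unitI/= in_itv/= => /andP[z0 _] zm.
  rewrite /ball/= sub0r normrN ger0_norm//.
  by apply: lt_trans zm _; apply: le_lt_trans k3d; exact: exp2V_le.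
have /(_ (conj _ _)) := dP (h, h') (conj (small _ _ k3k Ih hk) (small _ _ k3l Ih' hk')).
move=> /(_ (conj Ih Ih') (conj Ixh Iyh)).
rewrite !ler_norml => /andP[a1 a2] /andP[b1 b2] /andP[c1 c2].
by apply/andP; split; lra.
Qed.

(** * Contribution of the distant cells *)

Lemma head_rot (T : Type) (d : T) (l : nat) (s : seq T) : (l < size s)%N ->
  head d (rot l s) = nth d s l.
Proof.
move=> ls; rewrite /rot -nth0 nth_cat size_drop subn_gt0 ls nth_drop.
by rewrite addn0.
Qed.

(** Averaging the weighted sum over all cyclic rearrangements of a packing
    replaces every weight by the mean weight. *)
Lemma sum_jump_le (R : realType) (f : R * R -> R) (V : R) (s : seq (atom R)) :
  log_var_le f V -> packing s ->
  logW (size s) * \sum_(t <- s) jump f t <= (size s)%:R * V.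
Proof.
move=> fV ps; pose d : atom R := (0, 0, 0); set n := size s.
have : \sum_(r < n) wvar logw f 0 (rot r s) <= \sum_(r < n) V.
  by apply: ler_sum => r _; apply: fV; exact: packing_rot.
rewrite sumr_const card_ord mulr_natl; apply: le_trans.
under [leRHS]eq_bigr do rewrite (wvarE _ _ _ _ d) size_rot.
rewrite exchange_big /logW mulr_suml; apply: ler_sum => l _.
rewrite -mulr_sumr ler_wpM2l ?logw_ge0//.
rewrite le_eqVlt; apply/orP; left; apply/eqP.
have <- : \sum_(t <- rot l s) jump f t = \sum_(t <- s) jump f t.
  by apply: perm_big; rewrite perm_rot.
rewrite (big_nth d) size_rot big_mkord; apply: eq_bigr => r _.
by rewrite -head_rot ?size_rot ?ltn_ord// rot_rot head_rot// size_rot.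
Qed.

Definition dist (i j : nat) : nat := (i - j + (j - i))%N.

(** Separates the indices to the left of c from those to the right, where the
    distance determines the index. *)
Lemma sum_by_dist (R : realType) (n c : nat) (P : pred nat) (F : nat -> R) :
  (c < n)%N ->
  \sum_(i < n | P (dist i c)) F i = (if P 0%N then F c else 0) +
    (\sum_(l < c | P l.+1) F (c - l.+1)%N +
     \sum_(l < n - c.+1 | P l.+1) F (c + l.+1)%N).
Proof.
move=> cn; rewrite -(big_mkord (fun i => P (dist i c)) F).
rewrite (big_cat_nat (n := c))//=; last exact: ltnW.
rewrite addrCA; congr (_ + _).
  rewrite big_nat_rev/= -(big_mkord (fun l => P l.+1) (fun l => F (c - l.+1)%N)).
  rewrite add0n big_nat_cond [RHS]big_nat_cond; apply: eq_bigl => i.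
  rewrite /=; case: ltnP => //= ic; congr P; rewrite /dist; lia.
rewrite big_mkcond big_ltn//=; congr (_ + _).
  by rewrite /dist subnn.
rewrite -big_mkcond/= -{1}(add0n c.+1) big_addn.
rewrite -(big_mkord (fun l => P l.+1) (fun l => F (c + l.+1)%N)).
apply: eq_big => [i|i _]; last by congr F; lia.
by congr P; rewrite /dist; lia.
Qed.

Lemma sum_window (R : realType) (f : R * R -> R) (B : nat -> atom R)
    (N K T : nat) :
  \sum_(l < N | (K < l.+1 < T)%N) logw l.+1 * jump f (B l) =
  wvar logw f K (map B (iota K (minn N T.-1 - K))).
Proof.
pose d : atom R := (0, 0, 0); rewrite (wvarE _ _ _ _ d) size_map size_iota.
set n := (minn N T.-1 - K)%N.
transitivity (\sum_(K <= l < minn N T.-1) logw l.+1 * jump f (B l)).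
  rewrite (big_nat_widenl _ 0)// (big_nat_widen _ _ N) ?geq_minl// big_mkord.
  by apply: eq_bigl => l; have := ltn_ord l; lia.
rewrite -{1}(add0n K) big_addn -/n big_mkord; apply: eq_bigr => l _.
by rewrite (nth_map 0%N) ?size_iota// nth_iota// addnC.
Qed.

Lemma log_weight_le (R : realType) (m d T : nat) : (0 < T <= d)%N ->
  (d < 2 ^ m)%N -> logw d <= m%:R / T%:R :> R.
Proof.
move=> /andP[T0 Td] dm; rewrite /logw ler_pM ?ln_ge0 ?ler1n//.
  apply: (@le_trans _ _ (ln (2 ^ m)%:R)); first exact: ler_ln_nat.
  by rewrite lnXn2 ler_piMr// ln2_le1.
by rewrite lef_pV2 ?posrE ?ltr0n// ?ler_nat// (leq_trans T0).
Qed.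

Definition cell_atoms {R : realType} (m : nat) (A : nat -> atom R) : Prop :=
  forall i, (i < 2 ^ m)%N -> [/\ inside (A i), in_cell m i (A i).1.1 &
    in_cell m i (A i).1.2].

Lemma packing_cell_atoms (R : realType) (m : nat) (A : nat -> atom R)
    (s : seq nat) :
  cell_atoms m A -> uniq s -> all (fun i => i < 2 ^ m)%N s -> packing (map A s).
Proof.
move=> mA us sm; apply/andP; split.
  by apply/allP => _ /mapP[i /(allP sm) im ->]; have [] := mA i im.
pose B (i j : nat) := i != j.
have : pairwise B s by rewrite -uniq_pairwise.
rewrite pairwise_map; apply: (sub_in_pairwise _ sm) => i j im jm /= ij.
have [/and4P[_ i1 _ _] /in_cellE/andP[i2 i3] /in_cellE/andP[i4 i5]] := mA i im.
have [/and4P[_ j1 _ _] /in_cellE/andP[j2 j3] /in_cellE/andP[j4 j5]] := mA j jm.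
have mono (k l : nat) : (k < l)%N -> k.+1%:R / 2 ^+ m <= l%:R / 2 ^+ m :> R.
  by move=> kl; rewrite ler_pM2r ?invr_gt0 ?exprn_gt0// ler_nat.
rewrite /apart; apply/orP; move: ij; rewrite /B neq_ltn => /orP[]/mono h.
  by left; lra.
by right; lra.
Qed.

(** Cells far from x all have weights of order (log 2^m)/2^m, those near x but
    beyond the first K form a packing near x. *)
Lemma tail_small (R : realType) (f : R * R -> R) (V x e : R) :
  log_var_le f V -> unitI x -> 0 < e ->
  exists K m0, forall m c A, (m0 <= m)%N -> in_cell m c x -> cell_atoms m A ->
    \sum_(i < 2 ^ m | (K < dist i c)%N) logw (dist i c) * jump f (A i) <= e.
Proof.
move=> fV Ix e0; have e3 : 0 < e / 3 by rewrite divr_gt0.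
have [K [d d0 dP]] := small_wvar_near x fV e3.
have L := ln2_gt0 R.
have V0 : 0 <= V by apply: (fV [::]).
(* For m > C the far cells contribute at most e / 3, and for m >= m1 the
   distance T at which they begin is positive. *)
pose C := (Num.truncn (3 * 8 * V / (d * ln 2 * e))).+1.
have [m1 m1d] : exists k, 2 ^- k < d / 2 by apply: exp2_small; rewrite divr_gt0.
exists K, (maxn C.+1 m1) => m c A; rewrite geq_max => /andP[Cm m1m] xc mA.
have cm := in_cell_lt Ix xc.
have M0 : 0 < 2 ^+ m :> R by rewrite exprn_gt0.
pose T := Num.truncn (d * 2 ^+ m).
have dm : 2 < d * 2 ^+ m.
  have : 2 ^- m < d / 2 by apply: le_lt_trans m1d; exact: exp2V_le.
  by rewrite -[_^-1]mul1r ltr_pdivrMr// => h; lra.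
have /andP[T1 T2] : T%:R <= d * 2 ^+ m < T.+1%:R.
  by apply: truncn_itv; lra.
have T0 : (0 < T)%N.
  by rewrite -(ltr_nat R); rewrite -natr1 in T2; lra.
clearbody T.
set F := fun i => logw (dist i c) * jump f (A i).
have F0 i : 0 <= F i by rewrite mulr_ge0 ?logw_ge0 ?jump_ge0.
have split3 : \sum_(i < 2 ^ m | (K < dist i c)%N) F i <=
    \sum_(i < 2 ^ m | (K < dist i c < T)%N) F i +
    \sum_(i < 2 ^ m | (T <= dist i c)%N) F i.
  rewrite [leLHS]big_mkcond [X in _ <= X + _]big_mkcond.
  rewrite [X in _ <= _ + X]big_mkcond -big_split; apply: ler_sum => i _ /=.
  by case: (ltnP K) => _; case: (leqP T) => _ /=; rewrite ?add0r ?addr0.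
apply: le_trans split3 _.
have /in_cellE/andP[cl cr] := xc.
have cellE (k : nat) : k.+1%:R / 2 ^+ m = k%:R / 2 ^+ m + 2 ^- m :> R.
  by rewrite -natr1 mulrDl mul1r.
have near : \sum_(i < 2 ^ m | (K < dist i c < T)%N) F i <= e / 3 + e / 3.
  rewrite (@sum_by_dist _ _ _ (fun k => (K < k < T)%N))//= add0r lerD//.
    have -> : \sum_(l < c | (K < l.+1 < T)%N) F (c - l.+1)%N =
        \sum_(l < c | (K < l.+1 < T)%N) logw l.+1 * jump f (A (c - l.+1)%N).
      apply: eq_bigr => l _; rewrite /F; congr (logw _ * _).
      by have := ltn_ord l; rewrite /dist; clear; lia.
    rewrite (sum_window f (fun l => A (c - l.+1)%N)).
    rewrite (map_comp A (fun l => c - l.+1)%N).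
    apply: dP.
      apply: (packing_cell_atoms mA).
        rewrite map_inj_in_uniq ?iota_uniq// => i j.
        by rewrite !mem_iota; clear; lia.
      by apply/allP => _ /mapP[i + ->]; rewrite mem_iota => h; move: h cm; clear; lia.
    apply/allP => _ /mapP[_ /mapP[i + ->] ->]; rewrite mem_iota => h.
    have [ |iA /in_cellE/andP[i2 i3] /in_cellE/andP[i4 i5]] := mA (c - i.+1)%N.
      by move: h cm; clear; lia.
    apply/orP; left.
    have h1 : (c - i.+1).+1%:R / 2 ^+ m <= c%:R / 2 ^+ m :> R.
      by rewrite ler_pM2r ?invr_gt0// ler_nat; move: h cm; clear; lia.
    have h2 : c.+1%:R / 2 ^+ m <= (c - i.+1)%:R / 2 ^+ m + d :> R.
      rewrite -lerBlDl -mulrBl ler_pdivrMr// (le_trans _ T1)// lerBlDr -natrD.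
      by rewrite ler_nat; move: h cm; clear; lia.
    by apply/andP; split; lra.
  have -> : \sum_(l < 2 ^ m - c.+1 | (K < l.+1 < T)%N) F (c + l.+1)%N =
      \sum_(l < 2 ^ m - c.+1 | (K < l.+1 < T)%N)
        logw l.+1 * jump f (A (c + l.+1)%N).
    apply: eq_bigr => l _; rewrite /F; congr (logw _ * _).
    by rewrite /dist; clear; lia.
  rewrite (sum_window f (fun l => A (c + l.+1)%N)).
  rewrite (map_comp A (fun l => c + l.+1)%N).
  apply: dP.
    apply: (packing_cell_atoms mA).
      rewrite map_inj_in_uniq ?iota_uniq// => i j.
      by rewrite !mem_iota; clear; lia.
    by apply/allP => _ /mapP[i + ->]; rewrite mem_iota => h; move: h cm; clear; lia.
  apply/allP => _ /mapP[_ /mapP[i + ->] ->]; rewrite mem_iota => h.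
  have [ |iA /in_cellE/andP[i2 i3] /in_cellE/andP[i4 i5]] := mA (c + i.+1)%N.
    by move: h cm; clear; lia.
  apply/orP; right.
  have h1 : c.+1%:R / 2 ^+ m <= (c + i.+1)%:R / 2 ^+ m :> R.
    by rewrite ler_pM2r ?invr_gt0// ler_nat; move: h cm; clear; lia.
  have h2 : (c + i.+1).+1%:R / 2 ^+ m <= c%:R / 2 ^+ m + d :> R.
    rewrite -lerBlDl -mulrBl ler_pdivrMr// (le_trans _ T1)// lerBlDr -natrD.
    by rewrite ler_nat; move: h cm; clear; lia.
  by apply/andP; split; lra.
have far : \sum_(i < 2 ^ m | (T <= dist i c)%N) F i <= e / 3.
  have allA : logW (2 ^ m) * \sum_(i < 2 ^ m) jump f (A i) <= (2 ^ m)%:R * V.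
    have := @sum_jump_le _ f V (map A (index_iota 0 (2 ^ m))) fV.
    rewrite size_map size_iota subn0 big_map big_mkord; apply.
    apply: (packing_cell_atoms mA); first exact: iota_uniq.
    by apply/allP => i; rewrite mem_index_iota.
  set S := \sum_(i < 2 ^ m) _ in allA.
  have S0 : 0 <= S by apply: sumr_ge0 => i _; exact: jump_ge0.
  have : \sum_(i < 2 ^ m | (T <= dist i c)%N) F i <= m%:R / T%:R * S.
    rewrite mulr_sumr big_mkcond; apply: ler_sum => i _.
    case: ifPn => [Ti|_]; last first.
      by rewrite mulr_ge0 ?jump_ge0// divr_ge0.
    rewrite ler_wpM2r ?jump_ge0// log_weight_le ?T0//.
    by have := ltn_ord i; move: cm; rewrite /dist; clear; lia.
  move=> h; apply: (le_trans h).
  have WS := le_trans (ler_wpM2r S0 (logW_exp2 R m)) allA.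
  have Tr : d * 2 ^+ m <= 2 * T%:R by rewrite -natr1 in T2; lra.
  have T0r : 0 < T%:R :> R by rewrite ltr0n.
  have mC : 3 * 8 * V / (d * ln 2 * e) < m%:R - 1.
    apply: (@lt_le_trans _ _ C%:R); first exact: truncnS_gt.
    by rewrite lerBrDr natr1 ler_nat.
  have den : 0 < d * ln 2 * e by rewrite !mulr_gt0.
  rewrite ltr_pdivrMr// in mC.
  have m10 : 0 < m%:R - 1 :> R.
    by rewrite subr_gt0 ltr1n (leq_trans _ Cm).
  rewrite natrX in WS; clear - WS Tr mC m10 T0r L e0 M0.
  rewrite mulrAC ler_pdivrMr//.
  rewrite -(ler_pM2l (mulr_gt0 m10 L)).
  apply: (@le_trans _ _ (4 * (2 ^+ m * V))); first by lra.
  apply: (@le_trans _ _ ((m%:R - 1) * ln 2 * e / 6 * (d * 2 ^+ m))).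
    have := ler_wpM2l (ltW M0) (ltW mC); lra.
  have q0 : 0 <= (m%:R - 1) * ln 2 * e / 6.
    by rewrite divr_ge0// ltW// !mulr_gt0.
  by have := ler_wpM2l q0 Tr; lra.
by lra.
Qed.

(** * The kernel as a sum of differences, and the double sum *)

(** Index 0 stands for the average over the cell c and index i + 1 for the
    cell i, so that averages, simple and mixed differences are all terms of
    one double sum. *)
Definition halves {R : realType} (c k : nat) (g : nat -> R) : R :=
  if k is i.+1 then g i.*2.+1 - g i.*2 else (g c.*2 + g c.*2.+1) / 2.

Definition halves_cell (c k : nat) : nat := if k is i.+1 then i else c.

Definition halves_dist (c k : nat) : nat := if k is i.+1 then dist i c else 0.

Definition hweight {R : realType} (d : nat) : R := (maxn 1 d)%:R^-1.

Lemma halves_le (R : realType) (c k : nat) (g : nat -> R) (S : R) :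
  `|g (halves_cell c k).*2| <= S -> `|g (halves_cell c k).*2.+1| <= S ->
  `|halves c k g| <= 2 * S.
Proof.
case: k => [|i] /=; rewrite !ler_norml => /andP[a b] /andP[d e];
  by apply/andP; split; lra.
Qed.

Lemma halves_sum (R : realType) (c k : nat) (I : Type) (s : seq I)
    (g : I -> nat -> R) (a : I -> R) :
  halves c k (fun i => \sum_(j <- s) a j * g j i) =
  \sum_(j <- s) a j * halves c k (g j).
Proof.
elim: s => [|j s IH]; first by case: k => [|i]; rewrite /= !big_nil; lra.
rewrite big_cons -IH.
by case: k {IH} => [|i] /=; rewrite !big_cons; ring.
Qed.

Lemma big_double (R : realType) (n : nat) (F : nat -> R) :
  \sum_(i < n.*2) F i = \sum_(i < n) (F i.*2 + F i.*2.+1).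
Proof.
elim: n => [|n IH]; first by rewrite !big_ord0.
by rewrite doubleS !big_ord_recr/= IH addrA.
Qed.

(** Indices at distance at least t cannot have the same quotient by t. *)
Lemma dist_log (i c : nat) : (0 < dist i c)%N ->
  (i %/ 2 ^ trunc_log 2 (dist i c) <> c %/ 2 ^ trunc_log 2 (dist i c))%N.
Proof.
move=> d0; have := trunc_logP (isT : (1 < 2)%N) d0.
set t := (2 ^ _)%N => td.
have t0 : (0 < t)%N by rewrite expn_gt0.
have h1 := divn_eq i t; have h2 := divn_eq c t.
have h3 := ltn_pmod i t0; have h4 := ltn_pmod c t0.
move: td h1 h2 h3 h4; rewrite /dist.
set a := (i %/ t)%N; set b := (c %/ t)%N; set u := (i %% t)%N; set v := (c %% t)%N.
move=> td h1 h2 h3 h4 ab; subst b; rewrite -ab in h2.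
by move: td h1 h2 h3 h4; clear; lia.
Qed.

(** The kernel of order 2^m averages over the cell of x. The remaining part of
    the kernel is a Rademacher function times the kernel of order M - 2^m,
    which is constant on each cell; its size is bounded by comparing complete
    blocks of Walsh functions. *)
Lemma kernel_split (R : realType) (m M c : nat) (x : R) :
  unitI x -> in_cell m c x -> (2 ^ m <= M < 2 ^ m.+1)%N ->
  exists kap : nat -> R,
  [/\ kap 0%N = 1,
      forall g : nat -> R, \sum_(a < 2 ^ m.+1)
        walsh_kernel M x (a%:R / 2 ^+ m.+1) / 2 ^+ m.+1 * g a =
        \sum_(k < (2 ^ m).+1) kap k * halves c k g,
      forall k, (k < (2 ^ m).+1)%N -> `|kap k| <= hweight (halves_dist c k) &
      forall k r, (k < (2 ^ m).+1)%N -> (r <= m)%N ->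
        (halves_cell c k %/ 2 ^ (m - r) <> c %/ 2 ^ (m - r))%N ->
        `|kap k| <= 2 ^+ r / 2 ^+ m].
Proof.
move=> Ix xc /andP[mM Mm].
pose M' := (M - 2 ^ m)%N.
have ME : (M = 1 * 2 ^ m + M')%N by rewrite mul1n subnKC.
have M'm : (M' < 2 ^ m)%N by rewrite ltn_subLR// addnn -mul2n -expnS.
pose s (i : nat) : R := i%:R / 2 ^+ m.
pose kap k : R := if k is i.+1 then
  - (rademacher m x * walsh_kernel M' x (s i) / 2 ^+ m.+1) else 1.
have m0 : 0 < 2 ^+ m :> R by rewrite exprn_gt0.
have cm := in_cell_lt Ix xc.
have kap_far i r : (i < 2 ^ m)%N -> (r <= m)%N ->
    (i %/ 2 ^ (m - r) <> c %/ 2 ^ (m - r))%N ->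
    `|kap i.+1| <= 2 ^+ r / 2 ^+ m / 2.
  move=> im rm ic; rewrite /= normrN !normrM normr_rademacher mul1r.
  rewrite (ger0_norm (_ : 0 <= 2 ^- m.+1)) ?invr_ge0 ?exprn_ge0//.
  rewrite exprS [2 * _]mulrC invfM mulrA ler_pM2r ?invr_gt0//.
  rewrite ler_pM2r ?invr_gt0//.
  have rmE : (m = r + (m - r))%N by rewrite subnKC.
  have cr : (c %/ 2 ^ (m - r) < 2 ^ r)%N.
    by rewrite ltn_divLR ?expn_gt0// -expnD subnKC.
  have ir : (i %/ 2 ^ (m - r) < 2 ^ r)%N.
    by rewrite ltn_divLR ?expn_gt0// -expnD subnKC.
  apply: (walsh_kernel_diff_le _ cr ir) => //; last exact: nesym.
    by apply: in_cell_coarse; rewrite -rmE.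
  by apply: in_cell_coarse; rewrite -rmE; exact: in_cell_left.
exists kap; split => //.
- move=> g; rewrite big_ord_recl/= mul1r expnS mul2n.
  rewrite (big_double _ (fun a =>
    walsh_kernel M x (a%:R / 2 ^+ m.+1) / 2 ^+ m.+1 * g a)).
  pose w := rademacher m x.
  have term i b : (i < 2 ^ m)%N -> (b < 2)%N ->
      walsh_kernel M x ((i.*2 + b)%:R / 2 ^+ m.+1) =
      (i == c)%:R * 2 ^+ m + w * (-1) ^+ b * walsh_kernel M' x (s i).
    move=> im b2; set u : R := _%:R / 2 ^+ m.+1.
    have ub : in_cell m.+1 (i.*2 + b) u by exact: in_cell_left.
    have ui : in_cell m i u := in_cell_double b2 ub.
    rewrite ME walsh_kernelD ?(ltnW M'm)// mul1n !walsh_exp2.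
    rewrite (rademacher_cell ub) oddD odd_double/=.
    have -> : walsh_kernel M' x u = walsh_kernel M' x (s i).
      apply: eq_bigr => k _; congr (_ * _).
      by apply: walsh_cell_left ui; rewrite (ltn_trans (ltn_ord k)).
    have -> : (-1) ^+ odd b = (-1) ^+ b :> R by rewrite signr_odd.
    congr (_ + _); have [ic|ic] := eqVneq i c.
      by rewrite mul1r; apply: walsh_kernel_same xc _; rewrite -ic.
    by rewrite mul0r; apply: (walsh_kernel_diff cm im xc ui); exact/nesym/eqP.
  have mS : 2 ^+ m.+1 = 2 * 2 ^+ m :> R by rewrite exprS.
  have m1 : 2 ^+ m != 0 :> R by rewrite gt_eqF.
  transitivity (\sum_(i < 2 ^ m)
      ((if i == c :> nat then (g i.*2 + g i.*2.+1) / 2 else 0) +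
       kap i.+1 * (g i.*2.+1 - g i.*2))).
    apply: eq_bigr => i _; have := term i 0%N (ltn_ord i) isT.
    have := term i 1%N (ltn_ord i) isT; rewrite addn0 addn1 => -> ->.
    by rewrite /kap -/w mS; case: ifP => _ /=; field.
  rewrite big_split/=; congr (_ + _).
  by rewrite -big_mkcond/= (big_pred1 (Ordinal cm)).
- case=> [|i] km.
    by rewrite /= /hweight normr1 invr1.
  have im : (i < 2 ^ m)%N by [].
  rewrite /hweight [halves_dist _ _]/=.
  have [d0|d0] := posnP (dist i c).
    rewrite d0 /= invr1 normrN !normrM normr_rademacher mul1r.
    rewrite (ger0_norm (_ : 0 <= 2 ^- m.+1)) ?invr_ge0 ?exprn_ge0//.
    rewrite ler_pdivrMr ?exprn_gt0// mul1r.
    apply: le_trans (walsh_kernel_le _ _ _) _; rewrite -natrX ler_nat.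
    by rewrite (leq_trans (ltnW M'm))// leq_exp2l.
  rewrite (maxn_idPr d0).
  have /andP[t1 t2] := trunc_log_bounds (isT : (1 < 2)%N) d0.
  have := dist_log d0; set t := trunc_log 2 (dist i c) in t1 t2 *.
  have tm : (t <= m)%N.
    rewrite -(leq_exp2l _ _ (isT : (1 < 2)%N)) (leq_trans t1)//.
    by move: im cm; rewrite /dist; clear; lia.
  move=> h; have := kap_far i (m - t)%N im (leq_subr _ _).
  rewrite subKn// => /(_ h); move/le_trans; apply.
  have d0r : 0 < (dist i c)%:R :> R by rewrite ltr0n.
  rewrite -[X in _ <= X]mul1r ler_pdivlMr//.
  have : (dist i c)%:R <= 2 * 2 ^+ t :> R.
    by rewrite -exprS -natrX ler_nat ltnW.
  have -> : 2 ^+ m = 2 ^+ (m - t) * 2 ^+ t :> R by rewrite -exprD subnK.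
  have a0 : 2 ^+ (m - t) != 0 :> R by rewrite expf_neq0.
  have b0 : 0 < 2 ^+ t :> R by rewrite exprn_gt0.
  set A := 2 ^+ (m - t) in a0 *; set B := 2 ^+ t in b0 *.
  have b1 : B != 0 by rewrite gt_eqF.
  have -> : A / (A * B) / 2 * (dist i c)%:R = (dist i c)%:R / (2 * B) by field; apply/andP.
  by rewrite ler_pdivrMr ?mulr_gt0// mul1r.
- case=> [|i] r km rm //= h.
  apply: le_trans (kap_far i r km rm h) _.
  by rewrite ler_pdivrMr// ler_peMr ?ler1n.
Qed.

Lemma harmonic_le (R : realType) (D : nat) :
  \sum_(l < D) l.+1%:R^-1 <= 2 * ln D.+1%:R :> R.
Proof.
elim: D => [|D IH]; first by rewrite big_ord0 ln1 mulr0.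
rewrite big_ord_recr/=; apply: le_trans (lerD IH (lexx _)) _.
have D0 : 0 < D.+1%:R :> R by rewrite ltr0n.
have D1 : 0 < D.+2%:R :> R by rewrite ltr0n.
have D1E : D.+2%:R = D.+1%:R + 1 :> R by rewrite natr1.
have : ln (1 + - D.+2%:R^-1) <= - D.+2%:R^-1 :> R.
  by apply: le_ln1Dx; rewrite ltrN2 invf_lt1// ltr1n.
have -> : 1 - D.+2%:R^-1 = D.+1%:R / D.+2%:R :> R.
  rewrite D1E; move: D0; set a := D.+1%:R => D0.
  by have a1 : a + 1 != 0 by [rewrite gt_eqF// addr_gt0]; field.
rewrite ln_div ?posrE// => h.
have : D.+1%:R^-1 <= 2 * D.+2%:R^-1 :> R.
  rewrite -[X in X <= _]mul1r ler_pdivrMr// mulrAC ler_pdivlMr// D1E.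
  have : 1 <= D.+1%:R :> R by rewrite ler1n.
  by set b := D.+1%:R => b1; lra.
move: h; set p := D.+2%:R^-1; set q := D.+1%:R^-1 => h qp.
by lra.
Qed.

Lemma sum_hweight_le (R : realType) (n c D : nat) : (c < n)%N -> (0 < D)%N ->
  \sum_(k < n.+1 | (halves_dist c k <= D)%N) hweight (halves_dist c k) <=
  8 * ln D.+1%:R :> R.
Proof.
move=> cn D0; rewrite big_mkcond big_ord_recl/= {1}/hweight invr1.
rewrite -(big_mkcond (fun i : 'I_n => (dist i c <= D)%N)
  (fun i => hweight (dist i c)))/=.
rewrite (@sum_by_dist _ n c (fun d => (d <= D)%N)
  (fun i => hweight (dist i c)))//= /hweight {1}/dist subnn/= invr1.
have H N (F : nat -> R) : (forall l, (l < N)%N -> F l = l.+1%:R^-1) ->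
    \sum_(l < N | (l < D)%N) F l <= 2 * ln D.+1%:R.
  move=> FE; apply: le_trans (harmonic_le R D).
  rewrite (eq_bigr (fun l : 'I_N => l.+1%:R^-1)) => [|l _]; last exact: FE.
  rewrite -(big_mkord (fun l => (l < D)%N) (fun l => l.+1%:R^-1)).
  rewrite -(big_mkord xpredT (fun l => l.+1%:R^-1)).
  have [ND|DN] := leqP N D.
    rewrite (big_cat_nat (n := N) (p := D))//= -[X in X <= _]addr0 lerD//.
      rewrite [leLHS]big_mkcond; apply: ler_sum => i _; case: ifP => // _.
    by apply: sumr_ge0 => i _; rewrite invr_ge0.
  by rewrite [X in _ <= X](big_nat_widen _ _ N)//; exact: ltnW.
have h1 := H c (fun l => (maxn 1 (dist (c - l.+1) c))%:R^-1) _.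
have h2 := H (n - c.+1)%N (fun l => (maxn 1 (dist (c + l.+1) c))%:R^-1) _.
have {}h1 := h1 (fun l lc => ltac:(by congr (_%:R^-1); rewrite /dist; lia)).
have {}h2 := h2 (fun l lc => ltac:(by congr (_%:R^-1); rewrite /dist; lia)).
have : 1 <= 2 * ln D.+1%:R :> R.
  apply: le_trans (_ : 2 * ln 2 <= _); last by rewrite ler_pM2l// ler_ln_nat.
  have := harmonic_le R 1; rewrite big_ord1 invr1; exact.
by lra.
Qed.

(** The indices are ordered by the larger of the two distances: for d' <= d
    the inner sum contributes log d, which together with the weight 1/d gives
    the weight of the one-dimensional variation. *)
Lemma mixed_sum_le (R : realType) (n n' c c' K : nat) (kap lam u v : nat -> R)
    (G : nat -> nat -> R) (a e : R) :
  (c < n)%N -> (c' < n')%N -> (0 < K)%N -> 0 <= a ->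
  (forall k, (k < n.+1)%N -> `|kap k| <= hweight (halves_dist c k)) ->
  (forall l, (l < n'.+1)%N -> `|lam l| <= hweight (halves_dist c' l)) ->
  (forall i l, (i < n)%N -> (l < n'.+1)%N -> `|G i.+1 l| <= 2 * u i) ->
  (forall k j, (k < n.+1)%N -> (j < n')%N -> `|G k j.+1| <= 2 * v j) ->
  \sum_(i < n | (K < dist i c)%N) logw (dist i c) * u i <= e ->
  \sum_(j < n' | (K < dist j c')%N) logw (dist j c') * v j <= e ->
  (forall k l, (k < n.+1)%N -> (l < n'.+1)%N ->
    (halves_dist c k <= K)%N -> (halves_dist c' l <= K)%N ->
    `|kap k * lam l * G k l| <=
      a * (hweight (halves_dist c k) * hweight (halves_dist c' l))) ->
  `|\sum_(k < n.+1) \sum_(l < n'.+1) kap k * lam l * G k l| <=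
  a * (8 * ln K.+1%:R) ^+ 2 + 16 * e + 16 * e.
Proof.
move=> cn cn' K0 a0 kapP lamP Gu Gv ue ve core.
pose d k := halves_dist c k; pose d' l := halves_dist c' l.
pose w (i : nat) : R := hweight i.
have w0 i : 0 <= w i by rewrite /w /hweight invr_ge0.
pose X k l := `|kap k * lam l * G k l|.
have X0 k l : 0 <= X k l by exact: normr_ge0.
have bound : \sum_(k < n.+1) \sum_(l < n'.+1) X k l <=
    \sum_(k < n.+1 | (d k <= K)%N) \sum_(l < n'.+1 | (d' l <= K)%N) X k l +
    \sum_(k < n.+1 | (K < d k)%N) \sum_(l < n'.+1 | (d' l <= d k)%N) X k l +
    \sum_(l < n'.+1 | (K < d' l)%N) \sum_(k < n.+1 | (d k <= d' l)%N) X k l.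
  rewrite [X in _ <= _ + X](exchange_big_dep xpredT)//=.
  rewrite [X in _ <= X + _ + _]big_mkcond [X in _ <= _ + X + _]big_mkcond.
  rewrite -!big_split; apply: ler_sum => k _ /=.
  have mk (b : bool) (P : pred 'I_n'.+1) : (if b then \sum_(l < n'.+1 | P l) X k l
      else 0) = \sum_(l < n'.+1) (if b && P l then X k l else 0).
    by case: b; [rewrite big_mkcond | rewrite big1].
  rewrite !mk [X in _ <= _ + X]big_mkcond -!big_split; apply: ler_sum => l _ /=.
  case: (leqP (d k) K) => h1; case: (leqP (d' l) K) => h2 /=.
  - by rewrite !addr0.
  - by rewrite (leq_trans h1 (ltnW h2)) !add0r.
  - by rewrite (leq_trans h2 (ltnW h1)) add0r addr0.
  - case: (leqP (d' l) (d k)) => h3 /=; last by rewrite (ltnW h3) !add0r.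
    by rewrite add0r lerDl; case: ifP.
have side N N' b b' (f g h : nat -> R) (Y : nat -> nat -> R) :
    (b < N)%N -> (b' < N')%N ->
    (forall k, (k < N.+1)%N -> `|f k| <= hweight (halves_dist b k)) ->
    (forall l, (l < N'.+1)%N -> `|g l| <= hweight (halves_dist b' l)) ->
    (forall i l, (i < N)%N -> (l < N'.+1)%N ->
       Y i.+1 l <= `|f i.+1| * `|g l| * (2 * h i)) ->
    (forall i, (i < N)%N -> 0 <= h i) ->
    \sum_(i < N | (K < dist i b)%N) logw (dist i b) * h i <= e ->
    \sum_(k < N.+1 | (K < halves_dist b k)%N)
      \sum_(l < N'.+1 | (halves_dist b' l <= halves_dist b k)%N) Y k l <= 16 * e.
  move=> bN bN' fP gP YP h0 he.
  rewrite big_mkcond big_ord_recl/= add0r.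
  rewrite -(big_mkcond (fun i : 'I_N => (K < dist i b)%N)
    (fun i : 'I_N => \sum_(l < N'.+1 | (halves_dist b' l <= dist i b)%N) Y i.+1 l)).
  rewrite -(ler_pM2l (_ : 0 < 16)) in he => //; apply: le_trans he.
  rewrite mulr_sumr; apply: ler_sum => i Ki.
  have D0 : (0 < dist i b)%N by rewrite (leq_trans K0)// ltnW.
  apply: (@le_trans _ _ (\sum_(l < N'.+1 | (halves_dist b' l <= dist i b)%N)
      hweight (halves_dist b' l) * (`|f i.+1| * (2 * h i)))).
    apply: ler_sum => l _; apply: le_trans (YP i l _ _) _ => //.
    rewrite mulrAC -mulrA mulrC mulrAC.
    have : `|g l| <= hweight (halves_dist b' l) by exact: gP.
    have : 0 <= `|f i.+1| * (2 * h i) by rewrite mulr_ge0// mulr_ge0// h0.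
    by move=> p0 p1; rewrite mulrC mulrAC -mulrA [_ * (2 * _)]mulrC mulrC;
      have := ler_wpM2r p0 p1; lra.
  rewrite -mulr_suml.
  have := sum_hweight_le R bN' D0; set S := \sum_(_ < _ | _) _ => Sle.
  have f1 : `|f i.+1| <= (dist i b)%:R^-1.
    by have := fP i.+1 (ltn_ord i); rewrite /hweight/= (maxn_idPr D0).
  have hi : 0 <= 2 * h i by rewrite mulr_ge0// h0.
  have L0 : 0 <= ln (dist i b).+1%:R :> R by rewrite ln_ge0// ler1n.
  apply: (@le_trans _ _ (8 * ln (dist i b).+1%:R * (`|f i.+1| * (2 * h i)))).
    by rewrite ler_wpM2r// mulr_ge0.
  apply: (@le_trans _ _ (8 * ln (dist i b).+1%:R *
      ((dist i b)%:R^-1 * (2 * h i)))).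
    by rewrite ler_wpM2l ?mulr_ge0// ler_wpM2r.
  by rewrite /logw; lra.
apply: (@le_trans _ _ (\sum_(k < n.+1) \sum_(l < n'.+1) X k l)).
  apply: le_trans (ler_norm_sum _ _ _) _; apply: ler_sum => k _.
  exact: ler_norm_sum.
apply: (le_trans bound); rewrite lerD// ?lerD//.
- apply: (@le_trans _ _ (\sum_(k < n.+1 | (d k <= K)%N)
      \sum_(l < n'.+1 | (d' l <= K)%N) a * (w (d k) * w (d' l)))).
    by apply: ler_sum => k dk; apply: ler_sum => l dl; exact: core.
  under eq_bigr do rewrite -mulr_sumr -mulr_sumr.
  rewrite -mulr_sumr -mulr_suml expr2 ler_wpM2l// ler_pM//.
  + by apply: sumr_ge0.
  + by apply: sumr_ge0.
  + exact: sum_hweight_le.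
  + exact: sum_hweight_le.
- apply: (side n n' c c' kap lam u) => //.
    move=> i l ii ll; rewrite /X !normrM ler_wpM2l ?mulr_ge0//.
    exact: Gu.
  move=> i ii; have := le_trans (normr_ge0 _) (Gu i 0%N ii isT).
  by rewrite pmulr_rge0.
- apply: (side n' n c' c lam kap v (fun l k => X k l)) => //.
    move=> i l ii ll; rewrite /X !normrM [X in _ <= X * _]mulrC.
    by rewrite ler_wpM2l ?mulr_ge0//; exact: Gv.
  move=> i ii; have := le_trans (normr_ge0 _) (Gv 0%N i isT ii).
  by rewrite pmulr_rge0.
Qed.

(** * Convergence at points of continuity *)

Lemma exists_max (R : realType) (n : nat) (h : nat -> R) : (0 < n)%N ->
  exists2 j, (j < n)%N & forall k, (k < n)%N -> h k <= h j.
Proof.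
case: n => // n _; elim: n => [|n [j jn hj]].
  by exists 0%N => // -[].
have [le|lt] := leP (h n.+1) (h j).
  exists j; first exact: ltnW.
  by move=> k; rewrite ltnS leq_eqVlt => /predU1P[->//|]; exact: hj.
exists n.+1 => // k; rewrite ltnS leq_eqVlt => /predU1P[->//|kn].
by rewrite (le_trans (hj k kn))// ltW.
Qed.

(** Continuity with respect to the topology of cells, which controls f at
    every point of a small cell. *)
Definition cell_continuous {R : realType} (f : R * R -> R) (x y : R) : Prop :=
  forall e, 0 < e -> exists k0, forall k l i j s t, (k0 <= k)%N -> (k0 <= l)%N ->
    in_cell k i x -> in_cell k i s -> in_cell l j y -> in_cell l j t ->
    `|f (s, t) - f (x, y)| <= e.

(** One choice of second coordinates bounds the differences along all grid
    lines at once, and the variation allows the second coordinate to depend on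
    the interval. *)
Lemma max_atoms (R : realType) (f : R * R -> R) (m n : nat) (z w : R) :
  in_cell m.+1 0 z -> in_cell n.+1 0 w ->
  exists A : nat -> atom R, cell_atoms m A /\
    forall i b, (i < 2 ^ m)%N -> (b < 2 ^ n.+1)%N ->
      `|f (z + i.*2.+1%:R / 2 ^+ m.+1, w + b%:R / 2 ^+ n.+1) -
        f (z + i.*2%:R / 2 ^+ m.+1, w + b%:R / 2 ^+ n.+1)| <= jump f (A i).
Proof.
move=> z0 w0.
pose D (i b : nat) := `|f (z + i.*2.+1%:R / 2 ^+ m.+1, w + b%:R / 2 ^+ n.+1) -
        f (z + i.*2%:R / 2 ^+ m.+1, w + b%:R / 2 ^+ n.+1)|.
have /choice[Y YP] : forall i, exists j, (j < 2 ^ n.+1)%N /\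
    forall b, (b < 2 ^ n.+1)%N -> D i b <= D i j.
  move=> i; have [j j1 j2] := exists_max (D i) (expn_gt0 2 n.+1 : (0 < 2 ^ n.+1)%N).
  by exists j.
exists (fun i => ((z + i.*2%:R / 2 ^+ m.+1, z + i.*2.+1%:R / 2 ^+ m.+1),
  w + (Y i)%:R / 2 ^+ n.+1)); split; last by move=> i b im bn; exact: (YP i).2.
move=> i im /=.
have c0 : in_cell m.+1 (i.*2 + 0) (z + i.*2%:R / 2 ^+ m.+1).
  by rewrite addn0; exact: in_cell_shift.
have c1 : in_cell m.+1 (i.*2 + 1) (z + i.*2.+1%:R / 2 ^+ m.+1).
  by rewrite addn1; exact: in_cell_shift.
have d0 := in_cell_double (isT : (0 < 2)%N) c0.
have d1 := in_cell_double (isT : (1 < 2)%N) c1.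
split => //; have := cell_unitI im d0; have := cell_unitI im d1.
have := cell_unitI (YP i).1 (in_cell_shift (Y i) w0).
rewrite /unitI /inside/= !in_itv/= => -> /andP[_ ->] /andP[-> _] /=.
rewrite andbT ltrD2l ltr_pM2r ?invr_gt0 ?exprn_gt0// ltr_nat.
by rewrite ltnSn.
Qed.

Lemma tail_sum_mono (R : realType) (n c K K' : nat) (F : nat -> R) :
  (forall i, 0 <= F i) -> (K <= K')%N ->
  \sum_(i < n | (K' < dist i c)%N) F i <= \sum_(i < n | (K < dist i c)%N) F i.
Proof.
move=> F0 KK; rewrite big_mkcond [leRHS]big_mkcond; apply: ler_sum => i _.
case: ifP => h; first by rewrite (leq_ltn_trans KK h).
by case: ifP.
Qed.

(** Pairs of cells within distance K belong either to the cells of a fixed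
    rank k0 around x and y, where f is close to f(x, y), or to a region where
    one kernel is at most 2^k0; the other pairs are covered by the tails. *)
Lemma shifted_sums_near (R : realType) (f : R * R -> R) (V V' x y e : R) :
  log_var_le f V -> log_var_le (swap f) V' -> unitI x -> unitI y ->
  cell_continuous f x y -> 0 < e ->
  exists N0, forall m n M N z, (N0 <= m)%N -> (N0 <= n)%N ->
    (2 ^ m <= M < 2 ^ m.+1)%N -> (2 ^ n <= N < 2 ^ n.+1)%N ->
    cell2 m.+1 n.+1 0 0 z ->
    `|\sum_(a < 2 ^ m.+1) \sum_(b < 2 ^ n.+1)
        (walsh_kernel M x (a%:R / 2 ^+ m.+1) / 2 ^+ m.+1) *
        (walsh_kernel N y (b%:R / 2 ^+ n.+1) / 2 ^+ n.+1) *
        f (shift2 (a%:R / 2 ^+ m.+1) (b%:R / 2 ^+ n.+1) z) - f (x, y)| <= e.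
Proof.
move=> fV fV' Ix Iy fc e0; set L := f (x, y).
have [_ [B fB]] := log_var_borel fV fV'.
have B0 : 0 <= B by apply: le_trans (fB (x, y) _).
(* The two tails enter with the factor 16 each, which leaves e / 2. *)
have e64 : 0 < e / 64 by rewrite divr_gt0.
have [K1 [m1 tail1]] := tail_small fV Ix e64.
have [K2 [m2 tail2]] := tail_small fV' Iy e64.
pose K := maxn 1 (maxn K1 K2).
have K0 : (0 < K)%N by rewrite leq_max.
have K1K : (K1 <= K)%N by rewrite !leq_max leqnn orbT.
have K2K : (K2 <= K)%N by rewrite !leq_max leqnn !orbT.
clearbody K.
pose H : R := 8 * ln K.+1%:R.
have H0 : 0 < H by rewrite mulr_gt0// ln_gt0// ltr1n ltnS.
pose a : R := e / 2 / H ^+ 2.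
have a0 : 0 < a by rewrite !divr_gt0// exprn_gt0.
have [k0 k0P] := fc (a / 4) (divr_gt0 a0 (ltr0n _ 4)).
have [k1 k1P] : exists k, 2 ^- k < a / (K%:R * 2 ^+ k0 * (8 * (B + 1))).
  apply: exp2_small; rewrite divr_gt0// !mulr_gt0 ?ltr0n ?exprn_gt0//.
  by rewrite ltr_wpDl.
have theta m : (k1 <= m)%N ->
    2 ^+ k0 / 2 ^+ m * (8 * B) <= a / K%:R.
  move=> km; rewrite ler_pdivlMr ?ltr0n//.
  have := le_lt_trans (exp2V_le R km) k1P.
  rewrite ltr_pdivlMr ?mulr_gt0 ?ltr0n ?exprn_gt0 ?ltr_wpDl// => h.
  apply: le_trans (ltW h).
  have p0 : 0 <= 2 ^- m * (K%:R * 2 ^+ k0 * 8) :> R.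
    by rewrite !mulr_ge0// ?invr_ge0 ?exprn_ge0.
  by nra.
exists (maxn (maxn m1 m2) (maxn k0 k1)) => m n M N [z w].
rewrite !geq_max => /andP[/andP[m1m _] /andP[k0m k1m]].
move=> /andP[/andP[_ m2n] /andP[k0n k1n]] mM nN [/= z0 w0].
have [c cm xc] := in_cell_exists m Ix.
have [c' cn yc] := in_cell_exists n Iy.
have [kap [kap0 kapE kapP kapF]] := kernel_split Ix xc mM.
have [lam [lam0 lamE lamP lamF]] := kernel_split Iy yc nN.
pose p (i : nat) := z + i%:R / 2 ^+ m.+1.
pose q (j : nat) := w + j%:R / 2 ^+ n.+1.
pose F i j := f (p i, q j) - L.
pose G k l := halves c k (fun i => halves c' l (F i)).
pose al (i : nat) := walsh_kernel M x (i%:R / 2 ^+ m.+1) / 2 ^+ m.+1.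
pose be (j : nat) := walsh_kernel N y (j%:R / 2 ^+ n.+1) / 2 ^+ n.+1.
have sum1 (d r : nat) (th : nat -> R) : th 0%N = 1 ->
    \sum_(k < r.+1) th k * halves d k (fun=> 1) = 1.
  move=> th0; rewrite big_ord_recl th0 /= big1 => [|i _]; first by lra.
  by rewrite subrr mulr0.
have al1 : \sum_(i < 2 ^ m.+1) al i = 1.
  rewrite -(sum1 c (2 ^ m)%N kap kap0) -kapE; apply: eq_bigr => i _.
  by rewrite mulr1.
have be1 : \sum_(j < 2 ^ n.+1) be j = 1.
  rewrite -(sum1 c' (2 ^ n)%N lam lam0) -lamE; apply: eq_bigr => j _.
  by rewrite mulr1.
rewrite -/L.
have -> : \sum_(i < 2 ^ m.+1) \sum_(j < 2 ^ n.+1) al i * be j *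
      f (shift2 (i%:R / 2 ^+ m.+1) (j%:R / 2 ^+ n.+1) (z, w)) - L =
    \sum_(k < (2 ^ m).+1) \sum_(l < (2 ^ n).+1) kap k * lam l * G k l.
  transitivity (\sum_(i < 2 ^ m.+1) al i * \sum_(j < 2 ^ n.+1) be j * F i j).
    have LE : \sum_(i < 2 ^ m.+1) al i * (\sum_(j < 2 ^ n.+1) be j * L) = L.
      by rewrite -mulr_suml al1 mul1r -mulr_suml be1 mul1r.
    rewrite -[X in _ - X]LE -sumrB; apply: eq_bigr => i _.
    rewrite !mulr_sumr -sumrB.
    by apply: eq_bigr => j _; rewrite /F /shift2/=; ring.
  transitivity (\sum_(i < 2 ^ m.+1) al i *
      (\sum_(l < (2 ^ n).+1) lam l * halves c' l (F i))).
    by apply: eq_bigr => i _; rewrite -lamE.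
  rewrite (kapE (fun i => \sum_(l < (2 ^ n).+1) lam l * halves c' l (F i))).
  apply: eq_bigr => k _.
  have hs := halves_sum c k (index_enum _)
    (fun (l : 'I_(2 ^ n).+1) i => halves c' l (F i)) (fun l => lam l).
  rewrite [halves c k _]hs.
  by rewrite mulr_sumr; apply: eq_bigr => l _; rewrite /G mulrA.
have [A [mA AP]] := max_atoms f z0 w0.
have [A' [mA' AP']] := max_atoms (swap f) w0 z0.
have dbl r (i : nat) (b : bool) : (i < 2 ^ r)%N -> (i.*2 + b < 2 ^ r.+1)%N.
  by rewrite expnS mul2n; case: b => /=; lia.
have cell_lt r d k : (d < 2 ^ r)%N -> (k < (2 ^ r).+1)%N ->
    (halves_cell d k < 2 ^ r)%N by case: k.
have -> : e = a * H ^+ 2 + 16 * (e / 64) + 16 * (e / 64).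
  by rewrite /a; field; rewrite gt_eqF.
apply: (@mixed_sum_le _ (2 ^ m) (2 ^ n) c c' K kap lam
  (fun i => jump f (A i)) (fun j => jump (swap f) (A' j))) => //.
- exact: ltW.
- move=> i l im ln.
  have -> : G i.+1 l = halves c' l (fun j => F i.*2.+1 j - F i.*2 j).
    by rewrite /G /=; case: (l) => [|j] /=; lra.
  have ln' := cell_lt n c' l cn ln.
  apply: halves_le; rewrite /F opprB addrA subrK; apply: AP => //.
    by have := dbl n _ false ln'; rewrite addn0.
  by have := dbl n _ true ln'; rewrite addn1.
- move=> k j km jn.
  have km' := cell_lt m c k cm km.
  apply: (@halves_le _ c k (fun i => F i j.*2.+1 - F i j.*2));
    rewrite /F opprB addrA subrK; apply: (AP' j) => //.
    by have := dbl m _ false km'; rewrite addn0.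
  by have := dbl m _ true km'; rewrite addn1.
- apply: le_trans (tail1 m c A m1m xc mA).
  apply: (tail_sum_mono _ _ (F := fun i => logw (dist i c) * jump f (A i))) => //.
  by move=> i; rewrite mulr_ge0 ?logw_ge0 ?jump_ge0.
- apply: le_trans (tail2 n c' A' m2n yc mA').
  apply: (tail_sum_mono _ _ (F := fun i => logw (dist i c') * jump (swap f) (A' i))) => //.
  by move=> i; rewrite mulr_ge0 ?logw_ge0 ?jump_ge0.
move=> k l km ln dk dl.
have wK d : (d <= K)%N -> K%:R^-1 <= hweight d :> R.
  move=> dK; rewrite /hweight lef_pV2 ?posrE ?ltr0n ?ler_nat ?geq_max ?K0//.
  by rewrite leq_max.
have w0' d : 0 <= hweight d :> R by rewrite /hweight invr_ge0.
have km' := cell_lt m c k cm km; have ln' := cell_lt n c' l cn ln.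
have pc (i : nat) (b : bool) : in_cell m i (p (i.*2 + b)%N).
  by apply: (in_cell_double (b := b)); [case: (b) | exact: in_cell_shift].
have qc (j : nat) (b : bool) : in_cell n j (q (j.*2 + b)%N).
  by apply: (in_cell_double (b := b)); [case: (b) | exact: in_cell_shift].
have GS S : (forall b b' : bool,
    `|F ((halves_cell c k).*2 + b)%N ((halves_cell c' l).*2 + b')%N| <= S) ->
    `|G k l| <= 4 * S.
  move=> FS; have FS' (b : bool) :
      `|halves c' l (F ((halves_cell c k).*2 + b)%N)| <= 2 * S.
    apply: halves_le; first by have := FS b false; rewrite addn0.
    by have := FS b true; rewrite addn1.
  rewrite (_ : 4 * S = 2 * (2 * S)); last by lra.
  apply: halves_le; first by have := FS' false; rewrite addn0.
  by have := FS' true; rewrite addn1.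
have Gb : `|G k l| <= 8 * B.
  rewrite (_ : 8 * B = 4 * (2 * B)); last by lra.
  apply: GS => b b'; apply: (le_trans (ler_normB _ _)).
  rewrite mulr_natl mulr2n; apply: lerD; last exact: (fB (x, y)).
  apply: fB; split.
    by apply: (cell_unitI km'); exact: pc.
  by apply: (cell_unitI ln'); exact: qc.
rewrite normrM normrM.
(* Off the cells of rank k0 the smallness of one kernel compensates for the
   mere boundedness of f. *)
have far (s t wk wl : R) r : 0 <= s -> 0 <= t -> (k0 <= r)%N -> (k1 <= r)%N ->
    s <= 2 ^+ k0 / 2 ^+ r -> t <= wl -> K%:R^-1 <= wk -> 0 <= wl ->
    s * t * `|G k l| <= a * (wk * wl).
  move=> s0 t0 k0r k1r sr twl Kwk wl0.
  have h1 : s * `|G k l| <= a / K%:R.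
    by apply: le_trans (theta r k1r); rewrite ler_pM.
  have h2 : a / K%:R <= a * wk by rewrite ler_wpM2l// ltW.
  rewrite mulrAC mulrA ler_pM//; first by rewrite mulr_ge0.
  exact: le_trans h1 h2.
have [ck|ck] := eqVneq (halves_cell c k %/ 2 ^ (m - k0))%N (c %/ 2 ^ (m - k0))%N;
  have [cl|cl] := eqVneq (halves_cell c' l %/ 2 ^ (n - k0))%N
    (c' %/ 2 ^ (n - k0))%N.
- have : `|G k l| <= 4 * (a / 4).
    apply: GS => b b'.
    have mE : (m = k0 + (m - k0))%N by rewrite subnKC.
    have nE : (n = k0 + (n - k0))%N by rewrite subnKC.
    have h1 := pc (halves_cell c k) b; have h2 := qc (halves_cell c' l) b'.
    rewrite mE in h1 xc; rewrite nE in h2 yc.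
    have {}h1 := in_cell_coarse h1; have {}h2 := in_cell_coarse h2.
    have xc' := in_cell_coarse xc; have yc' := in_cell_coarse yc.
    rewrite ck in h1; rewrite cl in h2.
    exact: (k0P _ _ _ _ _ _ (leqnn _) (leqnn _) xc' h1 yc' h2).
  rewrite mulrC mulfVK// => Ga; rewrite mulrC ler_pM//.
  by rewrite ler_pM ?kapP ?lamP.
- rewrite [`|kap k| * _]mulrC [X in a * X]mulrC.
  apply: (far _ _ _ _ n) => //; [| exact: kapP | exact: wK].
  by apply: lamF => //; exact/eqP.
- apply: (far _ _ _ _ m) => //; [| exact: lamP | exact: wK].
  by apply: kapF => //; exact/eqP.
- apply: (far _ _ _ _ m) => //; [| exact: lamP | exact: wK].
  by apply: kapF => //; exact/eqP.
Qed.

Lemma average_near (R : realType) (p q : nat) (G : R * R -> R) (L e : R) :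
  bounded_borel (cell2 p q 0 0) G ->
  (forall z, cell2 p q 0 0 z -> `|G z / 2 ^+ p / 2 ^+ q - L| <= e) ->
  `|\int[leb2]_(z in cell2 p q 0 0) G z - L| <= e.
Proof.
move=> bG GL; have mc := @measurable_cell2 R p q 0 0.
have coo : (leb2 (@cell2 R p q 0 0) < +oo)%E by rewrite leb2_cell2 ltry.
have p0 : 0 < 2 ^+ p :> R by rewrite exprn_gt0.
have q0 : 0 < 2 ^+ q :> R by rewrite exprn_gt0.
have cst (r : R) : \int[leb2]_(z in cell2 p q 0 0) (r * (2 ^+ p * 2 ^+ q)) = r.
  rewrite Rintegral_cst// leb2_cell2/=; field.
  by rewrite !gt_eqF.
have icst (r : R) : leb2.-integrable (cell2 p q 0 0) (EFin \o (fun=> r)).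
  by apply: bounded_borel_integrable => //; exact: bounded_borel_cst.
have iG : leb2.-integrable (cell2 p q 0 0) (EFin \o G).
  exact: bounded_borel_integrable.
have GLz z : cell2 p q 0 0 z -> (L - e) * (2 ^+ p * 2 ^+ q) <= G z /\
    G z <= (L + e) * (2 ^+ p * 2 ^+ q).
  have PQ : 0 <= 2 ^+ p * 2 ^+ q :> R by rewrite mulr_ge0// ltW.
  have -> : G z = G z / 2 ^+ p / 2 ^+ q * (2 ^+ p * 2 ^+ q).
    by field; rewrite !gt_eqF.
  move=> /GL; rewrite ler_norml => /andP[h1 h2].
  by split; apply: ler_wpM2r => //; lra.
have h1 : L - e <= \int[leb2]_(z in cell2 p q 0 0) G z.
  rewrite -[leLHS]cst; apply: (le_Rintegral mc (icst _) iG) => z /GLz[h _].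
  exact: h.
have h2 : \int[leb2]_(z in cell2 p q 0 0) G z <= L + e.
  rewrite -[leRHS]cst; apply: (le_Rintegral mc iG (icst _)) => z /GLz[_ h].
  exact: h.
by rewrite ler_norml; apply/andP; split; lra.
Qed.

Lemma walsh_sum_cvg (R : realType) (f : R * R -> R) (V V' x y : R) :
  log_var_le f V -> log_var_le (swap f) V' -> unitI x -> unitI y ->
  cell_continuous f x y ->
  walsh_sum f MN.1 MN.2 x y @[MN --> filter_prod \oo \oo] --> f (x, y).
Proof.
move=> fV fV' Ix Iy fc; apply/cvgrPdist_le => e e0.
have [N0 NP] := shifted_sums_near fV fV' Ix Iy fc e0.
have bf := log_var_borel fV fV'.
have large : \oo [set M | (2 ^ N0 <= M)%N] by exists (2 ^ N0)%N.
exists ([set M | (2 ^ N0 <= M)%N], [set N | (2 ^ N0 <= N)%N]) => //.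
move=> [M N] [/= hM hN].
have scale T : (2 ^ N0 <= T)%N ->
    exists2 m, (N0 <= m)%N & (2 ^ m <= T < 2 ^ m.+1)%N.
  move=> hT; have T0 : (0 < T)%N by rewrite (leq_trans _ hT)// expn_gt0.
  exists (trunc_log 2 T); last exact: trunc_log_bounds.
  by rewrite -(trunc_expnK N0 (isT : (1 < 2)%N)) leq_trunc_log.
have [m Nm mM] := scale M hM; have [n Nn nN] := scale N hN.
rewrite distrC (@walsh_sum_average _ f m.+1 n.+1)//; last 2 first.
- by case/andP: mM => _ /ltnW.
- by case/andP: nN => _ /ltnW.
apply: average_near.
  apply: bounded_borel_sum => i; apply: bounded_borel_sum => j.
  by apply: bounded_borelZ; exact: bounded_borel_shift.
move=> z /(NP m n M N z Nm Nn mM nN); apply: le_trans.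
rewrite le_eqVlt; apply/orP; left; apply/eqP; congr (`|_ - _|).
rewrite 2!mulr_suml; apply: eq_bigr => i _.
rewrite 2!mulr_suml; apply: eq_bigr => j _.
set u := (2 ^+ m.+1)^-1; set v := (2 ^+ n.+1)^-1; set w := f _.
by ring.
Qed.

(** * Large Lebesgue constants and sawtooth functions *)

(** The number whose binary digits 1 are at the first r even places. *)
Fixpoint bad_order (r : nat) : nat :=
  if r is r'.+1 then (4 * bad_order r').+1 else 0.

Lemma bad_order_lt (r : nat) : (bad_order r < 2 ^ r.*2)%N.
Proof.
elim: r => [|r IH] //=; rewrite doubleS !expnS.
by move: IH; clear; lia.
Qed.

Lemma walsh_kernel_block (R : realType) (k n : nat) (x s : R) :
  walsh_kernel (n * 2 ^ k) x s =
  walsh_kernel (2 ^ k) x s * walsh_kernel n (2 ^+ k * x) (2 ^+ k * s).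
Proof.
elim: n => [|n IH]; first by rewrite /walsh_kernel !big_ord0 mulr0.
have S u v : walsh_kernel n.+1 u v = walsh_kernel n u v + walsh n u * walsh n v
    :> R by rewrite /walsh_kernel big_ord_recr.
by rewrite mulSn addnC walsh_kernelD// IH S !walsh_scale; ring.
Qed.

(** On a quarter of the interval the kernel of order 4n+1 is 4 times a
    rescaled kernel of order n, up to 1; elsewhere it is 1 in absolute value.
    Its L1 norm thus exceeds the one of order n by at
    least 1/2. *)
Lemma bad_order_norm (R : realType) (r : nat) :
  r%:R / 2 * 2 ^+ r.*2 <=
  \sum_(i < 2 ^ r.*2) `|walsh_kernel (bad_order r) (0 : R) (i%:R / 2 ^+ r.*2)|.
Proof.
elim: r => [|r IH]; first by rewrite mul0r mul0r; apply: sumr_ge0.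
set p := r.*2 in IH *; set n := bad_order r in IH *.
have p0 : 2 ^+ p != 0 :> R by rewrite expf_neq0.
have cut : (2 ^ r.+1.*2 = 2 ^ p + 3 * 2 ^ p)%N.
  by rewrite doubleS -/p !expnS; clear; lia.
have DE (s : R) : walsh_kernel (bad_order r.+1) 0 s =
    walsh_kernel (2 ^ 2) 0 s * walsh_kernel n 0 (2 ^+ 2 * s) + walsh (n * 2 ^ 2) s.
  rewrite /= -/n -addn1 [(4 * n)%N]mulnC -[4%N]/(2 ^ 2)%N walsh_kernelD//.
  rewrite walsh_kernel_block mulr0; congr (_ + _).
  by rewrite /walsh_kernel big_ord1 walsh_at0 /walsh !big_ord0 mul1r !mulr1.
have c0 : in_cell 2 0 (0 : R) by rewrite /in_cell mulr0 lexx ltr01.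
have icell i : in_cell (2 + p) i (i%:R / 2 ^+ r.+1.*2 : R).
  by rewrite doubleS -/p; exact: in_cell_left.
have PE : 2 ^+ r.+1.*2 = 2 ^+ 2 * 2 ^+ p :> R by rewrite -exprD doubleS.
rewrite cut big_split_ord/=.
have low : \sum_(i < 2 ^ p) (4 * `|walsh_kernel n (0 : R) (i%:R / 2 ^+ p)| - 1) <=
    \sum_(i < 2 ^ p) `|walsh_kernel (bad_order r.+1) (0 : R) (i%:R / 2 ^+ r.+1.*2)|.
  apply: ler_sum => i _; rewrite DE.
  have si : in_cell 2 0 (i%:R / 2 ^+ r.+1.*2 : R).
    by have := in_cell_coarse (icell i); rewrite divn_small.
  rewrite (walsh_kernel_same c0 si).
  have -> : 2 ^+ 2 * (i%:R / 2 ^+ r.+1.*2) = i%:R / 2 ^+ p :> R.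
    by rewrite PE; field.
  have := ler_normB (2 ^+ 2 * walsh_kernel n 0 (i%:R / 2 ^+ p) +
    walsh (n * 2 ^ 2) (i%:R / 2 ^+ r.+1.*2)) (walsh (n * 2 ^ 2) (i%:R / 2 ^+ r.+1.*2) : R).
  rewrite addrK normr_walsh normrM (ger0_norm (_ : 0 <= 2 ^+ 2)) ?exprn_ge0//.
  by rewrite -natrX => h; lra.
have high : \sum_(i < 3 * 2 ^ p) (1 : R) <= \sum_(i < 3 * 2 ^ p)
    `|walsh_kernel (bad_order r.+1) (0 : R) ((2 ^ p + i)%:R / 2 ^+ r.+1.*2)|.
  apply: ler_sum => i _; rewrite DE.
  have ci : in_cell 2 ((2 ^ p + i) %/ 2 ^ p)%N ((2 ^ p + i)%:R / 2 ^+ r.+1.*2 : R).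
    exact: in_cell_coarse.
  have ilt : ((2 ^ p + i) %/ 2 ^ p < 2 ^ 2)%N.
    rewrite ltn_divLR ?expn_gt0//; have := ltn_ord i.
    by rewrite -[(2 ^ 2)%N]/4%N; clear; lia.
  have ne : 0%N <> ((2 ^ p + i) %/ 2 ^ p)%N.
    by rewrite divnDl ?dvdnn// divnn expn_gt0.
  rewrite (walsh_kernel_diff _ ilt c0 ci ne)//.
  by rewrite mul0r add0r normr_walsh.
apply: le_trans (lerD low high).
rewrite sumrB -mulr_sumr !sumr_const !card_ord -[X in _ - X]mulr_natr -[X in _ + X]mulr_natr.
rewrite natrM natrX doubleS -/p !exprS -natr1; move: IH.
set S := \sum_(_ < _) _; set Q := 2 ^+ p => IH.
by lra.
Qed.

Definition tri {R : realType} (t : R) : R := Num.min t (1 - t).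

(** A sawtooth with Q teeth on the unit interval, the tooth on the cell of
    index i having the sign sigma i. *)
Definition saw {R : realType} (Q : R) (sigma : int -> R) (s : R) : R :=
  sigma (Num.floor (Q * s)) * tri (Q * s - (Num.floor (Q * s))%:~R).

Lemma tri_frac (R : realType) (t : R) :
  0 <= tri (t - (Num.floor t)%:~R) <= 2^-1.
Proof.
have /andP[h1 h2] := floor_itv t; rewrite intrD in h2.
by rewrite /tri le_min ge_min; apply/andP; split; [apply/andP; split; lra|];
  have [h|h] := lerP (t - (Num.floor t)%:~R) 2^-1; apply/orP; [left|right]; lra.
Qed.

Lemma saw_bound (R : realType) (Q : R) (sigma : int -> R) (s : R) :
  (forall i, `|sigma i| <= 1) -> `|saw Q sigma s| <= 2^-1.
Proof.
move=> s1; have /andP[h1 h2] := tri_frac (Q * s).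
rewrite /saw normrM (ger0_norm h1); apply: le_trans h2.
by rewrite ler_piMl.
Qed.

Lemma saw_lipschitz (R : realType) (Q : R) (sigma : int -> R) (s t : R) :
  0 <= Q -> (forall i, `|sigma i| <= 1) ->
  `|saw Q sigma s - saw Q sigma t| <= Q * `|s - t|.
Proof.
move=> Q0 s1; wlog st : s t / s <= t => [hw|].
  have [|/ltW] := leP s t; first exact: hw.
  by rewrite distrC [`|s - t|]distrC; exact: hw.
rewrite [`|s - t|]distrC (ger0_norm (_ : 0 <= t - s)) ?subr_ge0// mulrBr.
have QQ : Q * s <= Q * t by rewrite ler_wpM2l.
rewrite /saw; set u := Q * s in QQ *; set v := Q * t in QQ *.
have /andP[u1 u2] := floor_itv u; have /andP[v1 v2] := floor_itv v.
have trile (x : R) : tri x <= x /\ tri x <= 1 - x by rewrite /tri !ge_min !lexx orbT.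
have [uv|] := eqVneq (Num.floor u) (Num.floor v).
  rewrite -uv; rewrite -uv in v1 v2; set k : R := _%:~R in u1 v1 *.
  rewrite -mulrBr normrM; apply: (@le_trans _ _ (1 * (v - u))); last by rewrite mul1r.
  rewrite ler_pM// /tri.
  have [|] := leP (u - k) (1 - (u - k)); have [|] := leP (v - k) (1 - (v - k));
    move=> h1 h2; rewrite ler_norml; apply/andP; split; lra.
rewrite neq_lt => /orP[|vu]; last first.
  by have := le_floor QQ; rewrite leNgt vu.
rewrite -lezD1 -(ler_int R) intrD => fuv.
apply: le_trans (ler_normB _ _) _; rewrite !normrM.
have [a1 a2] := trile (u - (Num.floor u)%:~R).
have [b1 b2] := trile (v - (Num.floor v)%:~R).
have /andP[a0 _] := tri_frac u; have /andP[b0 _] := tri_frac v.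
rewrite (ger0_norm a0) (ger0_norm b0).
have h1 := ler_wpM2r a0 (s1 (Num.floor u)).
have h2 := ler_wpM2r b0 (s1 (Num.floor v)).
by lra.
Qed.

(** * Variation of Lipschitz functions *)

Lemma ln_succ_ge (R : realType) (n : nat) : n%:R / n.+1%:R <= ln n.+1%:R :> R.
Proof.
have n0 : 0 < n.+1%:R :> R by rewrite ltr0n.
have : ln (1 + (n.+1%:R^-1 - 1)) <= n.+1%:R^-1 - 1 :> R.
  by apply: le_ln1Dx; rewrite ltrBrDr addNr invr_gt0.
rewrite addrC subrK lnV ?posrE// => h.
have -> : n%:R / n.+1%:R = 1 - n.+1%:R^-1 :> R.
  by rewrite -natr1; field; rewrite natr1 gt_eqF.
by set p := n.+1%:R^-1 in h *; lra.
Qed.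

Lemma logw_decr (R : realType) (n : nat) : (0 < n)%N ->
  logw n.+1 <= logw n :> R.
Proof.
move=> n0; have nr : 0 < n%:R :> R by rewrite ltr0n.
have n1 : 0 < n.+1%:R :> R by rewrite ltr0n.
have n2 : 0 < n.+2%:R :> R by rewrite ltr0n.
rewrite /logw ler_pdivrMr// mulrAC ler_pdivlMr//.
have h1 := ln_succ_ge R n.
have h2 : ln n.+2%:R <= ln n.+1%:R + n.+1%:R^-1 :> R.
  rewrite -lerBlDl -ln_div ?posrE//.
  have -> : n.+2%:R / n.+1%:R = 1 + n.+1%:R^-1 :> R.
    by rewrite -[n.+2%:R]natr1 mulrDl divff ?gt_eqF// mul1r.
  by apply: le_ln1Dx; apply: lt_trans (_ : 0 < _); rewrite ?ltrN10 ?invr_gt0.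
have h3 := ler_wpM2r (ltW nr) h2.
apply: (le_trans h3); rewrite mulrDl [_^-1 * _]mulrC.
set L := ln n.+1%:R in h1 *; rewrite -[n.+1%:R in leRHS]natr1.
by rewrite mulrDr mulr1 lerD2l.
Qed.

Lemma packing_length_itv (R : realType) (n : nat) (s : seq (atom R)) (u v : R) :
  (size s <= n)%N -> u <= v -> packing s ->
  all (fun t => (u <= t.1.1) && (t.1.2 <= v)) s ->
  \sum_(t <- s) (t.1.2 - t.1.1) <= v - u.
Proof.
elim: n s u v => [|n IH] [|t s] u v //=; rewrite ?big_nil ?subr_ge0//.
rewrite ltnS => sn uv /andP[/= /andP[it is_] /andP[ts ps]] /andP[/andP[ut tv] suv].
have /and4P[_ tt _ _] := it.
pose P (x : atom R) := x.1.2 <= t.1.1.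
have sub (Q : pred (atom R)) : packing (seq.filter Q s) /\ (size (seq.filter Q s) <= n)%N.
  split; last by rewrite (leq_trans _ sn)// size_filter count_size.
  apply/andP; split; last exact: pairwise_filter.
  apply/allP => x.
  by rewrite mem_filter => /andP[_ /(allP is_)].
rewrite big_cons.
have -> : \sum_(x <- s) (x.1.2 - x.1.1) =
    \sum_(x <- seq.filter P s) (x.1.2 - x.1.1) +
    \sum_(x <- seq.filter (predC P) s) (x.1.2 - x.1.1).
  by rewrite (bigID P)/= !big_filter.
have h1 : \sum_(x <- seq.filter P s) (x.1.2 - x.1.1) <= t.1.1 - u.
  apply: IH; [exact: (sub P).2 | by [] | exact: (sub P).1 |].
  apply/allP => x; rewrite mem_filter => /andP[Px /(allP suv)/andP[-> _]].
  exact: Px.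
have h2 : \sum_(x <- seq.filter (predC P) s) (x.1.2 - x.1.1) <= v - t.1.2.
  apply: IH; [exact: (sub _).2 | by [] | exact: (sub _).1 |].
  apply/allP => x; rewrite mem_filter => /andP[/= Px xs].
  have /andP[_ ->] := allP suv _ xs; rewrite andbT.
  by have := allP ts _ xs; rewrite /apart => /orP[//|]; rewrite -/(P x) (negbTE Px).
by move: h1 h2; set A := \sum_(_ <- _) _;
  set B := \sum_(_ <- _) _ => h1 h2; lra.
Qed.

Lemma packing_length (R : realType) (s : seq (atom R)) :
  packing s -> \sum_(t <- s) (t.1.2 - t.1.1) <= 1.
Proof.
move=> ps; rewrite -[leRHS]subr0; apply: (packing_length_itv (leqnn _)) => //.
have /andP[is_ _] := ps; apply: sub_all is_ => t /and4P[-> _ t1 _].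
by rewrite ltW.
Qed.

(** At most Q jumps can be as large as c, since the total variation is at most
    c Q; for decreasing weights the worst case is to put them first. *)
Lemma lipschitz_wvar (R : realType) (w : nat -> R) (f : R * R -> R) (Q : nat)
    (c : R) (s : seq (atom R)) :
  (forall n, (0 < n)%N -> 0 <= w n) ->
  (forall m n, (0 < m <= n)%N -> w n <= w m) -> (0 < Q)%N -> 0 <= c ->
  (forall t, inside t -> jump f t <= c) ->
  (forall t, inside t -> jump f t <= c * Q%:R * (t.1.2 - t.1.1)) ->
  packing s -> wvar w f 0 s <= 2 * c * \sum_(l < Q) w l.+1.
Proof.
move=> w0 wd Q0 c0 fc fl ps; pose d : atom R := (0, 0, 0).
have /andP[/allP is_ _] := ps.
have term (l : 'I_(size s)) : w l.+1 * jump f (nth d s l) <=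
    (if (l < Q)%N then w l.+1 * c else 0) +
    w Q * (c * Q%:R * ((nth d s l).1.2 - (nth d s l).1.1)).
  have it : inside (nth d s l) by apply: is_; rewrite mem_nth.
  have h2 : 0 <= jump f (nth d s l) by exact: jump_ge0.
  have h3 := fl _ it; case: ltnP => lQ.
    rewrite -[leLHS]addr0 lerD//; first by rewrite ler_wpM2l ?w0// fc.
    by rewrite mulr_ge0 ?w0// (le_trans h2 h3).
  by rewrite add0r ler_pM ?w0// wd// Q0 leqW.
rewrite (wvarE _ _ _ _ d).
apply: le_trans (ler_sum _ (fun l _ => term l)) _.
rewrite big_split/= -mulr_sumr -mulr_sumr.
have len : \sum_(l < size s) ((nth d s l).1.2 - (nth d s l).1.1) <= 1.
  by rewrite -(big_mkord xpredT (fun l => (nth d s l).1.2 - (nth d s l).1.1))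
    -(big_nth d xpredT (fun t => t.1.2 - t.1.1)); exact: packing_length.
have W0 : 0 <= \sum_(l < Q) w l.+1 by apply: sumr_ge0 => l _; exact: w0.
have h1 : \sum_(l < size s) (if (l < Q)%N then w l.+1 * c else 0) <=
    c * \sum_(l < Q) w l.+1.
  rewrite -big_mkcond/= mulr_sumr.
  rewrite -(big_mkord (fun l => (l < Q)%N) (fun l => w l.+1 * c)).
  have [sQ|Qs] := leqP (size s) Q.
    rewrite -(big_mkord xpredT (fun l => c * w l.+1)).
    rewrite (big_cat_nat (n := size s) (p := Q))//= -[leLHS]addr0 lerD//.
      rewrite [leLHS]big_mkcond; apply: ler_sum => l _.
      by rewrite mulrC; case: ifP => // _; rewrite mulr_ge0// w0.
    by apply: sumr_ge0 => l _; rewrite mulr_ge0// w0.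
  rewrite -(big_nat_widen 0 Q (size s) xpredT (fun l => w l.+1 * c))//; last exact: ltnW.
  by rewrite big_mkord; apply: ler_sum => l _; rewrite mulrC.
have h2 : w Q * Q%:R <= \sum_(l < Q) w l.+1.
  rewrite mulr_natr -[X in _ *+ X](card_ord Q) -sumr_const.
  by apply: ler_sum => l _; rewrite wd//= ltn_ord.
have h3 := ler_wpM2l (mulr_ge0 (w0 _ Q0) (mulr_ge0 c0 (ler0n R Q))) len.
have h4 := ler_wpM2l c0 h2.
by move: h1 h3 h4; set A := \sum_(_ < _) _; set B := \sum_(_ < _) _;
  set D := \sum_(_ < _) _ => h1 h3 h4; lra.
Qed.

(** The infimum of alpha over all later indices. *)
Lemma monotone_minorant (R : realType) (alpha : nat -> R) :
  (forall n, (0 < n)%N -> 0 < alpha n) -> alpha n @[n --> \oo] --> +oo ->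
  exists beta : nat -> R,
    [/\ forall n, (0 < n)%N -> 0 < beta n <= alpha n,
        forall m n, (0 < m <= n)%N -> beta m <= beta n &
        forall C, exists n, forall k, (n < k)%N -> C <= beta k].
Proof.
move=> a0 aoo; pose E n : set R :=
  [set alpha k | k in [set k | (0 < k)%N /\ (n <= k)%N]].
have large C : exists n, forall k, (n < k)%N -> C <= alpha k.
  move/cvgryPge : aoo => /(_ C)[n _ nP]; exists n => k /ltnW; exact: nP.
have fin n : exists2 e, 0 < e & forall k, (0 < k <= n)%N -> e <= alpha k.
  elim: n => [|n [e e0 eP]].
    by exists 1 => // k /andP[k0]; rewrite leqn0 => /eqP k0'; rewrite k0' in k0.
  exists (Num.min e (alpha n.+1)); first by rewrite lt_min e0 a0.
  move=> k /andP[k0]; rewrite leq_eqVlt => /predU1P[->|kn].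
    by rewrite ge_min lexx orbT.
  by rewrite ge_min eP// k0.
have low : exists2 e, 0 < e & forall k, (0 < k)%N -> e <= alpha k.
  have [n nP] := large 1; have [e e0 eP] := fin n.
  exists (Num.min e 1); first by rewrite lt_min e0 ltr01.
  move=> k k0; rewrite ge_min; case: (leqP k n) => kn; last by rewrite nP ?orbT.
  by rewrite eP// k0.
have [e e0 eP] := low.
have lb n : has_lbound (E n).
  by exists e => _ [k [k0 _] <-]; exact: eP.
have ne n : E n !=set0 by exists (alpha n.+1), n.+1.
exists (fun n => inf (E n)); split.
- move=> n n0; apply/andP; split.
    apply: lt_le_trans e0 _; apply: lb_le_inf; first exact: ne.
    by move=> _ [k [k0 _] <-]; exact: eP.
  by apply: ge_inf; [exact: lb | exists n].
- move=> m n /andP[m0 mn]; apply: lb_le_inf; first exact: ne.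
  move=> _ [k [k0 nk] <-]; apply: ge_inf; first exact: lb.
  by exists k => //; split => //; exact: leq_trans nk.
- move=> C; have [n nP] := large C; exists n => k nk.
  apply: lb_le_inf; first exact: ne.
  by move=> _ [j [j0 kj] <-]; apply: nP; exact: leq_trans kj.
Qed.

(** * Functions with one large Walsh sum *)

Section Peak.
Context {R : realType}.
Implicit Types (beta : nat -> R) (r : nat).

Definition peak_sign r (i : int) : R :=
  Num.sg (walsh_kernel (bad_order r) 0 (i%:~R / 2 ^+ r.*2)).

Definition bad_saw r : R -> R := saw (2 ^+ r.*2) (peak_sign r).

Definition peak_weight beta r : R := \sum_(l < 2 ^ r.*2) logw l.+1 / beta l.+1.

(** Divided by the sum of the largest weights, which bounds the variation of
    the numerator. *)
Definition peak beta r (z : R * R) : R :=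
  bad_saw r z.1 * bad_saw r z.2 / peak_weight beta r.

Lemma peak_sign_le r i : `|peak_sign r i| <= 1.
Proof. by rewrite /peak_sign normr_sg; case: (_ == 0). Qed.

Lemma bad_saw_le r s : `|bad_saw r s| <= 2^-1.
Proof. by apply: saw_bound; exact: peak_sign_le. Qed.

Lemma bad_saw_lipschitz r s t :
  `|bad_saw r s - bad_saw r t| <= 2 ^+ r.*2 * `|s - t|.
Proof. by apply: saw_lipschitz; [exact: exprn_ge0 | exact: peak_sign_le]. Qed.

Lemma bad_saw0 r : bad_saw r 0 = 0.
Proof.
rewrite /bad_saw /saw mulr0 floor0 subrr /tri subr0.
by rewrite (min_idPl _) ?ler01// mulr0.
Qed.

Lemma bad_saw_value r i (b : bool) (z : R) : in_cell r.*2.+1 0 z ->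
  bad_saw r (z + (i.*2 + b)%:R / 2 ^+ r.*2.+1) = peak_sign r i%:Z *
    (if b then 2^-1 - 2 ^+ r.*2 * z else 2 ^+ r.*2 * z).
Proof.
set p := r.*2; rewrite /in_cell exprS -mulrA => /andP[z0 z1].
have p0 : 2 ^+ p != 0 :> R by rewrite expf_neq0.
set t := 2 ^+ p * z in z0 z1 *.
have E : 2 ^+ p * (z + (i.*2 + b)%:R / (2 * 2 ^+ p)) = i%:R + t + b%:R / 2.
  by rewrite -muln2 natrD natrM /t; field.
rewrite /bad_saw /saw -/p E.
have -> : Num.floor (i%:R + t + b%:R / 2) = i%:Z.
  apply: floor_def; rewrite intrD -!pmulrn.
  by case: b {E} => /=; apply/andP; split; lra.
congr (_ * _); rewrite -pmulrn /tri.
have -> : i%:R + t + b%:R / 2 - i%:R = t + b%:R / 2 by ring.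
case: b {E} => /=.
  by rewrite (min_idPr _); lra.
by rewrite (min_idPl _); lra.
Qed.

(** The two halves of a tooth add up to a constant, whatever the shift. *)
Lemma bad_saw_kernel_sum r (z : R) : in_cell r.*2.+1 0 z ->
  \sum_(a < 2 ^ r.*2.+1) walsh_kernel (bad_order r) 0 (a%:R / 2 ^+ r.*2.+1) *
    bad_saw r (z + a%:R / 2 ^+ r.*2.+1) =
  2^-1 * \sum_(i < 2 ^ r.*2) `|walsh_kernel (bad_order r) (0 : R) (i%:R / 2 ^+ r.*2)|.
Proof.
move=> zc; rewrite mulr_sumr expnS mul2n.
rewrite (big_double _ (fun a =>
  walsh_kernel (bad_order r) 0 (a%:R / 2 ^+ r.*2.+1) *
  bad_saw r (z + a%:R / 2 ^+ r.*2.+1))).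
apply: eq_bigr => i _.
have D (b : bool) : walsh_kernel (bad_order r) 0 ((i.*2 + b)%:R / 2 ^+ r.*2.+1) =
    walsh_kernel (bad_order r) (0 : R) (i%:R / 2 ^+ r.*2).
  apply: eq_bigr => k _; congr (_ * _).
  apply: walsh_cell_left; first by rewrite (ltn_trans (ltn_ord k)) ?bad_order_lt.
  apply: (@in_cell_double _ _ _ b); first by case: b.
  exact: in_cell_left.
have := D false; have := D true; have := bad_saw_value i false zc.
have := bad_saw_value i true zc; rewrite addn0 addn1 => -> -> -> ->.
set d := walsh_kernel _ _ _.
have <- : d * peak_sign r i%:Z = `|d|.
  by rewrite /peak_sign -pmulrn mulrC -normrEsg.
by ring.
Qed.

Definition positive_minorant beta := forall n, (0 < n)%N -> 0 < beta n.

Lemma peak_weight_ge beta r : positive_minorant beta ->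
  logw 1 / beta 1%N <= peak_weight beta r.
Proof.
move=> b0; have : (0 < 2 ^ r.*2)%N by rewrite expn_gt0.
rewrite /peak_weight; case: (2 ^ r.*2)%N => // q _.
rewrite big_ord_recl lerDl sumr_ge0// => i _.
by rewrite divr_ge0 ?logw_ge0// ltW// b0.
Qed.

Lemma peak_weight_gt0 beta r : positive_minorant beta -> 0 < peak_weight beta r.
Proof.
move=> b0; apply: lt_le_trans (peak_weight_ge r b0).
by rewrite divr_gt0 ?b0// /logw divr1 ln2_gt0.
Qed.

Lemma peak_le beta r z : positive_minorant beta ->
  `|peak beta r z| <= (logw 1 / beta 1%N)^-1.
Proof.
move=> b0; have W0 := peak_weight_gt0 r b0.
rewrite /peak normrM (ger0_norm (_ : 0 <= _^-1)) ?invr_ge0 ?(ltW W0)//.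
rewrite -[leRHS]mul1r ler_pM ?invr_ge0 ?(ltW W0)//.
  rewrite normrM (le_trans (ler_pM _ _ (bad_saw_le r z.1) (bad_saw_le r z.2)))//.
  by lra.
rewrite lef_pV2 ?posrE ?peak_weight_ge//.
by rewrite divr_gt0 ?b0// /logw divr1 ln2_gt0.
Qed.

Lemma peak_jump beta r t : positive_minorant beta ->
  jump (peak beta r) t <=
  (peak_weight beta r)^-1 * `|bad_saw r t.1.2 - bad_saw r t.1.1|.
Proof.
move=> b0; have W0 := peak_weight_gt0 r b0.
rewrite /jump /peak/= -mulrBl -mulrBl normrM.
rewrite (ger0_norm (_ : 0 <= _^-1)) ?invr_ge0 ?(ltW W0)// mulrC.
rewrite ler_wpM2l ?invr_ge0 ?(ltW W0)// normrM ler_piMr//.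
by apply: le_trans (bad_saw_le _ _) _; lra.
Qed.

Lemma peak_swap beta r : swap (peak beta r) = peak beta r.
Proof.
by apply/funext => z; rewrite /swap /peak/= [bad_saw r z.2 * _]mulrC.
Qed.

Lemma peak_wvar beta r (w : nat -> R) s : positive_minorant beta ->
  (forall n, (0 < n)%N -> 0 <= w n) ->
  (forall m n, (0 < m <= n)%N -> w n <= w m) -> packing s ->
  wvar w (peak beta r) 0 s <=
    2 * (peak_weight beta r)^-1 * \sum_(l < 2 ^ r.*2) w l.+1.
Proof.
move=> b0 w0 wd ps; have W0 := peak_weight_gt0 r b0.
have V0 : 0 <= (peak_weight beta r)^-1 by rewrite invr_ge0 ltW.
apply: lipschitz_wvar => //; first by rewrite expn_gt0.
- move=> t _; apply: le_trans (peak_jump r t b0) _; rewrite ler_piMr//.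
  apply: le_trans (ler_normB _ _) _.
  by have := bad_saw_le r t.1.2; have := bad_saw_le r t.1.1; lra.
- move=> t /and4P[_ tt _ _]; apply: le_trans (peak_jump r t b0) _.
  rewrite -mulrA ler_wpM2l//; apply: le_trans (bad_saw_lipschitz _ _ _) _.
  by rewrite natrX ger0_norm// subr_ge0 ltW.
Qed.

Lemma logw_noninc (m n : nat) : (0 < m <= n)%N -> logw n <= logw m :> R.
Proof.
move=> /andP[m0]; elim: n => [|n IH]; first by rewrite leqn0 => /eqP ->.
rewrite leq_eqVlt => /predU1P[->//|]; rewrite ltnS => mn.
apply: le_trans (IH mn); apply: logw_decr; exact: leq_trans mn.
Qed.

Lemma peak_log_var beta r : positive_minorant beta ->
  exists V, log_var_le (peak beta r) V.
Proof.
move=> b0; eexists => s ps; apply: peak_wvar => // [n _|]; first exact: logw_ge0.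
exact: logw_noninc.
Qed.

Lemma peak_borel beta r : positive_minorant beta ->
  bounded_borel unitI2 (peak beta r).
Proof.
move=> b0; have [V fV] := peak_log_var r b0.
by apply: (log_var_borel fV (V' := V)); rewrite peak_swap.
Qed.

Lemma peak_walsh_sum beta r : positive_minorant beta ->
  r%:R ^+ 2 / 64 / peak_weight beta r <=
  `|walsh_sum (peak beta r) (bad_order r) (bad_order r) 0 0|.
Proof.
move=> b0; have W0 := peak_weight_gt0 r b0.
set p := r.*2; have p0 : 0 < 2 ^+ p :> R by rewrite exprn_gt0.
have Mp : (bad_order r <= 2 ^ p.+1)%N.
  by rewrite (leq_trans (ltnW (bad_order_lt r)))// leq_exp2l.
(* On half teeth the integrand of the averaging formula is constant. *)
rewrite (@walsh_sum_average _ _ p.+1 p.+1)//; last exact: peak_borel.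
have SE := bad_order_norm R r.
set S := \sum_(_ < _) _ in SE.
pose L := (2^-1 * S) ^+ 2 / peak_weight beta r / 2 ^+ p.+1 / 2 ^+ p.+1.
set I := Rintegral _ _ _.
have : `|I - L| <= 0.
  apply: average_near.
    apply: bounded_borel_sum => i; apply: bounded_borel_sum => j.
    by apply: bounded_borelZ; apply: bounded_borel_shift => //; exact: peak_borel.
  move=> [z w] [/= zc wc].
  rewrite (_ : \sum_(_ < _) _ = (2^-1 * S) ^+ 2 / peak_weight beta r).
    by rewrite subrr normr0.
  rewrite expr2 -{1}(bad_saw_kernel_sum zc) -(bad_saw_kernel_sum wc).
  rewrite big_distrlr/= mulr_suml; apply: eq_bigr => i _.
  rewrite mulr_suml; apply: eq_bigr => j _.
  by rewrite /peak/=; ring.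
rewrite normr_le0 subr_eq0 => /eqP ->.
apply: le_trans (ler_norm _); rewrite /L [2 ^+ p.+1]exprS.
have -> : (2^-1 * S) ^+ 2 / peak_weight beta r / (2 * 2 ^+ p) / (2 * 2 ^+ p) =
    (S / 2 ^+ p) ^+ 2 / 16 / peak_weight beta r.
  by field; rewrite !gt_eqF.
rewrite ler_pM2r ?invr_gt0//.
have h : r%:R / 2 <= S / 2 ^+ p by rewrite ler_pdivlMr.
have r0 : 0 <= r%:R / 2 :> R by rewrite divr_ge0.
have := ler_pM r0 r0 h h; rewrite -!expr2 => h2.
by rewrite ler_pdivlMr//; lra.
Qed.

Lemma diagonal_bounded (f : R * R -> R) (l x y : R) :
  walsh_sum f MN.1 MN.2 x y @[MN --> filter_prod \oo \oo] --> l ->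
  exists B, forall N, `|walsh_sum f N N x y| <= B.
Proof.
move=> /cvgrPdist_le/(_ 1 ltr01)[[P Q]/= [[a _ aP] [b _ bQ]] PQ].
pose N0 := maxn a b.
exists (`|l| + 1 + \sum_(n < N0) `|walsh_sum f n n x y|) => N.
have [NN|NN] := leqP N0 N.
  have : `|l - walsh_sum f N N x y| <= 1.
    apply: (PQ (N, N)); split => /=.
      by apply: aP; rewrite /= (leq_trans _ NN)// leq_maxl.
    by apply: bQ; rewrite /= (leq_trans _ NN)// leq_maxr.
  have : 0 <= \sum_(n < N0) `|walsh_sum f n n x y| by apply: sumr_ge0.
  have := ler_normB l (l - walsh_sum f N N x y).
  by rewrite opprB addrC subrK; lra.
rewrite (bigD1 (Ordinal NN))//= addrCA lerDl !addr_ge0//.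
by apply: sumr_ge0.
Qed.

Lemma peak_bounded beta r : positive_minorant beta ->
  exists B, forall N, `|walsh_sum (peak beta r) N N 0 0| <= B.
Proof.
move=> b0; have [V fV] := peak_log_var r b0.
have W0 := peak_weight_gt0 r b0.
have I0 := unitI0 R.
apply: (@diagonal_bounded _ (peak beta r (0, 0))).
apply: (walsh_sum_cvg fV (V' := V)) => //; first by rewrite peak_swap.
move=> e e0.
have [k ke] : exists k, 2 ^- k < e * peak_weight beta r / 2 ^+ r.*2.
  by apply: exp2_small; rewrite divr_gt0 ?exprn_gt0// mulr_gt0.
exists k => m n i j s t km _ zi si _ _.
have i0 : i = 0%N.
  by apply: in_cell_inj zi _; rewrite /in_cell mulr0 lexx ltr01.
rewrite i0 in si; have /in_cellE/andP[s0 s1] := si.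
rewrite mul0r in s0; rewrite mul1r in s1.
rewrite {2}/peak/= bad_saw0 mul0r mul0r subr0 /peak/= normrM normrM.
rewrite [`|_^-1|]ger0_norm ?invr_ge0 ?(ltW W0)// ler_pdivrMr//.
have h1 : `|bad_saw r s| <= 2 ^+ r.*2 * s.
  have := bad_saw_lipschitz r s 0; rewrite bad_saw0 !subr0.
  by rewrite [`|s|]ger0_norm.
apply: (@le_trans _ _ (2 ^+ r.*2 * s * 1)).
  apply: ler_pM => //; apply: (le_trans (bad_saw_le r t)); lra.
rewrite mulr1 mulrC -ler_pdivlMr ?exprn_gt0//.
apply: le_trans (ltW s1) _; apply: le_trans (ltW ke).
exact: exp2V_le.
Qed.

Lemma bad_saw_continuous r : continuous (bad_saw r).
Proof.
move=> s; apply/cvgrPdist_le => e e0.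
have p0 : 0 < 2 ^+ r.*2 :> R by rewrite exprn_gt0.
apply/nbhs_ballP; exists (e / 2 ^+ r.*2) => /=; first by rewrite divr_gt0.
move=> t; rewrite /ball/= ltr_pdivlMr// => h.
by apply: le_trans (bad_saw_lipschitz r s t) _; rewrite mulrC ltW.
Qed.

Lemma peak_continuous beta r : continuous (peak beta r).
Proof.
move=> z; apply: cvgM; last exact: cvg_cst.
apply: cvgM.
  by apply: (@cvg_comp _ _ _ fst (bad_saw r) _ (nbhs z.1));
    [exact: cvg_fst | exact: bad_saw_continuous].
by apply: (@cvg_comp _ _ _ snd (bad_saw r) _ (nbhs z.2));
  [exact: cvg_snd | exact: bad_saw_continuous].
Qed.

(** The weights are o(log^2 4^r), while the Walsh sums grow like the square
    of the Lebesgue constants, that is log^2 4^r. *)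
Lemma peak_unbounded beta : positive_minorant beta ->
  (forall C, exists n, forall k, (n < k)%N -> C <= beta k) ->
  forall C, exists r, C <= r%:R ^+ 2 / 64 / peak_weight beta r.
Proof.
move=> b0 boo C0; pose C := `|C0| + 1.
have C1 : 0 < C by rewrite ltr_wpDl.
have [k kP] := boo (2 * 9 * 64 * C).
pose A := \sum_(l < k) logw l.+1 / beta l.+1.
have A0 : 0 <= A.
  by apply: sumr_ge0 => l _; rewrite divr_ge0 ?logw_ge0// ltW ?b0.
pose r := (Num.truncn (128 * C * A)).+1.
have rA : 128 * C * A <= r%:R by rewrite ltW// truncnS_gt.
have r1 : 1 <= r%:R :> R by rewrite ler1n.
exists r; have W0 := peak_weight_gt0 r b0.
rewrite ler_pdivlMr//; apply: (@le_trans _ _ (C * peak_weight beta r)).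
  by rewrite ler_wpM2r ?(ltW W0)// /C (le_trans (ler_norm _))// lerDl.
have WA : peak_weight beta r <= A + logW (2 ^ r.*2) / (2 * 9 * 64 * C).
  have D0 : 0 < 2 * 9 * 64 * C by rewrite !mulr_gt0.
  rewrite /peak_weight /logW mulr_suml /A.
  have mono (l : nat) : 0 <= logw l.+1 / beta l.+1.
    by rewrite divr_ge0 ?logw_ge0// ltW ?b0.
  have bnd (l : nat) : (k <= l)%N ->
      logw l.+1 / beta l.+1 <= logw l.+1 / (2 * 9 * 64 * C).
    move=> kl; rewrite ler_wpM2l ?logw_ge0// lef_pV2 ?posrE ?b0//.
    exact: kP.
  have pos (l : nat) : 0 <= logw l.+1 / (2 * 9 * 64 * C).
    by rewrite divr_ge0 ?logw_ge0 ?(ltW D0).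
  rewrite -!(big_mkord xpredT (fun l => logw l.+1 / beta l.+1)).
  rewrite -(big_mkord xpredT (fun l => logw l.+1 / (2 * 9 * 64 * C))).
  have [qk|kq] := leqP (2 ^ r.*2)%N k.
    rewrite [X in _ <= X + _](big_cat_nat (n := (2 ^ r.*2)%N))//= -addrA lerDl.
    by rewrite addr_ge0// sumr_ge0.
  rewrite (big_cat_nat (n := k))//=; last exact: ltnW.
  rewrite lerD2l [leRHS](big_cat_nat (n := k))//=; last exact: ltnW.
  rewrite -[leLHS]add0r lerD//; first exact: sumr_ge0.
  rewrite !big_nat; apply: ler_sum => l /andP[kl _]; exact: bnd.
have := logW_exp2_le R r.*2; set T := logW _ in WA * => h.
have h2 : (r.*2%:R + 1) ^+ 2 <= 9 * r%:R ^+ 2 :> R.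
  by rewrite -mul2n natrM; nra.
have h3 : T / (2 * 9 * 64 * C) * C = T / (2 * 9 * 64).
  by field; rewrite gt_eqF.
have h4 := ler_wpM2l (ltW C1) WA; rewrite mulrDr [C * (T / _)]mulrC h3 in h4.
apply: le_trans h4 _.
have h5 : r%:R <= r%:R ^+ 2 :> R by rewrite expr2 ler_peMr// (le_trans ler01).
by lra.
Qed.

End Peak.

(** * Condensation of singularities *)

Lemma walsh_sumD (R : realType) (f g : R * R -> R) (M N : nat) (x y : R) :
  bounded_borel unitI2 f -> bounded_borel unitI2 g ->
  walsh_sum (fun z => f z + g z) M N x y =
  walsh_sum f M N x y + walsh_sum g M N x y.
Proof.
move=> bf bg; have bfg := bounded_borelD bf bg.
have Mp : (M <= 2 ^ M)%N by rewrite ltnW// ltn_expl.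
have Np : (N <= 2 ^ N)%N by rewrite ltnW// ltn_expl.
have mc := @measurable_cell2 R M N 0 0.
have coo : (leb2 (@cell2 R M N 0 0) < +oo)%E by rewrite leb2_cell2 ltry.
rewrite !(@walsh_sum_average _ _ M N)// -RintegralD//; last 2 first.
- apply: bounded_borel_integrable => //; apply: bounded_borel_sum => i.
  by apply: bounded_borel_sum => j; apply: bounded_borelZ; exact: bounded_borel_shift.
- apply: bounded_borel_integrable => //; apply: bounded_borel_sum => i.
  by apply: bounded_borel_sum => j; apply: bounded_borelZ; exact: bounded_borel_shift.
apply: eq_Rintegral => z _; rewrite -big_split; apply: eq_bigr => i _ /=.
by rewrite -big_split; apply: eq_bigr => j _ /=; rewrite mulrDr.
Qed.

Lemma walsh_sumZ (R : realType) (f : R * R -> R) (c : R) (M N : nat) (x y : R) :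
  bounded_borel unitI2 f ->
  walsh_sum (fun z => c * f z) M N x y = c * walsh_sum f M N x y.
Proof.
move=> bf; have bcf := bounded_borelZ c bf.
have Mp : (M <= 2 ^ M)%N by rewrite ltnW// ltn_expl.
have Np : (N <= 2 ^ N)%N by rewrite ltnW// ltn_expl.
have mc := @measurable_cell2 R M N 0 0.
have coo : (leb2 (@cell2 R M N 0 0) < +oo)%E by rewrite leb2_cell2 ltry.
rewrite !(@walsh_sum_average _ _ M N)// -RintegralZl//; last first.
  apply: bounded_borel_integrable => //; apply: bounded_borel_sum => i.
  by apply: bounded_borel_sum => j; apply: bounded_borelZ; exact: bounded_borel_shift.
apply: eq_Rintegral => z _; rewrite mulr_sumr; apply: eq_bigr => i _.
by rewrite mulr_sumr; apply: eq_bigr => j _; ring.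
Qed.

Lemma walsh_sum_le (R : realType) (f : R * R -> R) (C : R) (M N : nat) (x y : R) :
  bounded_borel unitI2 f -> (forall z, unitI2 z -> `|f z| <= C) ->
  `|walsh_sum f M N x y| <= M%:R * N%:R * C.
Proof.
move=> bf fC.
have Mp : (M <= 2 ^ M)%N by rewrite ltnW// ltn_expl.
have Np : (N <= 2 ^ N)%N by rewrite ltnW// ltn_expl.
rewrite (@walsh_sum_average _ _ M N)// -[X in `|X|]subr0.
apply: average_near.
  apply: bounded_borel_sum => i; apply: bounded_borel_sum => j.
  by apply: bounded_borelZ; exact: bounded_borel_shift.
move=> z zc; rewrite subr0 !normrM.
rewrite (ger0_norm (_ : 0 <= 2 ^- M)) ?invr_ge0 ?exprn_ge0//.
rewrite (ger0_norm (_ : 0 <= 2 ^- N)) ?invr_ge0 ?exprn_ge0//.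
rewrite !ler_pdivrMr ?exprn_gt0//.
apply: (@le_trans _ _ (\sum_(i < 2 ^ M) \sum_(j < 2 ^ N) M%:R * N%:R * C)).
  apply: le_trans (ler_norm_sum _ _ _) _; apply: ler_sum => i _.
  apply: le_trans (ler_norm_sum _ _ _) _; apply: ler_sum => j _.
  rewrite normrM normrM; apply: ler_pM => //.
    by apply: ler_pM => //; exact: walsh_kernel_le.
  apply: fC; apply: (cell2_unitI2 (ltn_ord i) (ltn_ord j)).
  case: z zc => [a b] [/= ac bc].
  by split; rewrite /shift2/=; exact: in_cell_shift.
rewrite (eq_bigr (fun=> M%:R * N%:R * C *+ 2 ^ N)) => [|i _]; last first.
  by rewrite sumr_const card_ord.
rewrite sumr_const card_ord -mulrnA -[leLHS]mulr_natr natrM !natrX.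
by rewrite le_eqVlt; apply/orP; left; apply/eqP; ring.
Qed.

Lemma geometric_tail (R : realType) (u : nat -> R) (q : R) (n m : nat) :
  (forall k, (n <= k)%N -> `|u k| <= q * 2 ^- k) -> (n <= m)%N ->
  `|\sum_(k < m) u k - \sum_(k < n) u k| <= 2 * q * (2 ^- n - 2 ^- m).
Proof.
move=> uq; elim: m => [|m IH].
  by rewrite leqn0 => /eqP ->; rewrite !subrr normr0 mulr0.
rewrite leq_eqVlt => /predU1P[->|]; first by rewrite !subrr normr0 mulr0.
rewrite ltnS => nm; rewrite big_ord_recr/= addrAC.
apply: le_trans (ler_normD _ _) _.
apply: le_trans (lerD (IH nm) (uq m nm)) _.
have m0 : 2 ^+ m != 0 :> R by rewrite expf_neq0.
rewrite le_eqVlt; apply/orP; left; apply/eqP; rewrite exprS invfM.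
by set a := (2 ^+ m)^-1; set b := (2 ^+ n)^-1; field.
Qed.

Lemma geometric_cvg (R : realType) (u : nat -> R) (q : R) :
  (forall k, `|u k| <= q * 2 ^- k) -> cvgn (series u).
Proof.
move=> uq; apply: normed_cvg.
have vE k : geometric q 2^-1 k = q * 2 ^- k by rewrite /geometric/= exprVn.
apply: (@series_le_cvg _ _ (geometric q 2^-1)) => [k|k|k|].
- exact: normr_ge0.
- by rewrite vE (le_trans _ (uq k)).
- by rewrite vE; exact: uq.
by apply: is_cvg_geometric_series; rewrite ger0_norm// invf_lt1// ltr1n.
Qed.

(** Partial sums differ from the n-th one by at most a geometric tail. *)
Lemma geometric_remainder (R : realType) (u : nat -> R) (q : R) (n : nat) :
  cvgn (series u) -> 0 <= q -> (forall k, (n <= k)%N -> `|u k| <= q * 2 ^- k) ->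
  `|limn (series u) - \sum_(k < n) u k| <= 2 * q * 2 ^- n.
Proof.
move=> cu q0 uq; apply/ler_addgt0Pr => e e0.
move/cvgrPdist_le : cu => /(_ e e0)[m0 _ hm].
have := hm (maxn m0 n) (leq_maxl _ _); rewrite /series/= big_mkord => h1.
have h2 := geometric_tail uq (leq_maxr m0 n).
have h3 : 0 <= 2 * q * 2 ^- maxn m0 n.
  by rewrite !mulr_ge0// invr_ge0 exprn_ge0.
set S := \sum_(_ < maxn m0 n) _ in h1 h2.
rewrite -(subrK S (limn _)) -addrA; apply: le_trans (ler_normD _ _) _.
by rewrite mulrBr in h2; lra.
Qed.

(** The k-th coefficient is chosen after the orders of the first k humps, so
    small that later humps do not matter at those orders; the k-th hump is
    chosen so high that it dominates the preceding ones at its own order. *)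
Lemma gliding_hump (R : realType) (F : nat -> R * R -> R) (C : R) :
  (forall r z, `|F r z| <= C) -> (forall r, bounded_borel unitI2 (F r)) ->
  (forall r, exists B, forall N, `|walsh_sum (F r) N N 0 0| <= B) ->
  (forall A, exists r N, A <= `|walsh_sum (F r) N N 0 0|) ->
  exists (eps : nat -> R) (rk : nat -> nat) (f : R * R -> R),
    [/\ forall k, 0 <= eps k <= 2 ^- k,
        forall n z, `|f z - \sum_(k < n) eps k * F (rk k) z| <= 2 * C * 2 ^- n,
        measurable_fun (unitI2 : set (measurableTypeR R * measurableTypeR R))
          (f : _ -> measurableTypeR R) &
        forall l : nat, exists N, l%:R <= `|walsh_sum f N N 0 0|].
Proof.
move=> FC Fb /choice[Bd BdP] Fu.
have C0 : 0 <= C by apply: le_trans (FC 0%N (0, 0)).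
have Bd0 r : 0 <= Bd r by apply: le_trans (BdP r 0%N).
have /choice[pick pickP] : forall A, exists rN : nat * nat,
    A <= `|walsh_sum (F rN.1) rN.2 rN.2 0 0|.
  by move=> A; have [r [N rN]] := Fu A; exists (r, N).
pose ep k (st : R * R) := 2 ^- k / st.1.
pose ch k (st : R * R) := pick ((k%:R + st.2 + C) / ep k st).
(* The state holds a bound for the squares of the orders chosen so far and a
   bound for the Walsh sums of the humps chosen so far. *)
pose step k (st : R * R) :=
  (st.1 + (ch k st).2%:R * (ch k st).2%:R, st.2 + ep k st * Bd (ch k st).1).
pose st := fix st k : R * R := if k is k'.+1 then step k' (st k') else (1, 0).
pose eps k := ep k (st k); pose rk k := (ch k (st k)).1.
pose Nk k := (ch k (st k)).2.
have st1 k : 1 <= (st k).1.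
  elim: k => //= k IH; apply: (le_trans IH).
  by rewrite lerDl mulr_ge0.
have st1mono m n : (m <= n)%N -> (st m).1 <= (st n).1.
  elim: n => [|n IH]; first by rewrite leqn0 => /eqP ->.
  rewrite leq_eqVlt => /predU1P[->//|]; rewrite ltnS => /IH h.
  by apply: le_trans h _; rewrite /= lerDl mulr_ge0.
have st1gt k : 0 < (st k).1 by exact: lt_le_trans ltr01 (st1 k).
have eps0 k : 0 < eps k by rewrite divr_gt0 ?invr_gt0 ?exprn_gt0.
have epsm m k : (m <= k)%N -> eps k <= (st m).1^-1 * 2 ^- k.
  move=> mk; rewrite mulrC ler_wpM2l ?invr_ge0 ?exprn_ge0//.
  by rewrite lef_pV2 ?posrE// st1mono.
have st2E k : (st k).2 = \sum_(j < k) eps j * Bd (rk j).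
  by elim: k => [|k IH]; rewrite ?big_ord0// big_ord_recr/= -IH.
pose u z k := eps k * F (rk k) z.
have ub m z k : (m <= k)%N -> `|u z k| <= C / (st m).1 * 2 ^- k.
  move=> mk; rewrite normrM (gtr0_norm (eps0 k)) mulrC -mulrA.
  by rewrite ler_pM ?(ltW (eps0 k))// epsm.
have ub0 z k : `|u z k| <= C * 2 ^- k.
  by have := ub 0%N z k (leq0n k); rewrite /= divr1.
have cu z : cvgn (series (u z)) by exact: geometric_cvg (ub0 z).
pose f z := limn (series (u z)).
have frem n z : `|f z - \sum_(k < n) u z k| <= 2 * C * 2 ^- n.
  by apply: geometric_remainder => // k _; exact: ub0.
have Sb n : bounded_borel unitI2 (fun z => \sum_(k < n) u z k).
  by apply: bounded_borel_sum => k; exact: bounded_borelZ.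
have mf : measurable_fun (unitI2 : set (measurableTypeR R * measurableTypeR R))
    (f : _ -> measurableTypeR R).
  apply: (@measurable_fun_cvg _ _ _ _ (fun n z => \sum_(k < n) u z k)).
    by move=> n; have [] := Sb n.
  move=> z _; have := cu z; rewrite /f /series/=.
  by under eq_fun do rewrite big_mkord.
have bf : bounded_borel unitI2 f.
  split => //; exists (2 * C) => z _.
  by have := frem 0%N z; rewrite big_ord0 subr0 expr0 invr1 mulr1.
exists eps, rk, f; split => //.
  move=> k; rewrite (ltW (eps0 k))/=; apply: le_trans (epsm 0%N k (leq0n k)) _.
  by rewrite invr1 mul1r.
move=> l; exists (Nk l); set N := Nk l.
pose T z := f z + (-1) * \sum_(k < l.+1) u z k.
have bT : bounded_borel unitI2 T.
  by apply: bounded_borelD => //; apply: bounded_borelZ; exact: Sb.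
have TC z : `|T z| <= C / (st l.+1).1.
  rewrite /T mulN1r; apply: le_trans (@geometric_remainder _ (u z)
    (C / (st l.+1).1) l.+1 (cu z) _ _) _.
  - by rewrite divr_ge0// ltW.
  - by move=> k; exact: ub.
  - have q0 : 0 <= C / (st l.+1).1 by rewrite divr_ge0// ltW.
    have l1 : 2 ^- l <= 1 :> R by rewrite invf_le1 ?exprn_gt0// exprn_ege1// ler1n.
    move: q0; set q := C / _ => q0; rewrite exprS invfM.
    by move: l1; set h := (2 ^+ l)^-1 => l1; have := ler_wpM2l q0 l1; lra.
have lin n : walsh_sum (fun z => \sum_(k < n) u z k) N N 0 0 =
    \sum_(k < n) eps k * walsh_sum (F (rk k)) N N 0 0.
  elim: n => [|n IH].
    rewrite big_ord0 (_ : (fun _ => _) = fun z => 0 * F 0%N z).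
      by rewrite walsh_sumZ// mul0r.
    by apply/funext => z; rewrite big_ord0 mul0r.
  rewrite big_ord_recr/= -IH -walsh_sumZ// -walsh_sumD//.
    by congr walsh_sum; apply/funext => z; rewrite big_ord_recr.
  exact: bounded_borelZ.
have fE : walsh_sum f N N 0 0 = walsh_sum T N N 0 0 +
    (\sum_(k < l) eps k * walsh_sum (F (rk k)) N N 0 0 +
     eps l * walsh_sum (F (rk l)) N N 0 0).
  have <- : \sum_(k < l.+1) eps k * walsh_sum (F (rk k)) N N 0 0 =
      \sum_(k < l) eps k * walsh_sum (F (rk k)) N N 0 0 +
      eps l * walsh_sum (F (rk l)) N N 0 0 by rewrite big_ord_recr.
  rewrite -lin -walsh_sumD//; congr walsh_sum; apply/funext => z.
  by rewrite /T mulN1r subrK.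
have T1 : `|walsh_sum T N N 0 0| <= C.
  apply: le_trans (walsh_sum_le N N 0 0 bT (fun z _ => TC z)) _.
  rewrite mulrCA ler_piMr// ler_pdivrMr// mul1r /= -/N.
  by rewrite lerDr (le_trans ler01).
have H1 : `|\sum_(k < l) eps k * walsh_sum (F (rk k)) N N 0 0| <= (st l).2.
  rewrite st2E; apply: le_trans (ler_norm_sum _ _ _) _; apply: ler_sum => k _.
  rewrite normrM (gtr0_norm (eps0 k)) ler_wpM2l ?(ltW (eps0 k))//.
have P1 : l%:R + (st l).2 + C <= `|eps l * walsh_sum (F (rk l)) N N 0 0|.
  by rewrite normrM (gtr0_norm (eps0 l)) mulrC -ler_pdivrMr.
rewrite fE.
set a := walsh_sum T N N 0 0 in T1 *; set b := \sum_(k < l) _ in H1 *.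
set c := eps l * _ in P1 *.
have := ler_normB (a + (b + c)) (a + b); rewrite addrA [a + b + c]addrC addrK.
have := ler_normD a b.
by lra.
Qed.

Lemma wvar_le_weight (R : realType) (w w' : nat -> R) (f : R * R -> R) K s :
  (forall n, (0 < n)%N -> w n <= w' n) -> wvar w f K s <= wvar w' f K s.
Proof.
move=> ww; elim: s K => //= t s IH K.
by rewrite lerD// ler_wpM2r ?jump_ge0// ww.
Qed.

Lemma series_wvar_le (R : realType) (w : nat -> R) (F : nat -> R * R -> R)
    (f : R * R -> R) (eps : nat -> R) (C V : R) (s : seq (atom R)) :
  (forall n, (0 < n)%N -> 0 <= w n) -> 0 <= C -> 0 <= V ->
  (forall k, 0 <= eps k <= 2 ^- k) ->
  (forall n z, `|f z - \sum_(k < n) eps k * F k z| <= C * 2 ^- n) ->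
  (forall k, wvar w (F k) 0 s <= V) -> wvar w f 0 s <= 2 * V.
Proof.
move=> w0 C0 V0 e0 fF FV; pose d : atom R := (0, 0, 0).
pose W := \sum_(l < size s) w l.+1.
have W0 : 0 <= W by apply: sumr_ge0 => l _; exact: w0.
apply/ler_addgt0Pr => e egt0.
have [n ne] : exists n, 2 ^- n < e / (2 * (C + 1) * (W + 1)).
  by apply: exp2_small; rewrite divr_gt0// !mulr_gt0// ltr_wpDl.
have jumps t : jump f t <= \sum_(k < n) eps k * jump (F k) t + 2 * (C * 2 ^- n).
  have h1 := fF n (t.1.2, t.2); have h2 := fF n (t.1.1, t.2).
  have h3 : `|\sum_(k < n) eps k * F k (t.1.2, t.2) -
      \sum_(k < n) eps k * F k (t.1.1, t.2)| <= \sum_(k < n) eps k * jump (F k) t.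
    rewrite -sumrB; apply: le_trans (ler_norm_sum _ _ _) _.
    apply: ler_sum => k _; rewrite -mulrBr normrM ger0_norm//.
    by have /andP[] := e0 k.
  rewrite /jump; move: h1 h2 h3; set a := \sum_(_ < _) _; set b := \sum_(_ < _) _.
  set D := \sum_(_ < _) _; rewrite !ler_norml.
  by move=> /andP[a1 a2] /andP[b1 b2] /andP[c1 c2]; apply/andP; split; lra.
rewrite (wvarE _ _ _ _ d).
apply: (@le_trans _ _ (\sum_(l < size s) w l.+1 *
    (\sum_(k < n) eps k * jump (F k) (nth d s l) + 2 * (C * 2 ^- n)))).
  by apply: ler_sum => l _; rewrite ler_wpM2l ?w0.
under eq_bigr do rewrite mulrDr.
rewrite big_split/= -mulr_suml -/W lerD//; last first.
  have : 2 ^- n * (2 * (C + 1) * (W + 1)) <= e.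
    by rewrite -ler_pdivlMr ?ltW// !mulr_gt0// ltr_wpDl.
  have n0 : 0 <= 2 ^- n :> R by rewrite invr_ge0 exprn_ge0.
  apply: le_trans; set h := 2 ^- n in n0 *.
  have := mulr_ge0 (mulr_ge0 C0 W0) n0.
  have := mulr_ge0 C0 n0; have := mulr_ge0 W0 n0; lra.
have -> : \sum_(l < size s) w l.+1 * (\sum_(k < n) eps k * jump (F k) (nth d s l)) =
    \sum_(k < n) eps k * wvar w (F k) 0 s.
  under eq_bigr do rewrite mulr_sumr.
  rewrite exchange_big; apply: eq_bigr => k _ /=.
  by rewrite (wvarE _ _ _ _ d) mulr_sumr; apply: eq_bigr => l _; rewrite mulrCA.
have geo m : \sum_(k < m) 2 ^- k <= 2 :> R.
  have := @geometric_tail R (fun k => 2 ^- k) 1 0 m.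
  rewrite big_ord0 subr0 expr0 invr1 mulr1 => /(_ _ (leq0n m)) h.
  have n0 : 0 <= 2 ^- m :> R by rewrite invr_ge0 exprn_ge0.
  apply: le_trans (ler_norm _) (le_trans (h _) _); last by lra.
  by move=> k _; rewrite mul1r ger0_norm// invr_ge0 exprn_ge0.
apply: le_trans (_ : \sum_(k < n) 2 ^- k * V <= _).
  apply: ler_sum => k _; have /andP[h1 h2] := e0 k.
  apply: le_trans (ler_wpM2l h1 (FV k)) _; exact: ler_wpM2r.
by rewrite -mulr_suml ler_wpM2r.
Qed.

Lemma series_continuous (R : realType) (F : nat -> R * R -> R)
    (f : R * R -> R) (eps : nat -> R) (C : R) :
  0 <= C -> (forall k, continuous (F k)) ->
  (forall n z, `|f z - \sum_(k < n) eps k * F k z| <= C * 2 ^- n) ->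
  continuous f.
Proof.
move=> C0 cF fF z; apply/cvgrPdist_le => e e0.
have e3 : 0 < e / 3 by rewrite divr_gt0.
have [n ne] : exists n, 2 ^- n < e / 3 / (C + 1).
  by apply: exp2_small; rewrite divr_gt0// ltr_wpDl.
have Cn : C * 2 ^- n <= e / 3.
  rewrite ltr_pdivlMr ?ltr_wpDl// in ne; apply: le_trans (ltW ne).
  by rewrite mulrC ler_wpM2l ?invr_ge0 ?exprn_ge0// lerDl.
have cS m : continuous (fun z => \sum_(k < m) eps k * F k z).
  elim: m => [|m IH] t.
    rewrite (_ : (fun _ => _) = cst 0); first exact: cvg_cst.
    by apply/funext => v; rewrite big_ord0.
  rewrite (_ : (fun _ => _) =
    fun v => \sum_(k < m) eps k * F k v + eps m * F m v); last first.
    by apply/funext => v; rewrite big_ord_recr.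
  apply: cvgD; first exact: IH.
  by apply: cvgM; [exact: cvg_cst | exact: cF].
have /cvgrPdist_le/(_ _ e3) := cS n z; apply: filterS => t.
have := fF n z; have := fF n t.
set a := \sum_(_ < _) _; set b := \sum_(_ < _) _.
rewrite !ler_norml => /andP[a1 a2] /andP[b1 b2] /andP[c1 c2].
by apply/andP; split; lra.
Qed.

Lemma lebesgue_measurable_borel (R : realType) (D : set (R * R))
    (f : R * R -> R) :
  measurable (D : set (measurableTypeR R * measurableTypeR R)) ->
  measurable_fun (D : set (measurableTypeR R * measurableTypeR R))
    (f : _ -> measurableTypeR R) -> lebesgue_measurable_fun D f.
Proof.
move=> mD mf _ Y mY; apply: sub_gen_smallest.
exists (D `&` f @^-1` Y); first exact: mf.
exists set0; first exact: negligible_set0.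
by rewrite setU0.
Qed.

(** * The two parts of the theorem *)

Lemma divergent_example (R : realType) (alpha : nat -> R) :
  (forall n, (0 < n)%N -> 0 < alpha n) -> alpha n @[n --> \oo] --> +oo ->
  exists f : R * R -> R,
    [/\ {within unitI2, continuous f},
        sharpBV (fun n => n%:R * alpha n / ln (n.+1)%:R) f &
        ereal_sup (range (fun N : nat => `|walsh_sum f N N 0 0|%:E)) = +oo%E].
Proof.
move=> a0 aoo; have [beta [ba bmono boo]] := monotone_minorant a0 aoo.
have b0 : positive_minorant beta by move=> n /ba /andP[].
set C := (logw 1 / beta 1%N)^-1.
have C0 : 0 <= C by rewrite invr_ge0 divr_ge0 ?logw_ge0// ltW ?b0.
have unb A : exists r N, A <= `|walsh_sum (peak beta r) N N 0 0|.
  have [r rA] := peak_unbounded b0 boo A.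
  by exists r, (bad_order r); apply: le_trans rA (peak_walsh_sum r b0).
have [eps [rk [f [e01 fF mf fdiv]]]] := gliding_hump
  (fun r z => peak_le r z b0) (fun r => peak_borel r b0)
  (fun r => peak_bounded r b0) unb.
have lam0 n : (0 < n)%N -> 0 <= n%:R * alpha n / ln n.+1%:R :> R.
  by move=> n0; rewrite divr_ge0 ?ln_ge0 ?ler1n// mulr_ge0// ltW// a0.
pose wb n : R := logw n / beta n.
have wb0 n : (0 < n)%N -> 0 <= wb n.
  by move=> n0; rewrite divr_ge0 ?logw_ge0// ltW ?b0.
have wbd m n : (0 < m <= n)%N -> wb n <= wb m.
  move=> /andP[m0 mn]; have n0 := leq_trans m0 mn.
  rewrite ler_pM ?logw_ge0 ?logw_noninc ?invr_ge0 ?(ltW (b0 _ _)) ?m0//.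
  by rewrite lef_pV2 ?posrE ?b0// bmono// m0.
have C20 : 0 <= 2 * C by rewrite mulr_ge0.
have var s : packing s ->
    wvar (fun n => (n%:R * alpha n / ln n.+1%:R)^-1) f 0 s <= 4 /\
    wvar (fun n => (n%:R * alpha n / ln n.+1%:R)^-1) (swap f) 0 s <= 4.
  move=> ps.
  have ww (g : R * R -> R) :
      wvar (fun n => (n%:R * alpha n / ln n.+1%:R)^-1) g 0 s <= wvar wb g 0 s.
    apply: wvar_le_weight => n n0; rewrite invf_div invfM mulrA /wb /logw.
    rewrite ler_wpM2l ?divr_ge0 ?ln_ge0 ?ler1n//.
    by have /andP[h1 h2] := ba _ n0; rewrite lef_pV2 ?posrE ?a0.
  have pk k : wvar wb (peak beta (rk k)) 0 s <= 2.
    apply: le_trans (peak_wvar (rk k) b0 wb0 wbd ps) _.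
    by rewrite -/(peak_weight beta (rk k)) mulfVK// gt_eqF// peak_weight_gt0.
  have four : 4 = 2 * 2 :> R by lra.
  split; apply: le_trans (ww _) _; rewrite four.
    exact: (series_wvar_le wb0 C20 (ler0n R 2) e01 fF pk).
  apply: (series_wvar_le wb0 C20 (ler0n R 2) e01 (F := fun k => peak beta (rk k))) => //.
  move=> n z; have := fF n (z.2, z.1); rewrite /swap.
  congr (`|_ - _| <= _); apply: eq_bigr => k _.
  by rewrite -[in LHS](peak_swap beta (rk k)).
exists f; split.
- apply: continuous_subspaceT.
  exact: (series_continuous C20 (fun k => @peak_continuous R beta (rk k)) fF).
- split; first exact: lebesgue_measurable_borel (@measurable_unitI2 R) mf.
  rewrite sharpV2_swap.
  have V1 := wvar_sharpV1 lam0 (fun s ps => (var s ps).1).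
  have V2 := wvar_sharpV1 lam0 (fun s ps => (var s ps).2).
  by apply: le_lt_trans (leeD V1 V2) _; rewrite -EFinD ltry.
- apply/eqyP => A _; have [N NA] := fdiv (Num.truncn A).+1.
  apply: (@le_trans _ _ `|walsh_sum f N N 0 0|%:E).
    by rewrite lee_fin (le_trans _ NA)// ltW// truncnS_gt.
  by apply: ereal_sup_ubound; exists N.
Qed.

Lemma sharpV1_ge0 (R : realType) (lambda : nat -> R) (f : R * R -> R) :
  (0 <= sharpV1 lambda f)%E.
Proof.
have I0 := unitI0 R.
apply: (@le_trans _ _ (ereal_sup [set \esum_(i in c.1)
    (`|f ((c.2 i).2, 0) - f ((c.2 i).1, 0)| / lambda i.+1)%:E | c in Omega])).
  apply: ereal_sup_ubound; exists (set0, fun=> (0, 0)) => /=; last first.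
    by rewrite esum_set0.
  by split => //=; right; exists 0%N; rewrite II0.
by apply: ereal_sup_ubound; exists (fun=> 0).
Qed.

Theorem theorem3p3 (R : realType) :
  (forall (f : R * R -> R) (x y : R),
     sharpBV (fun n => n%:R / ln (n.+1)%:R) f ->
     unitI2 (x, y) ->
     dyadic_continuous_at f x y ->
     walsh_sum f MN.1 MN.2 x y @[MN --> filter_prod \oo \oo] --> f (x, y)) /\
  (forall alpha : nat -> R,
     (forall n, (0 < n)%N -> 0 < alpha n) ->
     alpha n @[n --> \oo] --> +oo ->
     exists f : R * R -> R,
       [/\ {within unitI2, continuous f},
           sharpBV (fun n => n%:R * alpha n / ln (n.+1)%:R) f &
           ereal_sup (range (fun N : nat => `|walsh_sum f N N 0 0|%:E)) =
             +oo%E]).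
Proof.
split; last exact: divergent_example.
move=> f x y [_ Voo] [/= Ix Iy] fc.
have [V fV] : exists V, log_var_le f V.
  apply: sharpV1_log_var; apply: le_lt_trans Voo; rewrite leeDl//.
  by rewrite sharpV2_swap sharpV1_ge0.
have [V' fV'] : exists V, log_var_le (swap f) V.
  apply: sharpV1_log_var; rewrite -sharpV2_swap; apply: le_lt_trans Voo.
  by rewrite leeDr// sharpV1_ge0.
apply: (walsh_sum_cvg fV fV' Ix Iy) => e e0.
exact: (dyadic_continuous_cells fV fV' Ix Iy fc e0).
Qed.
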